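(* Let $K$ be an algebraically closed field of arbitrary characteristic. Let $F(x,y)$ be the free $K$-algebra with two generators $x,y$ in a Nielsen–Schreier variety of $K$-algebras defined by a homogeneous (with respect to each variable) system of polynomial identities. Let $c_n$ be the dimension of the vector space of all homogeneous polynomials $u(x)$ in one variable of degree $n$ in $F(x,y)$, and assume that $1=c_1=c_2\leq c_3\leq\cdots$. (i) The dimension of the set of automorphisms of degree $n$ of $F(x,y)$ is $$d_n=c_1+c_2+\cdots+c_n+4+2\varepsilon,$$ where $\varepsilon=1$ for unitary algebras and $\varepsilon=0$ for nonunitary algebras. (ii) For the free nonassociative algebra $K\{x,y\}$, the generating function of the sequence $d_n$ is $$d(t)=\sum_{n\geq 1}d_nt^n=\frac{1+4(2+\varepsilon)t-\sqrt{1-4t}}{2(1-t)}.$$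
   Context: Algebras over $K$ are not assumed associative or commutative. A variety of $K$-algebras is Nielsen–Schreier if every subalgebra of a free algebra of the variety is again free in the same variety. One works either with unitary algebras (free algebras contain $1$, and polynomials may have constant terms) or with nonunitary algebras (no constant terms). $K\{x,y\}$ is the free nonassociative algebra, i.e. the free algebra in the variety of all (unitary, respectively nonunitary) $K$-algebras. A $K$-automorphism $\varphi$ of $F(x,y)$ is written $\varphi=(f,g)$ with $f=\varphi(x)$, $g=\varphi(y)$. Its degree is $\deg(\varphi)=\max\{\deg(f),\deg(g)\}$, where $\deg$ is the total degree in $x,y$. The endomorphisms $(f,g)$ of degree $\leq n$ are identified with points of a finite-dimensional affine space over $K$ by taking the coordinates of $f$ and $g$ with respect to a fixed homogeneous basis of the space of elements of $F(x,y)$ of degree $\leq n$. The dimension of a set of automorphisms of bounded degree is the dimension of the corresponding set of points in the Zariski topology (equivalently, of its Zariski closure). The identity in (ii) is one of formal power series, with $\sqrt{1-4t}$ the power series with constant term $1$.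
   Formalization: The printed formula fails at n=1: degree-one automorphisms have dimension 4+2ε, not 5+2ε. So (i) is stated with 1 subtracted when n=1, and in (ii) the closed form is the generating function of d_n with 1 added to d_1; all n≥2 are as printed. *)

(* Defs.v *)
From HB Require Import structures.
From mathcomp Require Import all_boot all_order all_algebra.
From mathcomp Require Import finmap.
From mathcomp Require Import mpoly.

Set Implicit Arguments.
Unset Strict Implicit.
Unset Printing Implicit Defensive.

Import GRing.Theory.
Local Open Scope ring_scope.

(** [nalgType u K]: unitary ([u = true]) or nonunitary ([u = false]) algebras
    over [K], neither associative nor commutative in general.  In the
    nonunitary case [nunit] carries no information: it is forced to be [0], so
    that constant terms, which are absent from nonunitary polynomials, may
    harmlessly be evaluated, and preserving [nunit] is no condition. *)
HB.mixin Record Lmodule_isNAlgebra (u : bool) (K : nzRingType) A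
    of GRing.Lmodule K A := {
  nmul : A -> A -> A;
  nunit : A;
  nmulDl : forall a b c : A, nmul (a + b) c = nmul a c + nmul b c;
  nmulDr : forall a b c : A, nmul a (b + c) = nmul a b + nmul a c;
  nmulZl : forall (k : K) (a b : A), nmul (k *: a) b = k *: nmul a b;
  nmulZr : forall (k : K) (a b : A), nmul a (k *: b) = k *: nmul a b;
  nunitP : if u then (forall a : A, nmul nunit a = a) /\
                     (forall a : A, nmul a nunit = a)
           else nunit = 0
}.

#[short(type="nalgType")]
HB.structure Definition NAlgebra (u : bool) (K : nzRingType) :=
  {A of GRing.Lmodule K A & Lmodule_isNAlgebra u K A}.

Definition nalg_hom (u : bool) (K : nzRingType) (A B : nalgType u K)
    (h : A -> B) : Prop :=
  [/\ forall (k : K) (a b : A), h (k *: a + b) = k *: h a + h b,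
      forall a b : A, h (nmul a b) = nmul (h a) (h b)
    & h (nunit : A) = (nunit : B)].

Inductive word (X : Type) : Type :=
  | Letter of X
  | Join of word X & word X.

Fixpoint word_tree (X : Type) (w : word X) : GenTree.tree X :=
  match w with
  | Letter x => GenTree.Leaf x
  | Join w1 w2 => GenTree.Node 0 [:: word_tree w1; word_tree w2]
  end.

Fixpoint tree_word (X : Type) (t : GenTree.tree X) : option (word X) :=
  match t with
  | GenTree.Leaf x => Some (Letter x)
  | GenTree.Node _ [:: t1; t2] =>
      if (tree_word t1, tree_word t2) is (Some w1, Some w2)
      then Some (Join w1 w2) else None
  | _ => None
  end.

Lemma word_treeK (X : Type) : pcancel (@word_tree X) (@tree_word X).
Proof. by elim=> //= w1 -> w2 ->. Qed.

HB.instance Definition _ (X : choiceType) :=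
  Choice.copy (word X) (pcan_type (@word_treeK X)).

(** Monomials, [None] being the empty monomial [1]. *)
Notation mono X := (option (word X)).

Fixpoint word_deg (X : Type) (P : pred X) (w : word X) : nat :=
  match w with
  | Letter x => P x
  | Join w1 w2 => (word_deg P w1 + word_deg P w2)%N
  end.

(** Number of occurrences in [m] of letters satisfying [P]. *)
Definition mono_deg (X : Type) (P : pred X) (m : mono X) : nat :=
  if m is Some w then word_deg P w else 0%N.

Notation tot_deg m := (mono_deg predT m).
Notation part_deg i m := (mono_deg (pred1 i) m).

(** Elements of [K{X}], as finitely supported families of coefficients; those
    with no constant term are the nonunitary polynomials. *)
Notation napoly K X := {fsfun mono X -> K with 0%R}.

Definition napoly_of (u : bool) (K : nzRingType) (X : choiceType)
    (p : napoly K X) : Prop :=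
  u || (p None == 0).

Fixpoint word_eval (u : bool) (K : nzRingType) (A : nalgType u K) (X : Type)
    (v : X -> A) (w : word X) : A :=
  match w with
  | Letter x => v x
  | Join w1 w2 => nmul (word_eval v w1) (word_eval v w2)
  end.

Definition mono_eval (u : bool) (K : nzRingType) (A : nalgType u K) (X : Type)
    (v : X -> A) (m : mono X) : A :=
  if m is Some w then word_eval v w else nunit.

Definition napoly_eval (u : bool) (K : nzRingType) (A : nalgType u K)
    (X : choiceType) (v : X -> A) (p : napoly K X) : A :=
  \sum_(m <- finsupp p) p m *: mono_eval v m.

(** A system of polynomial identities is a set [I] of polynomials in the
    letters [nat]; it defines the variety of all [A : nalgType u K] such that
    [satisfies I A]. *)

Definition satisfies (u : bool) (K : nzRingType) (I : napoly K nat -> Prop)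
    (A : nalgType u K) : Prop :=
  forall p, I p -> forall v : nat -> A, napoly_eval v p = 0.

Definition multihomogeneous (K : nzRingType) (p : napoly K nat) : Prop :=
  forall m1 m2, m1 \in finsupp p -> m2 \in finsupp p ->
  forall i : nat, part_deg i m1 = part_deg i m2.

Definition homogeneous_system (u : bool) (K : nzRingType)
    (I : napoly K nat -> Prop) : Prop :=
  forall p, I p -> napoly_of u p /\ multihomogeneous p.

Definition free_on (u : bool) (K : nzRingType) (I : napoly K nat -> Prop)
    (X : Type) (F : nalgType u K) (v : X -> F) : Prop :=
  satisfies I F /\
  forall A : nalgType u K, satisfies I A -> forall g : X -> A,
    (exists2 h : F -> A, nalg_hom h & forall x, h (v x) = g x) /\
    (forall h1 h2 : F -> A, nalg_hom h1 -> nalg_hom h2 ->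
       (forall x, h1 (v x) = h2 (v x)) -> forall a, h1 a = h2 a).

(** Subalgebras of [F] are presented as algebras [B] with an injective
    homomorphism [j : B -> F] (the inclusion). *)
Definition nielsen_schreier (u : bool) (K : nzRingType)
    (I : napoly K nat -> Prop) : Prop :=
  forall (X : Type) (F : nalgType u K) (v : X -> F), free_on I v ->
  forall (B : nalgType u K) (j : B -> F), nalg_hom j -> injective j ->
  exists (Y : Type) (w : Y -> B), free_on I w.

Section Degree.
Variables (u : bool) (K : nzRingType) (F : nalgType u K) (X : choiceType).
Variable v : X -> F.

Definition homogeneous (n : nat) (f : F) : Prop :=
  exists2 p : napoly K X, (forall m, m \in finsupp p -> tot_deg m = n)
                       & f = napoly_eval v p.

Definition deg_le (n : nat) (f : F) : Prop :=
  exists2 p : napoly K X, (forall m, m \in finsupp p -> (tot_deg m <= n)%N)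
                       & f = napoly_eval v p.

Definition has_deg (f : F) (n : nat) : Prop :=
  deg_le n f /\ forall k, deg_le k f -> (n <= k)%N.

End Degree.

Definition is_basis (K : nzRingType) (V : lmodType K) (P : V -> Prop)
    (N : nat) (b : 'I_N -> V) : Prop :=
  (forall a : 'I_N -> K, \sum_i a i *: b i = 0 -> forall i, a i = 0) /\
  (forall f : V, P f <-> exists a : 'I_N -> K, f = \sum_i a i *: b i).

Definition has_dim (K : nzRingType) (V : lmodType K) (P : V -> Prop)
    (d : nat) : Prop :=
  exists b : 'I_d -> V, is_basis P b.

Definition pair_gen (T : Type) (x y : T) (i : bool) : T := if i then y else x.

Definition homog_basis (u : bool) (K : nzRingType) (F : nalgType u K)
    (x y : F) (n N : nat) (b : 'I_N -> F) : Prop :=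
  is_basis (deg_le (pair_gen x y) n) b /\
  forall i, exists k, homogeneous (pair_gen x y) k (b i).

Definition is_automorphism (u : bool) (K : nzRingType) (F : nalgType u K)
    (x y f g : F) : Prop :=
  exists phi : F -> F, [/\ nalg_hom phi, bijective phi, phi x = f & phi y = g].

Definition has_aut_deg (u : bool) (K : nzRingType) (F : nalgType u K)
    (x y f g : F) (n : nat) : Prop :=
  exists k l : nat, [/\ has_deg (pair_gen x y) f k,
                        has_deg (pair_gen x y) g l & n = maxn k l].

(** The points of the affine space of dimension [N + N] (coordinates of [f],
    then coordinates of [g]) given by the automorphisms [(f, g)] of degree
    [n]. *)
Definition aut_points (u : bool) (K : nzRingType) (F : nalgType u K)
    (x y : F) (n N : nat) (b : 'I_N -> F) (p : 'rV[K]_(N + N)) : Prop :=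
  let f := \sum_(i < N) lsubmx p 0 i *: b i in
  let g := \sum_(i < N) rsubmx p 0 i *: b i in
  is_automorphism x y f g /\ has_aut_deg x y f g n.

Section Zariski.
Variables (K : fieldType) (M : nat).
Implicit Types Z S : 'rV[K]_M -> Prop.

Definition zclosed Z : Prop :=
  exists E : {mpoly K[M]} -> Prop,
    forall p, Z p <-> forall q, E q -> q.@[fun i => p 0 i] = 0.

Definition zclosure S : 'rV[K]_M -> Prop :=
  fun p => forall Z, zclosed Z -> (forall q, S q -> Z q) -> Z p.

Definition zirreducible Z : Prop :=
  (exists p, Z p) /\
  forall Z1 Z2, zclosed Z1 -> zclosed Z2 -> (forall p, Z p -> Z1 p \/ Z2 p) ->
    (forall p, Z p -> Z1 p) \/ (forall p, Z p -> Z2 p).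

(** A chain [Z 0 < Z 1 < ... < Z d] of irreducible closed subsets of the
    closure of [S]. *)
Definition zchain S (d : nat) : Prop :=
  exists Z : nat -> 'rV[K]_M -> Prop,
    (forall i, (i <= d)%N ->
       [/\ zclosed (Z i), zirreducible (Z i)
         & forall p, Z i p -> zclosure S p]) /\
    (forall i, (i < d)%N ->
       (forall p, Z i p -> Z i.+1 p) /\ exists2 p, Z i.+1 p & ~ Z i p).

Definition zdim S (d : nat) : Prop :=
  zchain S d /\ forall k, zchain S k -> (k <= d)%N.

End Zariski.

Definition fps_mul (a b : nat -> rat) (n : nat) : rat :=
  \sum_(i < n.+1) a i * b (n - i)%N.

Definition fps_poly (p : {poly rat}) (n : nat) : rat := p`_n.

(** [s = sqrt (1 - 4 t)], with constant term [1]. *)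
Definition is_sqrt_1_4t (s : nat -> rat) : Prop :=
  s 0%N = 1 /\ forall n, fps_mul s s n = fps_poly (1 - 4%:R *: 'X) n.

(* Main.v *)
Require Import Defs.
From mathcomp Require Import all_boot all_order all_algebra.
From HB Require Import structures.
From mathcomp Require Import finmap mpoly boolp functions zify ring.

Set Implicit Arguments.
Unset Strict Implicit.
Unset Printing Implicit Defensive.

Import GRing.Theory.
Local Open Scope ring_scope.

(** Let [F] be the free algebra on [x], [y].  As [K] is infinite, rescaling the
    generators shows that [F] is graded for any choice of weights of [x], [y].

    In a Nielsen-Schreier variety the image of an endomorphism [E] of [F] is
    free, hence projective: [E = E p] for some endomorphism [p] that kills
    [ker E].  If no element of [ker E] has a nonzero linear part, then [p] is
    the identity plus terms of higher degree, so [p], and therefore [E], is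
    injective.  Hence two homogeneous elements, neither of which is a polynomial
    in the other, are free generators of a subalgebra, and the leading forms of
    an automorphism [(f, g)] of degree [n > 1] cannot be of this kind: if
    [deg f = n > b = deg g], then [b] divides [n] and [f = f' + w(g)] with
    [deg f' <= b] and [w] in the span of the [c_2 + ... + c_(n/b)] polynomials in
    one variable of degrees [2 .. n/b].  By induction the automorphisms of
    degree [n] are covered by finitely many polynomial families, whose numbers
    of parameters are bounded thanks to
    [(c_1 + ... + c_a) + (c_1 + ... + c_b) <= c_1 + ... + c_(ab)].
    A chain of [k] irreducible sets yields [k] algebraically independent
    functions, so a family with [d] parameters has dimension at most [d].

    The bound is attained by the pairs
      [g = c x + d y + e + w(l)],  [f = a l + e' + alpha g],  [l = x + b y],
    whose parameters can be read off successively by polynomials in the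
    coordinates of [(f, g)]; this produces a flag of irreducible closed sets. *)

(** * Polynomial functions and algebraic dependence *)

Section Infinite.
Variable K : closedFieldType.

Lemma closed_notin (s : seq K) : exists x, x \notin s.
Proof.
case: s => [|a s]; first by exists 0.
set p := \prod_(b <- a :: s) ('X - b%:P).
have sp1 : size p = (size s).+2 by rewrite size_prod_XsubC.
have sp : size (p + 1) != 1%N.
  by rewrite size_polyDl ?sp1 // size_poly1.
have [x /rootP px] := closed_rootP _ sp; exists x.
apply: contraTN (oner_neq0 K) => xs; rewrite negbK.
move: px; rewrite hornerD hornerC.
by rewrite (rootP _) ?add0r => [/eqP //|]; rewrite root_prod_XsubC.
Qed.

Lemma poly_neq0_eval (p : {poly K}) : p != 0 -> exists x, p.[x] != 0.
Proof.
move=> p0; have [r pE] := closed_field_poly_normal p.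
have [x xr] := closed_notin r; exists x.
rewrite pE hornerZ mulf_neq0 ?lead_coef_eq0 //.
by rewrite -rootE root_prod_XsubC.
Qed.

Lemma distinct_seq n : exists2 s : seq K, size s = n & uniq s.
Proof.
elim: n => [|n [s ss us]]; first by exists [::].
by have [x xs] := closed_notin s; exists (x :: s); rewrite /= ?ss ?xs.
Qed.

End Infinite.

Section Pol.
Variable K : closedFieldType.

Definition pol (T : finType) (h : (T -> K) -> K) : Prop :=
  exists q : {mpoly K[#|T|]}, forall t, h t = q.@[fun i => t (enum_val i)].

Lemma pol_cst (T : finType) c : pol (fun _ : T -> K => c).
Proof. by exists c%:MP => t; rewrite mevalC. Qed.

Lemma pol_var (T : finType) (i : T) : pol (fun t => t i).
Proof. by exists 'X_(enum_rank i) => t; rewrite mevalXU enum_rankK. Qed.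

Lemma pol_add (T : finType) h1 h2 :
  pol h1 -> pol h2 -> pol (fun t : T -> K => h1 t + h2 t).
Proof. by case=> q1 H1 [q2 H2]; exists (q1 + q2) => t; rewrite mevalD H1 H2. Qed.

Lemma pol_mul (T : finType) h1 h2 :
  pol h1 -> pol h2 -> pol (fun t : T -> K => h1 t * h2 t).
Proof. by case=> q1 H1 [q2 H2]; exists (q1 * q2) => t; rewrite mevalM H1 H2. Qed.

Lemma pol_ext (T : finType) (h1 h2 : (T -> K) -> K) :
  h1 =1 h2 -> pol h1 -> pol h2.
Proof. by move=> e [q H]; exists q => t; rewrite -e H. Qed.

Lemma pol_sub (T : finType) h1 h2 :
  pol h1 -> pol h2 -> pol (fun t : T -> K => h1 t - h2 t).
Proof.
move=> p1 p2; apply: pol_ext (pol_add p1 (pol_mul (pol_cst T (-1)) p2)) => t.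
by rewrite mulN1r.
Qed.

Lemma pol_sum (T : finType) (I : Type) (r : seq I) (P : pred I)
    (h : I -> (T -> K) -> K) :
  (forall i, pol (h i)) -> pol (fun t => \sum_(i <- r | P i) h i t).
Proof.
move=> ph; elim: r => [|i r IH].
  by apply: pol_ext (pol_cst T 0) => t; rewrite big_nil.
case Pi: (P i).
  by apply: pol_ext (pol_add (ph i) IH) => t; rewrite big_cons Pi.
by apply: pol_ext IH => t; rewrite big_cons Pi.
Qed.

Lemma pol_exp (T : finType) (h : (T -> K) -> K) n :
  pol h -> pol (fun t => h t ^+ n).
Proof.
move=> ph; elim: n => [|n IH]; first exact: pol_cst.
by apply: pol_ext (pol_mul ph IH) => t; rewrite exprS.
Qed.

Lemma pol_prod (T : finType) (I : Type) (r : seq I) (h : I -> (T -> K) -> K) :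
  (forall i, pol (h i)) -> pol (fun t => \prod_(i <- r) h i t).
Proof.
move=> ph; elim: r => [|i r IH].
  by apply: pol_ext (pol_cst T 1) => t; rewrite big_nil.
by apply: pol_ext (pol_mul (ph i) IH) => t; rewrite big_cons.
Qed.

Lemma pol_comp (T : finType) n (q : {mpoly K[n]}) (h : 'I_n -> (T -> K) -> K) :
  (forall i, pol (h i)) -> pol (fun t => q.@[fun i => h i t]).
Proof.
move=> ph; apply: (@pol_ext _ (fun t =>
  \sum_(m <- msupp q) q@_m * \prod_i h i t ^+ m i)).
  by move=> t; rewrite mevalE.
apply: pol_sum => m; apply: pol_mul; first exact: pol_cst.
by apply: pol_prod => i; apply: pol_exp.
Qed.

Lemma pol_comp2 (T U : finType) (h : (T -> K) -> K) (g : (U -> K) -> T -> K) :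
  pol h -> (forall i, pol (fun t => g t i)) -> pol (fun t => h (g t)).
Proof.
case=> q hq pg.
apply: (@pol_ext _ (fun t => q.@[fun i => g t (enum_val i)])) => [t|].
  by rewrite hq.
by apply: (pol_comp q (h := fun i t => g t (enum_val i))).
Qed.

Lemma pol_line (T : finType) (h : (T -> K) -> K) (a b : T -> K) : pol h ->
  exists p : {poly K}, forall s, p.[s] = h (fun i => a i + s * (b i - a i)).
Proof.
case=> q hq.
exists (\sum_(m <- msupp q) (q@_m)%:P *
  \prod_i ((a (enum_val i))%:P + 'X * (b (enum_val i) - a (enum_val i))%:P) ^+ m i).
move=> s; rewrite hq mevalE horner_sum; apply: eq_bigr => m _.
rewrite hornerM hornerC horner_prod; congr (_ * _); apply: eq_bigr => i _.
by rewrite horner_exp !hornerE.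
Qed.

Lemma pol_common (T : finType) (h1 h2 : (T -> K) -> K) a b :
  pol h1 -> pol h2 -> h1 a != 0 -> h2 b != 0 ->
  exists t, h1 t != 0 /\ h2 t != 0.
Proof.
move=> p1 p2 h1a h2b.
have [q1 e1] := pol_line a b p1; have [q2 e2] := pol_line a b p2.
have la : (fun i => a i + 0 * (b i - a i)) = a.
  by apply/funext => i; rewrite mul0r addr0.
have lb : (fun i => a i + 1 * (b i - a i)) = b.
  by apply/funext => i; rewrite mul1r addrC subrK.
have q1n : q1 != 0 by apply: contraNneq h1a => z; rewrite -la -e1 z horner0.
have q2n : q2 != 0 by apply: contraNneq h2b => z; rewrite -lb -e2 z horner0.
have [s] := poly_neq0_eval (mulf_neq0 q1n q2n).
rewrite hornerM mulf_eq0 negb_or e1 e2 => /andP[s1 s2].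
by exists (fun i => a i + s * (b i - a i)).
Qed.

End Pol.

Section Dependence.
Variable K : fieldType.

Lemma msizeX_le m (q : {mpoly K[m]}) s j :
  (msize q <= s)%N -> (msize (q ^+ j) <= j * s.+1 + 1)%N.
Proof.
move=> qs; elim: j => [|j IH]; first by rewrite expr0 msize1.
rewrite exprS; apply: leq_trans (msizeM_le _ _) _.
rewrite mulSn -addnA -addSn leq_add //.
Qed.

Lemma msize_prod_le m k (q : 'I_k -> {mpoly K[m]}) s :
  (forall i, msize (q i) <= s)%N -> (msize (\prod_i q i) <= k * s.+1 + 1)%N.
Proof.
elim: k q => [|k IH] q qs; first by rewrite big_ord0 msize1.
rewrite big_ord_recl; apply: leq_trans (msizeM_le _ _) _.
rewrite mulSn -addnA -addSn leq_add //.
  by rewrite ltnS.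
by apply: (IH (fun i => q (lift ord0 i))).
Qed.

Lemma msize_sum_le m (I : finType) (q : I -> {mpoly K[m]}) s :
  (forall i, msize (q i) <= s)%N -> (msize (\sum_i q i) <= s)%N.
Proof.
move=> qs; apply: (big_ind (fun p : {mpoly K[m]} => msize p <= s)%N).
- by rewrite msize0.
- by move=> p1 p2 h1 h2; apply: leq_trans (msizeD_le _ _) _; rewrite geq_max h1.
- by [].
Qed.

(** The [D ^ k] monomials of partial degrees [< D] in the [q i] live in a space
    of dimension [(C * D) ^ m], which is smaller as soon as [C ^ m < D]. *)
Lemma mpoly_dependent m k (q : 'I_k -> {mpoly K[m]}) : (m < k)%N ->
  exists2 P : {mpoly K[k]}, P != 0 &
    forall t, P.@[fun i => (q i).@[t]] = 0.
Proof.
move=> mk.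
pose s := \max_i msize (q i).
pose C := (k * s.+3 + 1)%N; pose D := (C ^ m).+1; pose B := (C * D)%N.
pose E := {ffun 'I_k -> 'I_D}; pose G := {ffun 'I_m -> 'I_B}.
pose Q (e : E) : {mpoly K[m]} := \prod_i q i ^+ e i.
have Qs e : (msize (Q e) <= B)%N.
  have h i : (msize (q i ^+ e i) <= D * s.+1 + 1)%N.
    apply: leq_trans (msizeX_le (s := s) _ (leq_bigmax (F := fun i => msize (q i)) i)) _.
    by rewrite leq_add2r leq_mul2r ltnW ?orbT.
  apply: leq_trans (msize_prod_le h) _; rewrite /B /C mulnDl mul1n.
  rewrite leq_add // -mulnA leq_mul2l -[s.+3]addn2 mulnDl (mulnC _ D).
  by rewrite -addnS leq_add2l leq_pmulr ?orbT.
pose mn (g : G) : 'X_{1..m} := [multinom (g i : nat) | i < m].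
pose A : 'M[K]_(#|E|, #|G|) := \matrix_(e, g) (Q (enum_val e))@_(mn (enum_val g)).
have rA : (\rank A < #|E|)%N.
  apply: leq_ltn_trans (rank_leq_col _) _.
  rewrite !card_ffun !card_ord /B expnMn.
  apply: (@leq_trans (D ^ m.+1)); last by rewrite leq_pexp2l.
  by rewrite expnS ltn_pmul2r ?expn_gt0.
have /rowV0Pn[v /sub_kermxP vA v0] : kermx A != 0.
  by rewrite -mxrank_eq0 mxrank_ker subn_eq0 -ltnNge.
pose em (e : E) : 'X_{1..k} := [multinom (e i : nat) | i < k].
have em_inj : injective em.
  move=> e1 e2 h; apply/ffunP => i; apply/val_inj.
  by move/mnmP/(_ i): h; rewrite !mnmE.
exists (\sum_e v 0 e *: 'X_[em (enum_val e)]).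
  apply: contraNneq v0 => P0; apply/eqP/rowP => e; rewrite mxE.
  move/(congr1 (mcoeff (em (enum_val e)))): P0; rewrite mcoeff0 raddf_sum /=.
  rewrite (bigD1 e) //= mcoeffZ mcoeffX eqxx mulr1 big1 ?addr0 // => e' ne.
  rewrite mcoeffZ mcoeffX (inj_eq em_inj) (inj_eq enum_val_inj) (negPf ne).
  by rewrite mulr0.
have R0 : \sum_e v 0 e *: Q (enum_val e) = 0.
  set R := LHS; apply/mpolyP => mm; rewrite mcoeff0; apply/eqP.
  have [mB|mB] := ltnP (mdeg mm) B; last first.
    rewrite mcoeff_eq0; apply/negP => /msize_mdeg_lt; rewrite ltnNge.
    rewrite (leq_trans _ mB) // msize_sum_le // => e.
    exact: leq_trans (msizeZ_le _ _) (Qs _).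
  have mi i : (mm i < B)%N.
    apply: leq_ltn_trans mB; rewrite mdegE (bigD1 i) //=; exact: leq_addr.
  pose g : G := [ffun i => Ordinal (mi i)].
  have -> : mm = mn g by apply/mnmP => i; rewrite mnmE ffunE.
  move/rowP/(_ (enum_rank g)): vA; rewrite !mxE => vA0.
  rewrite -[X in _ == X]vA0 raddf_sum; apply/eqP/eq_bigr => e _.
  by rewrite /= mcoeffZ mxE enum_rankK.
move=> t; rewrite -[RHS](meval0 t) -R0 !raddf_sum /=; apply: eq_bigr => e _.
rewrite !mevalZ mevalX; congr (_ * _).
rewrite /Q rmorph_prod; apply: eq_bigr => i _.
by rewrite rmorphXn /= mnmE.
Qed.

Definition mnm_widen_init n (m : 'X_{1..n.+1}) : 'X_{1..n} :=
  [multinom m (widen_ord (leqnSn n) i) | i < n].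

Lemma muni_inj n (p : {mpoly K[n.+1]}) : muni p = 0 -> p = 0.
Proof.
move=> p0; apply/mpolyP => m; rewrite mcoeff0; apply/eqP.
apply/negPn/negP; rewrite -mcoeff_msupp => ms.
move: (congr1 (fun r : {poly {mpoly K[n]}} =>
  (r`_(m ord_max))@_(mnm_widen_init m)) p0).
rewrite muniE coef0 mcoeff0 coef_sum raddf_sum /=.
rewrite (bigD1_seq m) ?msupp_uniq //= coefZ coefXn eqxx mulr1.
rewrite mcoeffZ mcoeffX eqxx mulr1 big1 ?addr0.
  by move/eqP; apply/negP; rewrite -mcoeff_msupp.
move=> m' ne; rewrite coefZ coefXn; case: eqP => [emax|]; last first.
  by rewrite mulr0 mcoeff0.
rewrite mulr1 mcoeffZ mcoeffX; case: eqP => [einit|]; last by rewrite mulr0.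
case/eqP: ne; apply/mnmP => i.
case: (unliftP ord_max i) => [j|] -> //.
have -> : lift ord_max j = widen_ord (leqnSn n) j.
  by apply/val_inj; rewrite /= /bump leqNgt ltn_ord.
by move/mnmP/(_ j): einit; rewrite !mnmE.
Qed.

Lemma meval_muni n (p : {mpoly K[n.+1]}) (v : 'I_n.+1 -> K) :
  p.@[v] = (map_poly (meval (fun i => v (widen_ord (leqnSn n) i))) (muni p)).[v ord_max].
Proof.
rewrite mevalE muniE raddf_sum /= horner_sum; apply: eq_bigr => m _.
rewrite map_polyZ /= hornerZ map_polyXn hornerXn mevalZ mevalX big_ord_recr /=.
rewrite mulrA; congr (_ * _ * _); apply: eq_bigr => i _.
by rewrite mnmE.
Qed.

End Dependence.

(** * Dimension of constructible families *)

Section Upper.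
Variables (K : closedFieldType) (M : nat).
Implicit Types (Z S : 'rV[K]_M -> Prop) (q : {mpoly K[M]}) (p : 'rV[K]_M).

Definition peval q p := q.@[fun i => p 0 i].

Lemma zclosed1 q : zclosed (fun p => peval q p = 0).
Proof. by exists (fun r => r = q) => p; split=> [h r ->|h]; last exact: h. Qed.

Lemma zclosure_peval S q p :
  zclosure S p -> (forall r, S r -> peval q r = 0) -> peval q p = 0.
Proof. by move=> cp h; apply: (cp _ (zclosed1 q)). Qed.

Lemma zirreducible_mul Z q1 q2 : zirreducible Z ->
  (forall p, Z p -> peval q1 p * peval q2 p = 0) ->
  (forall p, Z p -> peval q1 p = 0) \/ (forall p, Z p -> peval q2 p = 0).
Proof.
case=> _ irr h; apply: irr (zclosed1 q1) (zclosed1 q2) _ => p Zp.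
by have /eqP := h p Zp; rewrite mulf_eq0 => /orP[]/eqP; [left|right].
Qed.

Lemma zclosed_separate Z p : zclosed Z -> ~ Z p ->
  exists2 q, (forall r, Z r -> peval q r = 0) & peval q p <> 0.
Proof.
case=> E hE nZp; apply: contrapT => h; apply: nZp; apply/hE => q Eq.
apply: contrapT => qp; apply: h; exists q => // r /hE; exact.
Qed.

Lemma zchain_independent k (Z : nat -> 'rV[K]_M -> Prop) :
  (forall i, (i <= k)%N -> zclosed (Z i) /\ zirreducible (Z i)) ->
  (forall i, (i < k)%N ->
    (forall p, Z i p -> Z i.+1 p) /\ exists2 p, Z i.+1 p & ~ Z i p) ->
  exists f : nat -> {mpoly K[M]}, forall P : {mpoly K[k]},
    (forall p, Z k p -> P.@[fun i : 'I_k => peval (f i) p] = 0) -> P = 0.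
Proof.
elim: k => [|k IH] hZ hs.
  exists (fun=> 0) => P h; have [[p Zp] _] := (hZ 0%N isT).2.
  move: (h p Zp); rewrite mevalE => /= h0.
  apply/mpolyP => m; rewrite mcoeff0; apply/eqP/negPn/negP.
  rewrite -mcoeff_msupp => ms; move: h0.
  rewrite (bigD1_seq m) ?msupp_uniq //= big_ord0 mulr1 big1 ?addr0.
    by move/eqP; apply/negP; rewrite -mcoeff_msupp.
  by move=> m' /eqP[]; apply/mnmP => -[].
have [|i ik|f hf] := IH.
- by move=> i ik; apply: hZ; apply: leqW.
- by apply: hs; apply: leqW.
have [sub [p0 Zp0 nZp0]] := hs k (ltnSn k).
have [q q0 qp0] := zclosed_separate (hZ k (leqnSn k)).1 nZp0.
pose g i := if (i < k)%N then f i else q; exists g => P hP.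
apply: muni_inj; move: hP.
have -> : (forall p, Z k.+1 p -> P.@[fun i : 'I_k.+1 => peval (g i) p] = 0) =
  (forall p, Z k.+1 p -> (map_poly (meval (fun i : 'I_k => peval (f i) p))
     (muni P)).[peval q p] = 0).
  apply: eq_forall => p; congr (_ -> _ = _); rewrite meval_muni /g /= ltnn.
  congr (map_poly (meval _) _).[_]; apply/funext => i /=.
  by rewrite ltn_ord.
elim/poly_ind: (muni P) => {P} [//|P c IHP] h.
have h' p : Z k.+1 p ->
    (map_poly (meval (fun i : 'I_k => peval (f i) p)) P).[peval q p] * peval q p
    + c.@[fun i : 'I_k => peval (f i) p] = 0.
  by move=> Zp; rewrite -(h p Zp) rmorphD rmorphM /= map_polyX map_polyC /= !hornerE.
have c0 : c = 0.
  apply: hf => p Zp; move: (h' p (sub p Zp)).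
  by rewrite q0 // mulr0 add0r.
suff -> : P = 0 by rewrite mul0r add0r c0.
apply: IHP => p Zp.
pose r := \sum_(i < size P) (P`_i \mPo [tuple f j | j < k]) * q ^+ i.
have rE s : peval r s =
    (map_poly (meval (fun i : 'I_k => peval (f i) s)) P).[peval q s].
  rewrite /peval /r raddf_sum /= (horner_coef_wide _ (size_poly _ _)).
  apply: eq_bigr => i _; rewrite mevalM rmorphXn /= coef_map /=; congr (_ * _).
  by rewrite comp_mpoly_meval; apply: meval_eq => j; rewrite tnth_mktuple.
rewrite -rE.
have [|//|qz] := @zirreducible_mul (Z k.+1) r q (hZ _ (leqnn _)).2; last first.
  by case: qp0; apply: qz.
- by move=> hh; apply: hh.
- by move=> s Zs; rewrite rE -[RHS](h' s Zs) c0 meval0 addr0.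
Qed.

Definition polymap (T : finType) (phi : (T -> K) -> 'rV[K]_M) : Prop :=
  forall i, pol (fun t => phi t 0 i).

Lemma zchain_dependent S k d : zchain S k ->
  (forall f : nat -> {mpoly K[M]}, (d < k)%N -> exists2 P : {mpoly K[k]}, P != 0 &
     forall p, S p -> P.@[fun i : 'I_k => peval (f i) p] = 0) ->
  (k <= d)%N.
Proof.
case=> Z [hZ hs] dep; rewrite leqNgt; apply/negP => dk.
have [|//|f hf] := @zchain_independent k Z.
  by move=> i ik; have [] := hZ i ik.
have [P /eqP P0 hP] := dep f dk; apply: P0; apply: hf => p Zp.
have [_ _ /(_ p Zp) cl] := hZ k (leqnn k).
pose r := P \mPo [tuple f j | j < k].
have rE s : peval r s = P.@[fun i : 'I_k => peval (f i) s].
  rewrite /peval /r comp_mpoly_meval.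
  by apply: meval_eq => j; rewrite tnth_mktuple.
rewrite -rE; apply: zclosure_peval cl _ => s /hP; by rewrite rE.
Qed.

Lemma polymap_dependent (T : finType) (phi : (T -> K) -> 'rV[K]_M) k
    (f : nat -> {mpoly K[M]}) : polymap phi -> (#|T| < k)%N ->
  exists2 P : {mpoly K[k]}, P != 0 &
    forall t, P.@[fun i : 'I_k => peval (f i) (phi t)] = 0.
Proof.
move=> pp Tk.
have pf i : pol (fun t => peval (f i) (phi t)) by apply: pol_comp.
have [q qE] : exists q : nat -> {mpoly K[#|T|]}, forall i t,
    peval (f i) (phi t) = (q i).@[fun j => t (enum_val j)].
  have [q hq] := choice pf; by exists q.
have [P P0 hP] := mpoly_dependent (fun i : 'I_k => q i) Tk.
exists P => // t; rewrite -[RHS](hP (fun j => t (enum_val j))).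
by apply: meval_eq => i; rewrite qE.
Qed.

End Upper.

Section Lower.
Variables (K : closedFieldType) (M : nat) (T : finType).
Variables (S : 'rV[K]_M -> Prop) (phi : (T -> K) -> 'rV[K]_M).
Variables (D : (T -> K) -> K) (P : T -> {mpoly K[M]}) (Q : T -> (T -> K) -> K).
Hypothesis phi_pol : polymap phi.
Hypothesis D_pol : pol D.
Hypothesis D0 : D (fun=> 0) != 0.
Hypothesis DS : forall t, D t != 0 -> S (phi t).
Hypothesis PQ : forall i t, peval (P i) (phi t) = t i * Q i t.
Hypothesis Q_pol : forall i, pol (Q i).
Hypothesis Q0 : forall i, Q i (fun=> 0) != 0.

Definition flag (k : nat) (t : T -> K) : T -> K :=
  fun i => if (enum_rank i < k)%N then t i else 0.

Lemma flag_pol k i : pol (fun t => flag k t i).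
Proof. by rewrite /flag; case: ltnP => _; [exact: pol_var|exact: pol_cst]. Qed.

Definition flagZ k := zclosure (fun p => exists t, p = phi (flag k t)).

Lemma zclosed_zclosure (X : 'rV[K]_M -> Prop) : zclosed (zclosure X).
Proof.
exists (fun q => forall r, X r -> peval q r = 0) => p; split=> [cp q hq|h].
  exact: zclosure_peval cp hq.
move=> Z [E hE] XZ; apply/hE => q Eq; apply: h => r /XZ /hE; exact.
Qed.

Lemma pol_peval q k : pol (fun t => peval q (phi (flag k t))).
Proof.
apply: (@pol_comp2 K T T (fun t => peval q (phi t))); last exact: flag_pol.
exact: (pol_comp q (h := fun i t => phi t 0 i)).
Qed.

Lemma flagZ_irreducible k : zirreducible (flagZ k).
Proof.
split; first by exists (phi (flag k (fun=> 0))) => Z _; apply; exists (fun=> 0).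
move=> Z1 Z2 c1 c2 cov.
have sub Z (cZ : zclosed Z) : (forall t, Z (phi (flag k t))) ->
    forall p, flagZ k p -> Z p.
  by move=> h p /(_ Z cZ); apply=> _ [t ->].
have [h1|n1] := pselect (forall t, Z1 (phi (flag k t))); first by left; apply: sub.
have [h2|n2] := pselect (forall t, Z2 (phi (flag k t))); first by right; apply: sub.
have [a na] : exists a, ~ Z1 (phi (flag k a)) by apply/existsNP.
have [b nb] : exists b, ~ Z2 (phi (flag k b)) by apply/existsNP.
have [q1 z1 /eqP e1] := zclosed_separate c1 na.
have [q2 z2 /eqP e2] := zclosed_separate c2 nb.
have [t [t1 t2]] := pol_common (pol_peval q1 k) (pol_peval q2 k) e1 e2.
have [|/z1/eqP|/z2/eqP] := cov (phi (flag k t)).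
- by move=> Z _; apply; exists t.
- by rewrite (negPf t1).
- by rewrite (negPf t2).
Qed.

Lemma flagZ_mono k p : flagZ k p -> flagZ k.+1 p.
Proof.
move=> h Z cZ hZ; apply: h => // _ [t ->]; apply: hZ; exists (flag k t).
by congr phi; apply/funext => i; rewrite /flag ltnS; case: ltnP => [/ltnW->|]; rewrite ?if_same.
Qed.

Lemma flagZ_closure k p : flagZ k p -> zclosure S p.
Proof.
move=> h Z cZ hZ; apply: h => // _ [t ->].
apply: contrapT => nZ; have [q z /eqP e] := zclosed_separate cZ nZ.
have pq : pol (fun t => peval q (phi t)).
  exact: (pol_comp q (h := fun i t => phi t 0 i)).
have [s [s1 s2]] := pol_common pq D_pol e D0.
by case/eqP: s1; apply: z; apply: hZ; apply: DS.
Qed.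

Lemma flagZ_strict k : (k < #|T|)%N -> exists2 p, flagZ k.+1 p & ~ flagZ k p.
Proof.
move=> kT; pose i := enum_val (Ordinal kT).
have ri : enum_rank i = k :> nat by rewrite enum_valK.
pose h t := t i * Q i (flag k.+1 t).
have pQ : pol (fun t => Q i (flag k.+1 t)).
  exact: (pol_comp2 (Q_pol i) (flag_pol k.+1)).
have z : flag k.+1 (fun=> 0) = fun=> 0.
  by apply/funext => j; rewrite /flag if_same.
have [t [t1 t2]] := @pol_common K T (fun t => t i) _ (fun=> 1) (fun=> 0)
   (pol_var K i) pQ (oner_neq0 _) (etrans (congr1 (fun x => Q i x != 0) z) (Q0 i)).
exists (phi (flag k.+1 t)); first by move=> Z _; apply; exists t.
move=> /(zclosure_peval (q := P i)) h0.
have : peval (P i) (phi (flag k.+1 t)) = 0.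
  by apply: h0 => _ [s ->]; rewrite PQ /flag ri ltnn mul0r.
rewrite PQ {1}/flag ri ltnSn => /eqP; by rewrite mulf_eq0 (negPf t1) (negPf t2).
Qed.

Lemma flag_zchain : zchain S #|T|.
Proof.
exists flagZ; split=> k kT.
  split; [exact: zclosed_zclosure|exact: flagZ_irreducible|].
  exact: flagZ_closure.
by split; [exact: flagZ_mono|exact: flagZ_strict].
Qed.

End Lower.

(** * Homomorphisms, evaluations and subalgebras *)

Section Algebra.
Variables (u : bool) (K : nzRingType).
Implicit Types A B C : nalgType u K.

Lemma nmul0l A (a : A) : nmul 0 a = 0.
Proof. by apply: (addrI (nmul 0 a)); rewrite -nmulDl !addr0. Qed.

Lemma nmul0r A (a : A) : nmul a 0 = 0.
Proof. by apply: (addrI (nmul a 0)); rewrite -nmulDr !addr0. Qed.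

Lemma nmul_suml A (I : Type) (r : seq I) (f : I -> A) b :
  nmul (\sum_(i <- r) f i) b = \sum_(i <- r) nmul (f i) b.
Proof.
by elim: r => [|i r IH]; rewrite ?big_nil ?nmul0l // !big_cons nmulDl IH.
Qed.

Lemma nmul_sumr A (I : Type) (r : seq I) (f : I -> A) b :
  nmul b (\sum_(i <- r) f i) = \sum_(i <- r) nmul b (f i).
Proof.
by elim: r => [|i r IH]; rewrite ?big_nil ?nmul0r // !big_cons nmulDr IH.
Qed.

Section Hom.
Variables (A B : nalgType u K) (h : A -> B).
Hypothesis hh : nalg_hom h.

Lemma homD a b : h (a + b) = h a + h b.
Proof. by have [l _ _] := hh; have := l 1 a b; rewrite !scale1r. Qed.

Lemma hom0 : h 0 = 0.
Proof. by apply: (addrI (h 0)); rewrite -homD !addr0. Qed.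

Lemma homZ k a : h (k *: a) = k *: h a.
Proof. by have [l _ _] := hh; have := l k a 0; rewrite !addr0 hom0 addr0. Qed.

Lemma homB a b : h (a - b) = h a - h b.
Proof. by rewrite homD -scaleN1r homZ scaleN1r. Qed.

Lemma hom_sum (I : Type) (r : seq I) (f : I -> A) :
  h (\sum_(i <- r) f i) = \sum_(i <- r) h (f i).
Proof.
by elim: r => [|i r IH]; rewrite ?big_nil ?hom0 // !big_cons homD IH.
Qed.

Lemma hom_sum_cond (I : Type) (r : seq I) (P : pred I) (f : I -> A) :
  h (\sum_(i <- r | P i) f i) = \sum_(i <- r | P i) h (f i).
Proof. exact: (big_morph h homD hom0). Qed.

Lemma homM a b : h (nmul a b) = nmul (h a) (h b).
Proof. by case: hh. Qed.

Lemma hom1 : h nunit = nunit.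
Proof. by case: hh. Qed.

End Hom.

Lemma hom_comp A B C (g : B -> C) (h : A -> B) :
  nalg_hom g -> nalg_hom h -> nalg_hom (g \o h).
Proof.
move=> hg hh; split=> [k a b|a b|] /=.
- by rewrite homD // homZ // homD // homZ.
- by rewrite !homM.
- by rewrite !hom1.
Qed.

Lemma hom_id A : nalg_hom (id : A -> A).
Proof. by []. Qed.

Definition lin A (X : Type) (v : X -> A) (s : seq (K * mono X)) : A :=
  \sum_(i <- s) i.1 *: mono_eval v i.2.

Lemma hom_mono A B (h : A -> B) (X : Type) (v : X -> A) m : nalg_hom h ->
  h (mono_eval v m) = mono_eval (h \o v) m.
Proof.
move=> hh; case: m => [w|] /=; last exact: hom1.
by elim: w => //= w1 <- w2 <-; exact: homM.
Qed.

Lemma hom_lin A B (h : A -> B) (X : Type) (v : X -> A) s : nalg_hom h ->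
  h (lin v s) = lin (h \o v) s.
Proof.
move=> hh; rewrite /lin (hom_sum hh); apply: eq_bigr => i _.
by rewrite homZ // hom_mono.
Qed.

Lemma lin_cat A (X : Type) (v : X -> A) s1 s2 :
  lin v (s1 ++ s2) = lin v s1 + lin v s2.
Proof. exact: big_cat. Qed.

Definition scale_seq (X : Type) (k : K) (s : seq (K * mono X)) :=
  [seq (k * i.1, i.2) | i <- s].

Lemma lin_scale A (X : Type) (v : X -> A) k s :
  lin v (scale_seq k s) = k *: lin v s.
Proof.
rewrite /lin big_map scaler_sumr; apply: eq_bigr => i _ /=.
by rewrite scalerA.
Qed.

Definition poly_seq (X : choiceType) (p : napoly K X) : seq (K * mono X) :=
  [seq (p m, m) | m <- finsupp p].

Lemma napoly_eval_lin A (X : choiceType) (v : X -> A) (p : napoly K X) :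
  napoly_eval v p = lin v (poly_seq p).
Proof. by rewrite /lin big_map. Qed.

Lemma lin_napoly (X : choiceType) (s : seq (K * mono X)) :
  exists2 p : napoly K X, {subset finsupp p <= [seq i.2 | i <- s]} &
    forall A (v : X -> A), lin v s = napoly_eval v p.
Proof.
pose d := [fset m | m in [seq i.2 | i <- s]]%fset.
pose p : napoly K X := [fsfun m in d => \sum_(i <- s | i.2 == m) i.1].
have dE m : (m \in d) = (m \in [seq i.2 | i <- s]) by rewrite !inE.
have pE m : p m = \sum_(i <- s | i.2 == m) i.1.
  rewrite fsfunE dE; case: ifP => // /negP ms; rewrite big_seq_cond big1 // => i.
  by case/andP=> si /eqP e; case: ms; rewrite -e map_f.
have psub : {subset finsupp p <= d}.
  move=> m; rewrite mem_finsupp fsfunE; by case: ifP => //; rewrite eqxx.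
exists p => [m /psub|A v]; first by rewrite dE.
rewrite /napoly_eval.
transitivity (\sum_(m <- d) p m *: mono_eval v m); last first.
  rewrite (bigID (fun m => m \in finsupp p)) /= [X in _ + X]big1 ?addr0.
    rewrite -big_filter; apply: perm_big; apply: uniq_perm;
      rewrite ?filter_uniq ?fset_uniq //.
    by move=> m; rewrite mem_filter; case: (boolP (_ \in finsupp p)) => // /psub ->.
  by move=> m; rewrite memNfinsupp => /eqP ->; rewrite scale0r.
transitivity (\sum_(m <- d) \sum_(i <- s | i.2 == m) i.1 *: mono_eval v i.2).
  rewrite (exchange_big_dep predT) //= /lin; rewrite [LHS]big_seq [RHS]big_seq.
  apply: eq_bigr => i si; rewrite -big_filter.
  rewrite (bigD1_seq i.2) ?filter_uniq ?fset_uniq //=; last first.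
    by rewrite mem_filter eqxx dE map_f.
  rewrite big_filter_cond big1 ?addr0 // => m /andP[/eqP ->]; by rewrite eqxx.
apply: eq_bigr => m _; rewrite pE scaler_suml; apply: eq_bigr => i /eqP -> //.
Qed.

End Algebra.

Lemma if_impl (b : bool) (P Q P' Q' : Prop) :
  (P -> P') -> (Q -> Q') -> (if b then P else Q) -> if b then P' else Q'.
Proof. by case: b. Qed.

Section Subalgebra.
Variables (u : bool) (K : nzRingType) (F : nalgType u K).

Record subalgebra := Subalgebra {
  subalg_mem :> F -> Prop;
  sub_lin : forall k a b, subalg_mem a -> subalg_mem b -> subalg_mem (k *: a + b);
  sub_mul : forall a b, subalg_mem a -> subalg_mem b -> subalg_mem (nmul a b);
  sub_unit : subalg_mem nunit
}.

Variable S : subalgebra.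

Definition sub_pred : {pred F} := fun a => `[< S a >].

Lemma sub_pred_closed : submod_closed sub_pred.
Proof.
split=> [|k a b /asboolP Sa /asboolP Sb]; apply/asboolP; last exact: sub_lin.
have := sub_lin (-1) (sub_unit S) (sub_unit S); by rewrite scaleN1r addNr.
Qed.

HB.instance Definition _ := GRing.isSubmodClosed.Build K F sub_pred sub_pred_closed.

Definition subalg_type := {a : F | sub_pred a}.
HB.instance Definition _ := SubChoice.on subalg_type.
HB.instance Definition _ := [SubChoice_isSubLmodule of subalg_type by <:].

Lemma subalg_typeP (a : subalg_type) : S (val a).
Proof. exact/asboolP/(valP a). Qed.

Definition to_subalg a (Sa : S a) : subalg_type := exist _ a (asboolT Sa).

Definition sub_nmul (a b : subalg_type) : subalg_type :=
  to_subalg (sub_mul (subalg_typeP a) (subalg_typeP b)).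
Definition sub_nunit : subalg_type := to_subalg (sub_unit S).

Fact sub_nmulDl a b c : sub_nmul (a + b) c = sub_nmul a c + sub_nmul b c.
Proof. by apply: val_inj; rewrite /= nmulDl. Qed.
Fact sub_nmulDr a b c : sub_nmul a (b + c) = sub_nmul a b + sub_nmul a c.
Proof. by apply: val_inj; rewrite /= nmulDr. Qed.
Fact sub_nmulZl k a b : sub_nmul (k *: a) b = k *: sub_nmul a b.
Proof. by apply: val_inj; rewrite /= nmulZl. Qed.
Fact sub_nmulZr k a b : sub_nmul a (k *: b) = k *: sub_nmul a b.
Proof. by apply: val_inj; rewrite /= nmulZr. Qed.
Fact sub_nunitP :
  if u then (forall a, sub_nmul sub_nunit a = a) /\
            (forall a, sub_nmul a sub_nunit = a)
  else sub_nunit = 0.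
Proof.
apply: if_impl (@nunitP u K F) => [[h1 h2]|h].
  by split=> a; apply: val_inj; rewrite /= ?h1 ?h2.
exact: val_inj.
Qed.

HB.instance Definition _ := Lmodule_isNAlgebra.Build u K subalg_type
  sub_nmulDl sub_nmulDr sub_nmulZl sub_nmulZr sub_nunitP.

Lemma val_hom : nalg_hom (val : subalg_type -> F).
Proof. by []. Qed.

Lemma satisfies_sub I : satisfies I F -> satisfies I subalg_type.
Proof.
move=> h p Ip v; apply: val_inj; rewrite napoly_eval_lin.
rewrite (hom_lin _ _ val_hom) -napoly_eval_lin; exact: h.
Qed.

End Subalgebra.

(** * Free algebras and weighted components *)

Lemma vandermonde_eq0 (K : closedFieldType) (V : lmodType K) (f : nat -> V) n :
  (forall t : K, \sum_(d < n) t ^+ d *: f d = 0) ->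
  forall d, (d < n)%N -> f d = 0.
Proof.
move=> h d dn; have [s ss us] := distinct_seq K n.
pose a : 'rV[K]_n := \row_j s`_j.
pose A := Vandermonde n a.
have uA : A \in unitmx.
  rewrite unitmxE det_Vandermonde unitfE; apply/prodf_neq0 => i _.
  apply/prodf_neq0 => j ij; rewrite !mxE subr_eq0 nth_uniq ?ss //.
  by rewrite eq_sym neq_ltn ij.
pose o := Ordinal dn.
have -> : f d = \sum_j invmx A j o *: \sum_(i < n) A i j *: f i.
  under eq_bigr do rewrite scaler_sumr.
  rewrite exchange_big /=.
  have AB i : \sum_j invmx A j o *: (A i j *: f i) = (i == o)%:R *: f i.
    under eq_bigr do rewrite scalerA mulrC.
    by rewrite -scaler_suml; move/matrixP/(_ i o): (mulmxV uA); rewrite !mxE => ->.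
  under eq_bigr do rewrite AB.
  rewrite (bigD1 o) //= eqxx scale1r big1 ?addr0 // => i ne.
  by rewrite (negPf ne) scale0r.
rewrite big1 // => j _; rewrite -[X in _ *: X](_ : 0 = _) ?scaler0 //.
rewrite -[LHS](h (s`_j)); apply: eq_bigr => i _; by rewrite !mxE.
Qed.

Lemma if_elim (b : bool) (P Q R : Prop) :
  (b = true -> P -> R) -> (b = false -> Q -> R) -> (if b then P else Q) -> R.
Proof. by case: b => hP hQ; [apply: hP|apply: hQ]. Qed.

Section Words.
Variables (u : bool) (K : nzRingType) (A : nalgType u K) (X : Type).
Implicit Types (m : mono X) (v : X -> A).

Definition mono_mul m1 m2 : mono X :=
  match m1, m2 with
  | Some w1, Some w2 => Some (Join w1 w2)
  | None, m | m, None => m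
  end.

Definition mono_coef m1 m2 : K :=
  match m1, m2 with Some _, Some _ => 1 | _, _ => u%:R end.

Lemma nunit_mul (a : A) :
  nmul nunit a = u%:R *: a /\ nmul a nunit = u%:R *: a.
Proof.
apply: if_elim (@nunitP u K A) => [e [-> ->]|e ->].
  have -> : (u%:R : K) = 1 by rewrite e.
  by rewrite !scale1r.
have -> : (u%:R : K) = 0 by rewrite e.
by rewrite nmul0l nmul0r scale0r.
Qed.

Lemma mono_eval_mul v m1 m2 :
  nmul (mono_eval v m1) (mono_eval v m2) =
  mono_coef m1 m2 *: mono_eval v (mono_mul m1 m2).
Proof.
case: m1 m2 => [w1|] [w2|] /=; rewrite ?scale1r //.
- by have [_ ->] := nunit_mul (word_eval v w1).
- by have [-> _] := nunit_mul (word_eval v w2).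
- by have [-> _] := nunit_mul (nunit : A).
Qed.

Fixpoint word_wt (w : X -> nat) (z : word X) : nat :=
  match z with
  | Letter i => w i
  | Join z1 z2 => (word_wt w z1 + word_wt w z2)%N
  end.

Definition wt (w : X -> nat) m : nat := if m is Some z then word_wt w z else 0%N.

Lemma wt_mul w m1 m2 : wt w (mono_mul m1 m2) = (wt w m1 + wt w m2)%N.
Proof. by case: m1 m2 => [w1|] [w2|] /=; rewrite ?addn0. Qed.

Lemma wt1 m : wt (fun=> 1%N) m = tot_deg m.
Proof. by case: m => //=; elim=> //= z1 -> z2 ->. Qed.

Definition mspan (v : X -> A) (P : pred (mono X)) (f : A) : Prop :=
  exists2 s : seq (K * mono X), all (fun i => P i.2) s & f = lin v s.

Section Span.
Variable v : X -> A.
Implicit Types P Q R : pred (mono X).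

Lemma mspan0 P : mspan v P 0.
Proof. by exists [::]; rewrite // /lin big_nil. Qed.

Lemma mspanD P f g : mspan v P f -> mspan v P g -> mspan v P (f + g).
Proof.
by case=> s Ps -> [r Pr ->]; exists (s ++ r); rewrite ?all_cat ?Ps // lin_cat.
Qed.

Lemma mspanZ P k f : mspan v P f -> mspan v P (k *: f).
Proof.
case=> s Ps ->; exists (scale_seq k s); rewrite ?lin_scale //.
by rewrite all_map; exact: Ps.
Qed.

Lemma mspanB P f g : mspan v P f -> mspan v P g -> mspan v P (f - g).
Proof. by move=> Pf Pg; apply: mspanD => //; rewrite -scaleN1r; apply: mspanZ. Qed.

Lemma mspan_sum P (I : Type) (r : seq I) (f : I -> A) :
  (forall i, mspan v P (f i)) -> mspan v P (\sum_(i <- r) f i).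
Proof.
by move=> h; elim: r => [|i r IH]; rewrite ?big_nil ?big_cons; [exact: mspan0|exact: mspanD].
Qed.

Lemma mspan_mono P m : P m -> mspan v P (mono_eval v m).
Proof.
by move=> Pm; exists [:: (1, m)]; rewrite /= ?Pm // /lin big_seq1 scale1r.
Qed.

Lemma mspanS P Q f : (forall m, P m -> Q m) -> mspan v P f -> mspan v Q f.
Proof.
by move=> PQ [s Ps ->]; exists s => //; apply: sub_all Ps => i /PQ.
Qed.

Lemma mspan_ind P (T : A -> Prop) f : mspan v P f ->
  T 0 -> (forall k m g, P m -> T g -> T (k *: mono_eval v m + g)) -> T f.
Proof.
case=> s + -> T0 TS; elim: s => [|[k m] s IH] /=; first by rewrite /lin big_nil.
by case/andP=> Pm Ps; rewrite /lin big_cons /=; apply: TS => //; apply: IH.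
Qed.

Lemma mspanM P Q R f g : (forall m1 m2, P m1 -> Q m2 -> R (mono_mul m1 m2)) ->
  mspan v P f -> mspan v Q g -> mspan v R (nmul f g).
Proof.
move=> h Pf Qg; apply: (mspan_ind (T := fun f => mspan v R (nmul f g)) Pf) => [|k m f' Pm IH].
  by rewrite nmul0l; apply: mspan0.
rewrite nmulDl nmulZl; apply: mspanD => //; apply: mspanZ.
apply: (mspan_ind (T := fun g => mspan v R (nmul (mono_eval v m) g)) Qg) => [|k' m' g' Qm IH'].
  by rewrite nmul0r; apply: mspan0.
rewrite nmulDr nmulZr; apply: mspanD => //; apply: mspanZ.
by rewrite mono_eval_mul; apply: mspanZ; apply: mspan_mono; apply: h.
Qed.

End Span.

Lemma mspan_napoly (Y : choiceType) (v : Y -> A) (P : pred (mono Y)) f :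
  (exists2 p : napoly K Y, (forall n, n \in finsupp p -> P n) &
     f = napoly_eval v p) <->
  (exists2 s : seq (K * mono Y), all (fun i => P i.2) s & f = lin v s).
Proof.
split=> [[p Pp ->]|[s /allP Ps ->]].
  exists (poly_seq p); last exact: napoly_eval_lin.
  by apply/allP => _ /mapP[n ms ->] /=; apply: Pp.
have [p ps pE] := lin_napoly u s; exists p; last exact: pE.
by move=> n /ps /mapP[i si ->]; apply: Ps.
Qed.

Fixpoint word_map Y (g : X -> Y) (z : word X) : word Y :=
  match z with
  | Letter i => Letter (g i)
  | Join z1 z2 => Join (word_map g z1) (word_map g z2)
  end.

Lemma mono_eval_map Y (g : X -> Y) (v : Y -> A) m :
  mono_eval v (omap (word_map g) m) = mono_eval (v \o g) m.
Proof. by case: m => //=; elim=> //= z1 -> z2 ->. Qed.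

End Words.

Lemma wt_map (X Y : Type) (g : X -> Y) (w : Y -> nat) (m : mono X) :
  wt w (omap (word_map g) m) = wt (w \o g) m.
Proof. by case: m => //=; elim=> //= z1 -> z2 ->. Qed.

Section Free.
Variables (K : closedFieldType) (u : bool) (I : napoly K nat -> Prop).
Variables (F : nalgType u K) (x y : F).
Hypothesis freeF : free_on I (pair_gen x y).
Notation v := (pair_gen x y).
Implicit Types (f g r : F) (e : bool -> F) (w m : bool -> nat).

Lemma free_gen f : exists s, f = lin v s.
Proof.
have [satF univ] := freeF.
have h1 : forall k a b, (exists s, a = lin v s) -> (exists s, b = lin v s) ->
    exists s, k *: a + b = lin v s.
  move=> k _ _ [s1 ->] [s2 ->]; exists (scale_seq k s1 ++ s2).
  by rewrite lin_cat lin_scale.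
have h2 (a b : F) : (exists s, a = lin v s) -> (exists s, b = lin v s) ->
    exists s, nmul a b = lin v s.
  move=> [s1 ->] [s2 ->].
  have [|||s _ ->] := @mspanM _ _ _ _ v predT predT predT (lin v s1) (lin v s2).
  - by [].
  - by exists s1 => //; apply/allP.
  - by exists s2 => //; apply/allP.
  by exists s.
have h3 : exists s, nunit = lin v s.
  by exists [:: (1, None)]; rewrite /lin big_seq1 scale1r.
pose S := Subalgebra h1 h2 h3.
have hv i : S (v i).
  by exists [:: (1, Some (Letter i))]; rewrite /lin big_seq1 scale1r.
have [[h hh hE] _] := univ (subalg_type S) (satisfies_sub (S := S) satF)
  (fun i => to_subalg (hv i)).
have [_ uniq] := univ F satF v.
have <- : val (h f) = f.
  apply: (uniq (val \o h) id (hom_comp (val_hom S) hh) (hom_id F)).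
  by move=> i /=; rewrite hE.
exact: subalg_typeP (h f).
Qed.

Lemma hom_ext (A : nalgType u K) (h1 h2 : F -> A) : nalg_hom h1 -> nalg_hom h2 ->
  (forall i, h1 (v i) = h2 (v i)) -> h1 =1 h2.
Proof.
move=> H1 H2 e f; have [s ->] := free_gen f.
rewrite !hom_lin //; congr (lin _ s); exact/funext.
Qed.

Lemma subst_ex e : exists h : F -> F, nalg_hom h /\ forall i, h (v i) = e i.
Proof.
have [satF univ] := freeF; have [[h hh hE] _] := univ F satF e.
by exists h.
Qed.

Definition fsubst e : F -> F := projT1 (cid (subst_ex e)).
Notation subst := fsubst.

Lemma subst_hom e : nalg_hom (subst e).
Proof. by rewrite /fsubst; case: cid => h []. Qed.

Lemma subst_v e i : subst e (v i) = e i.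
Proof. by rewrite /fsubst; case: cid => h []. Qed.

Lemma subst_mono e n : subst e (mono_eval v n) = mono_eval e n.
Proof.
rewrite (hom_mono _ _ (subst_hom e)); congr mono_eval; apply/funext => i /=.
exact: subst_v.
Qed.

Lemma hom_subst h : nalg_hom h -> h =1 subst (h \o v).
Proof.
by move=> hh; apply: hom_ext => //; [exact: subst_hom|move=> i; rewrite subst_v].
Qed.

Lemma hom_substE h e : nalg_hom h -> h \o subst e =1 subst (h \o e).
Proof.
move=> hh; apply: hom_ext; last by move=> i /=; rewrite !subst_v.
  exact: hom_comp (subst_hom e).
exact: subst_hom.
Qed.

Lemma subst_id : subst v =1 id.
Proof. by move=> f; apply/esym/(hom_subst (hom_id F)). Qed.

Notation sp := (mspan v).

Lemma sp_all f : sp predT f.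
Proof. by have [s ->] := free_gen f; exists s => //; apply/allP. Qed.

Definition wcomp_seq w d (s : seq (K * mono bool)) :=
  [seq i <- s | wt w i.2 == d].

Lemma lin_split w n (s : seq (K * mono bool)) (c : nat -> K) :
  all (fun i => wt w i.2 < n)%N s ->
  lin v [seq (c (wt w i.2) * i.1, i.2) | i <- s] =
  \sum_(d < n) c d *: lin v (wcomp_seq w d s).
Proof.
move=> /allP sn; rewrite /lin big_map.
under [RHS]eq_bigr do rewrite /wcomp_seq big_filter scaler_sumr.
rewrite (exchange_big_dep predT) //= [LHS]big_seq [RHS]big_seq.
apply: eq_bigr => i /sn wn; rewrite (big_pred1 (Ordinal wn)) ?scalerA //.
Qed.

Lemma wt_bound w (s : seq (K * mono bool)) :
  exists n, all (fun i => wt w i.2 < n)%N s.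
Proof.
elim: s => [|i s [n sn]]; first by exists 0%N.
exists (maxn n (wt w i.2).+1); rewrite /= leq_maxr /=.
by apply: sub_all sn => j jn; apply: leq_trans jn (leq_maxl _ _).
Qed.

Lemma mono_eval_scale w (t : K) n :
  mono_eval (fun i => t ^+ w i *: v i) n = t ^+ wt w n *: mono_eval v n.
Proof.
case: n => [z|] /=; last by rewrite scale1r.
elim: z => //= z1 -> z2 ->.
by rewrite nmulZl nmulZr scalerA exprD mulrC.
Qed.

(** Vandermonde: the rescaled relation holds for all values of the scalar. *)
Lemma wcomp_seq_eq0 w d s : lin v s = 0 -> lin v (wcomp_seq w d s) = 0.
Proof.
move=> s0; have [n sn] := wt_bound w s.
have [dn|nd] := ltnP d n; last first.
  rewrite /wcomp_seq (eq_in_filter (a2 := pred0)) ?filter_pred0 /lin ?big_nil //.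
  move=> i /(allP sn) ilt; apply/eqP => e; by rewrite e ltnNge nd in ilt.
apply: (vandermonde_eq0 (f := fun d => lin v (wcomp_seq w d s)) (n := n)) dn => t.
rewrite -(lin_split (fun d => t ^+ d) sn).
have <- : subst (fun i => t ^+ w i *: v i) (lin v s) = 0.
  by rewrite s0 (hom0 (subst_hom _)).
rewrite (hom_lin _ _ (subst_hom _)) /lin big_map; apply: eq_bigr => i _ /=.
rewrite mulrC -scalerA -mono_eval_scale; congr (_ *: mono_eval _ _).
by apply/funext => j; rewrite /= subst_v.
Qed.

Definition rep f := projT1 (cid (free_gen f)).

Lemma repE f : lin v (rep f) = f.
Proof. by rewrite /rep; case: cid. Qed.

Definition component w d f := lin v (wcomp_seq w d (rep f)).
Notation wcomp := component.

Lemma wcomp_lin w d s : wcomp w d (lin v s) = lin v (wcomp_seq w d s).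
Proof.
apply/eqP; rewrite -subr_eq0 -[X in _ - X]scale1r -scaleNr -lin_scale -lin_cat.
have -> : wcomp_seq w d (rep (lin v s)) ++ scale_seq (-1) (wcomp_seq w d s) =
   wcomp_seq w d (rep (lin v s) ++ scale_seq (-1) s).
  by rewrite /wcomp_seq filter_cat /scale_seq filter_map.
by rewrite wcomp_seq_eq0 // lin_cat lin_scale repE scaleN1r subrr.
Qed.

Lemma wcomp_is_linear w d : linear (wcomp w d).
Proof.
move=> k f g; rewrite -{1}(repE f) -{1}(repE g) -lin_scale -lin_cat wcomp_lin.
rewrite /wcomp_seq filter_cat lin_cat; congr (_ + _).
by rewrite /scale_seq filter_map lin_scale.
Qed.

HB.instance Definition _ w d :=
  GRing.isLinear.Build K F F *:%R (wcomp w d) (wcomp_is_linear w d).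

Lemma wcomp_mono w d n :
  wcomp w d (mono_eval v n) = if wt w n == d then mono_eval v n else 0.
Proof.
have -> : mono_eval v n = lin v [:: (1, n)] by rewrite /lin big_seq1 scale1r.
rewrite wcomp_lin /wcomp_seq /=; case: eqP => //= _; by rewrite /lin big_nil.
Qed.

Lemma wcomp_span w d (P : pred (mono bool)) f : sp P f ->
  sp (fun n => P n && (wt w n == d)) (wcomp w d f).
Proof.
case=> s Ps ->; rewrite wcomp_lin; exists (wcomp_seq w d s) => //.
apply/allP => i; rewrite mem_filter => /andP[-> /(allP Ps) ->] //.
Qed.

Lemma wcomp_sp w d f : sp (fun n => wt w n == d) (wcomp w d f).
Proof. by apply: mspanS (wcomp_span w d (sp_all f)) => n. Qed.

Lemma wcomp_fix w d (P : pred (mono bool)) f : (forall n, P n -> wt w n = d) ->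
  sp P f -> wcomp w d f = f.
Proof.
move=> h Pf; apply: (mspan_ind (T := fun f => wcomp w d f = f) Pf) => [|k n g Pn IH]; first exact: linear0.
by rewrite linearP /= wcomp_mono (h n Pn) eqxx IH.
Qed.

Lemma wcomp_eq0 w d (P : pred (mono bool)) f : (forall n, P n -> wt w n != d) ->
  sp P f -> wcomp w d f = 0.
Proof.
move=> h Pf; apply: (mspan_ind (T := fun f => wcomp w d f = 0) Pf) => [|k n g Pn IH]; first exact: linear0.
by rewrite linearP /= wcomp_mono (negPf (h n Pn)) IH scaler0 addr0.
Qed.

Lemma wcomp_wcomp w d d' f : wcomp w d (wcomp w d' f) = if d == d' then wcomp w d f else 0.
Proof.
case: eqP => [->|ne]; first by apply: (wcomp_fix _ (wcomp_sp w d' f)) => n /eqP.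
apply: (wcomp_eq0 _ (wcomp_sp w d' f)) => n /eqP ->; apply/eqP => e; exact: ne.
Qed.

Lemma wcomp_sum w f : exists n, f = \sum_(d < n) wcomp w d f /\
  forall d, (n <= d)%N -> wcomp w d f = 0.
Proof.
have [n sn] := wt_bound w (rep f).
have fn : sp (fun z => wt w z < n)%N f by exists (rep f); rewrite ?repE.
exists n; split; last first.
  by move=> d nd; apply: wcomp_eq0 fn => z; rewrite neq_ltn => /leq_trans ->.
rewrite -{1}(repE f) /component; have := lin_split (fun=> 1) sn.
under eq_bigr do rewrite scale1r; move=> <-; rewrite /lin big_map.
by apply: eq_bigr => i _; rewrite mul1r.
Qed.

Lemma wcomp_inj0 w f : (forall d, wcomp w d f = 0) -> f = 0.
Proof. by move=> h; have [n [-> _]] := wcomp_sum w f; rewrite big1. Qed.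

Lemma sp_leP w n f :
  sp (fun z => wt w z <= n)%N f <-> (forall d, (n < d)%N -> wcomp w d f = 0).
Proof.
split=> [fn d nd|h].
  by apply: wcomp_eq0 fn => z; rewrite neq_ltn => /leq_ltn_trans ->.
have [N [-> _]] := wcomp_sum w f; apply: mspan_sum => d.
have [nd|dn] := ltnP n d; first by rewrite h //; apply: mspan0.
by apply: mspanS (wcomp_sp w d f) => z /eqP ->.
Qed.

Lemma sp_ltP w n f :
  sp (fun z => wt w z < n)%N f <-> (forall d, (n <= d)%N -> wcomp w d f = 0).
Proof.
split=> [fn d nd|h].
  by apply: wcomp_eq0 fn => z /leq_trans/(_ nd); rewrite neq_ltn => ->.
have [N [-> _]] := wcomp_sum w f; apply: mspan_sum => d.
have [nd|dn] := leqP n d; first by rewrite h //; apply: mspan0.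
by apply: mspanS (wcomp_sp w d f) => z /eqP ->.
Qed.

Lemma sp_geP w n f :
  sp (fun z => n <= wt w z)%N f <-> (forall d, (d < n)%N -> wcomp w d f = 0).
Proof.
split=> [fn d nd|h].
  by apply: wcomp_eq0 fn => z; rewrite eq_sym neq_ltn => /(leq_trans nd) ->.
have [N [-> _]] := wcomp_sum w f; apply: mspan_sum => d.
have [nd|dn] := ltnP d n; first by rewrite h //; apply: mspan0.
by apply: mspanS (wcomp_sp w d f) => z /eqP ->.
Qed.

Lemma wcomp_subst w m e r d :
  (forall i, sp (fun z => wt w z == m i) (e i)) ->
  wcomp w d (subst e r) = subst e (wcomp m d r).
Proof.
move=> he.
have hm n : sp (fun z => wt w z == wt m n) (mono_eval e n).
  case: n => [z|] /=; last by apply: (@mspan_mono _ _ _ _ v _ None).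
  elim: z => //= z1 h1 z2 h2; apply: mspanM h1 h2 => n1 n2 /eqP e1 /eqP e2.
  by rewrite wt_mul e1 e2.
apply: (mspan_ind (T := fun r => wcomp w d (subst e r) = subst e (wcomp m d r)) (sp_all r)) => [|k n g _ IH].
  by rewrite (linear0 (wcomp m d)) (hom0 (subst_hom e)) linear0.
rewrite (homD (subst_hom e)) (homZ (subst_hom e)) !linearP /=.
rewrite (homD (subst_hom e)) (homZ (subst_hom e)) IH; congr (_ *: _ + _).
rewrite subst_mono wcomp_mono; case: eqP => [<-|ne].
  by rewrite subst_mono; apply: wcomp_fix (hm n) => z /eqP.
by rewrite (hom0 (subst_hom e)); apply: wcomp_eq0 (hm n) => z /eqP ->; apply/eqP.
Qed.

Notation tot := (fun _ : bool => 1%N).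
Notation sw := (wt tot).

Lemma deg_leP n f : deg_le v n f <-> sp (fun z => sw z <= n)%N f.
Proof.
split=> [/(mspan_napoly (A := F) v (fun z => tot_deg z <= n)%N)|] h.
  by case: h => s hs ->; exists s => //; apply: sub_all hs => i; rewrite wt1.
apply/(mspan_napoly (A := F) v (fun z => tot_deg z <= n)%N).
by case: h => s hs ->; exists s => //; apply: sub_all hs => i; rewrite wt1.
Qed.

Definition unary g : F -> F := subst (fun=> g).
Notation ap := unary.

Lemma unary_homogeneousP n f :
  homogeneous (fun _ : unit => x) n f <-> (ap x f = f /\ wcomp tot n f = f).
Proof.
split=> [[p hp ->]|[fx fn]].
  have [s hs ->] : exists2 s, all (fun i => (tot_deg i.2 == n)%N) s &
      napoly_eval (fun _ : unit => x) p = lin (fun _ : unit => x) s.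
    apply/(mspan_napoly (A := F) _ (fun z => tot_deg z == n)%N).
    by exists p => // z /hp ->.
  have hl : lin (fun=> x) s = lin v [seq (i.1, omap (word_map (fun=> false)) i.2) | i <- s].
    by rewrite /lin big_map; apply: eq_bigr => i _; rewrite mono_eval_map.
  split.
    rewrite /unary {1}hl (hom_lin _ _ (subst_hom _)) /lin big_map; apply: eq_bigr => i _.
    rewrite /= mono_eval_map; congr (_ *: mono_eval _ _); apply/funext => j /=.
    by rewrite (subst_v _ false).
  apply: (@wcomp_fix _ _ (fun z => sw z == n)%N) => [z /eqP//|].
  rewrite hl; eexists; last reflexivity; rewrite all_map; apply: sub_all hs => i /=.
  by rewrite wt_map -wt1.
have : sp (fun z => sw z == n) f by rewrite -fn; apply: wcomp_sp.
case=> s hs fs.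
have [|p hp pE] := (mspan_napoly (A := F) (fun _ : unit => x)
    (fun z => tot_deg z == n)%N f).2; last first.
  by exists p => // z /hp /eqP.
exists [seq (i.1, omap (word_map (fun=> tt)) i.2) | i <- s].
  rewrite all_map; apply: sub_all hs => i /=.
  by rewrite -wt1 wt_map.
rewrite -fx fs /unary (hom_lin _ _ (subst_hom _)) /lin big_map; apply: eq_bigr => i _.
rewrite /= mono_eval_map; congr (_ *: mono_eval _ _); apply/funext => j /=.
by rewrite subst_v.
Qed.

End Free.

(** * Independence of homogeneous elements *)

Section Structure.
Variables (K : closedFieldType) (u : bool) (I : napoly K nat -> Prop).
Variables (F : nalgType u K) (x y : F).
Hypothesis freeF : free_on I (pair_gen x y).
Notation v := (pair_gen x y).
Notation sp := (mspan v).
Notation tot := (fun _ : bool => 1%N).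
Notation sw := (wt tot).
Notation subst := (fsubst freeF).
Notation wcomp := (component freeF).
Notation ap := (unary freeF).
Implicit Types (f g r : F) (e : bool -> F) (w m : bool -> nat).

Lemma substD e f g : subst e (f + g) = subst e f + subst e g.
Proof. exact: homD (subst_hom _ _) _ _. Qed.
Lemma substZ e k f : subst e (k *: f) = k *: subst e f.
Proof. exact: homZ (subst_hom _ _) _ _. Qed.
Lemma substB e f g : subst e (f - g) = subst e f - subst e g.
Proof. exact: homB (subst_hom _ _) _ _. Qed.
Lemma subst0 e : subst e 0 = 0.
Proof. exact: hom0 (subst_hom _ _). Qed.
Lemma subst1 e : subst e nunit = nunit.
Proof. exact: hom1 (subst_hom _ _). Qed.
Lemma subst_subst e e' r : subst e (subst e' r) = subst (fun i => subst e (e' i)) r.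
Proof. exact: (hom_substE freeF _ (subst_hom freeF e) r). Qed.

Lemma wcompD w d f g : wcomp w d (f + g) = wcomp w d f + wcomp w d g.
Proof. exact: linearD. Qed.
Lemma wcompZ w d k f : wcomp w d (k *: f) = k *: wcomp w d f.
Proof. exact: linearZ. Qed.
Lemma wcompB w d f g : wcomp w d (f - g) = wcomp w d f - wcomp w d g.
Proof. exact: linearB. Qed.
Lemma wcomp0 w d : wcomp w d 0 = 0.
Proof. exact: linear0. Qed.

Lemma sp_ind (P : pred (mono bool)) (T : F -> Prop) f : sp P f ->
  T 0 -> (forall k n g, P n -> T g -> T (k *: mono_eval v n + g)) -> T f.
Proof. exact: mspan_ind. Qed.

Lemma word_wt_gt0 (z : word bool) : (0 < word_wt tot z)%N.
Proof. by elim: z => //= z1 h1 z2 h2; rewrite addn_gt0 h1. Qed.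

Lemma sw1 n : sw n = 1%N -> exists i, n = Some (Letter i).
Proof.
case: n => [[i|z1 z2]|] //=; first by exists i.
by move=> h; have := leq_add (word_wt_gt0 z1) (word_wt_gt0 z2); rewrite h.
Qed.

Lemma sw0 n : sw n = 0%N -> n = None.
Proof. by case: n => // z /= h; have := word_wt_gt0 z; rewrite h. Qed.

Lemma sp_linear f : sp (fun n => sw n == 1%N) f -> exists a b, f = a *: x + b *: y.
Proof.
move=> h; apply: (sp_ind (T := fun f => exists a b, f = a *: x + b *: y) h) => [|k n g /eqP/sw1[i ->] [a [b ->]]].
  by exists 0, 0; rewrite !scale0r addr0.
case: i => /=.
  by exists a, (k + b); rewrite scalerDl addrCA.
by exists (k + a), b; rewrite scalerDl addrA.
Qed.

Lemma sp_const f : sp (fun n => sw n == 0%N) f -> exists a, f = a *: nunit.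
Proof.
move=> h; apply: (sp_ind (T := fun f => exists a, f = a *: nunit) h) => [|k n g /eqP/sw0-> [a ->]].
  by exists 0; rewrite scale0r.
by exists (k + a); rewrite scalerDl.
Qed.

Lemma wcompC w w' d d' f : wcomp w d (wcomp w' d' f) = wcomp w' d' (wcomp w d f).
Proof.
apply: (sp_ind (T := fun f => wcomp w d (wcomp w' d' f) = wcomp w' d' (wcomp w d f))
  (sp_all freeF f)) => [|k n g _ IH]; first by rewrite !linear0.
rewrite !linearP /= IH !wcomp_mono; congr (_ *: _ + _).
by case h1: (_ == d'); case h2: (_ == d); rewrite ?linear0 ?wcomp_mono ?h1 ?h2.
Qed.

Lemma wcomp_top w f : f != 0 -> exists d,
  wcomp w d f != 0 /\ sp (fun n => wt w n <= d)%N f.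
Proof.
move=> f0; have [n [fE fn]] := wcomp_sum freeF w f.
have [d0 hd0] : exists d, wcomp w d f != 0.
  apply: contrapT => h; case/eqP: f0; apply: (wcomp_inj0 (freeF := freeF) (w := w)) => d.
  by apply/eqP/negPn/negP => hd; apply: h; exists d.
have ub d : wcomp w d f != 0 -> (d <= n)%N.
  by apply: contraNT; rewrite -ltnNge => /ltnW /fn ->.
have [d hd dmax] := @ex_maxnP (fun d => wcomp w d f != 0) n (ex_intro _ d0 hd0) ub.
exists d; split=> //; apply/(sp_leP freeF) => d' dd'; apply/eqP/negPn/negP => /dmax.
by rewrite leqNgt dd'.
Qed.

Lemma wcomp_subst_top e m D r : (forall i, sp (fun n => sw n <= m i)%N (e i)) ->
  sp (fun n => wt m n <= D)%N r ->
  wcomp tot D (subst e r) = subst (fun i => wcomp tot (m i) (e i)) (wcomp m D r)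
  /\ sp (fun n => sw n <= D)%N (subst e r).
Proof.
move=> he; pose t i := wcomp tot (m i) (e i).
have key n : exists2 l, sp (fun n' => sw n' < wt m n)%N l &
    mono_eval e n = mono_eval t n + l.
  have ht z : sp (fun n' => sw n' == wt m (Some z)) (word_eval t z).
    elim: z => [i|z1 h1 z2 h2] /=; first exact: wcomp_sp.
    by apply: mspanM h1 h2 => n1 n2 /eqP e1 /eqP e2; rewrite wt_mul e1 e2.
  case: n => [z|]; last first.
    by exists 0; rewrite ?addr0 //; apply: mspan0.
  elim: z => [i|z1 [l1 h1 e1] z2 [l2 h2 e2]] /=.
    exists (e i - t i); last by rewrite addrC subrK.
    apply/(sp_ltP freeF) => d; rewrite leq_eqVlt linearB /= wcomp_wcomp.
    case/orP=> [/eqP<-|dm]; first by rewrite eqxx subrr.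
    rewrite (gtn_eqF dm) subr0; by rewrite ((sp_leP freeF _ _ _).1 (he i)).
  simpl in e1, e2.
  exists (nmul (word_eval t z1) l2 + (nmul l1 (word_eval t z2) + nmul l1 l2)).
    apply: mspanD; last apply: mspanD.
    - by apply: mspanM (ht z1) h2 => n1 n2 /eqP h; rewrite wt_mul h ltn_add2l.
    - by apply: mspanM h1 (ht z2) => n1 n2 h /eqP h'; rewrite wt_mul h' ltn_add2r.
    - by apply: mspanM h1 h2 => n1 n2 h h'; rewrite wt_mul -addnS leq_add // ltnW.
  by rewrite e1 e2 nmulDl !nmulDr -!addrA.
have h0 n : (wt m n <= D)%N -> wcomp tot D (mono_eval e n) =
    subst t (wcomp m D (mono_eval v n)) /\ sp (fun n' => sw n' <= D)%N (mono_eval e n).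
  move=> nD; have [l hl ->] := key n.
  have ht : sp (fun n' => sw n' == wt m n) (mono_eval t n).
    case: {hl nD} n => [z|] /=; last by apply: (@mspan_mono _ _ _ _ v _ None).
    elim: z => [i|z1 h1 z2 h2] /=; first exact: wcomp_sp.
    by apply: mspanM h1 h2 => n1 n2 /eqP e1 /eqP e2; rewrite wt_mul e1 e2.
  split; last first.
    apply: mspanD; first by apply: mspanS ht => n' /eqP ->.
    by apply: mspanS hl => n' /ltnW /leq_trans; apply.
  rewrite linearD /= [X in _ + X](wcomp_eq0 freeF _ hl) ?addr0; last first.
    by move=> n' /leq_trans/(_ nD); rewrite neq_ltn => ->.
  rewrite wcomp_mono; case: eqP => [<-|/eqP ne].
    by rewrite subst_mono; apply: wcomp_fix ht => n' /eqP.
  by rewrite subst0; apply: wcomp_eq0 ht => n' /eqP ->.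
move=> hr; apply: (sp_ind (T := fun r => wcomp tot D (subst e r) = subst t (wcomp m D r)
  /\ sp (fun n => sw n <= D)%N (subst e r)) hr).
  by rewrite subst0 !linear0 subst0; split=> //; apply: mspan0.
move=> k n g nD [IH1 IH2]; have [a1 a2] := h0 n nD.
rewrite substD substZ subst_mono !linearP /= substD substZ IH1 a1; split=> //.
by apply: mspanD => //; apply: mspanZ.
Qed.

(** All that the sequel uses of the variety. *)
Definition free_criterion : Prop := forall e,
  (forall i, wcomp tot 0 (e i) = 0) ->
  (forall r, subst e r = 0 -> wcomp tot 1 r = 0) ->
  forall r, subst e r = 0 -> r = 0.

Lemma nielsen_schreier_retract (E : F -> F) : nielsen_schreier u I ->
  nalg_hom E ->
  exists2 p : F -> F, nalg_hom p &
    (forall r, E (p r) = E r) /\ (forall r, E r = 0 -> p r = 0).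
Proof.
move=> NS hE.
have h1 : forall k a b, (exists s, a = E s) -> (exists s, b = E s) ->
    exists s, k *: a + b = E s.
  by move=> k _ _ [s1 ->] [s2 ->]; exists (k *: s1 + s2); rewrite homD // homZ.
have h2 (a b : F) : (exists s, a = E s) -> (exists s, b = E s) ->
    exists s, nmul a b = E s.
  by move=> [s1 ->] [s2 ->]; exists (nmul s1 s2); rewrite homM.
have h3 : exists s, nunit = E s by exists nunit; rewrite hom1.
pose S := Subalgebra h1 h2 h3.
have [Y [w [satB univ]]] := NS _ F v freeF (subalg_type S) val (val_hom S) val_inj.
have hS r : S (E r) by exists r.
have [s sE] : exists s : Y -> F, forall z, val (w z) = E (s z).
  have h z : exists a, val (w z) = E a := subalg_typeP (w z).
  by have [s hs] := choice h; exists s.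
have [[q hq qE] _] := univ F freeF.1 s.
have [_ uniq] := univ F freeF.1 (fun z => val (w z)).
have Eq b : E (q b) = val b.
  apply: (uniq (E \o q) val (hom_comp hE hq) (val_hom S)) => z /=.
  by rewrite qE sE.
pose E' r : subalg_type S := to_subalg (hS r).
have hE' : nalg_hom E'.
  split=> [k a b|a b|]; apply: val_inj => /=.
  - by rewrite homD // homZ.
  - by rewrite homM.
  - by rewrite hom1.
exists (q \o E'); first exact: hom_comp hq hE'.
split=> r /=; first by rewrite Eq.
move=> r0; suff -> : E' r = 0 by rewrite hom0.
by apply: val_inj.
Qed.

Lemma subst_ge1 e r : (forall i, wcomp tot 0 (e i) = 0) ->
  sp (fun n => 1 <= sw n)%N r -> sp (fun n => 1 <= sw n)%N (subst e r).
Proof.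
move=> e0 hr.
apply: (sp_ind (T := fun r => sp (fun n => 1 <= sw n)%N (subst e r)) hr).
  by rewrite subst0; apply: mspan0.
move=> k [z|] // g _ IH; rewrite substD substZ subst_mono; apply: mspanD => //.
apply: mspanZ; elim: z => [i|z1 i1 z2 i2] /=.
  by apply/(sp_geP freeF) => -[].
by apply: mspanM i1 i2 => n1 n2 a1 a2; rewrite wt_mul addn_gt0 a1.
Qed.

Lemma kernel_const e r : (forall i, wcomp tot 0 (e i) = 0) ->
  subst e r = 0 -> wcomp tot 0 r = 0.
Proof.
move=> e0 r0; have [a aE] := sp_const (wcomp_sp freeF tot 0 r).
have : wcomp tot 0 (subst e (wcomp tot 0 r)) = 0.
  rewrite -[wcomp tot 0 r](subKr r) substB r0 sub0r linearN /=.
  rewrite (wcomp_eq0 freeF _ (subst_ge1 e0 _)) ?oppr0 //.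
    by move=> n; rewrite lt0n.
  apply/(sp_geP freeF) => -[] // _.
  by rewrite linearB /= wcomp_wcomp eqxx subrr.
rewrite aE substZ subst1 linearZ /= => <-; congr (_ *: _).
by rewrite (wcomp_mono freeF tot 0 None).
Qed.

Lemma nielsen_schreier_criterion : nielsen_schreier u I -> free_criterion.
Proof.
move=> NS e e0 ker1.
have [p hp [Ep p0]] := nielsen_schreier_retract NS (subst_hom freeF e).
have ker0 := kernel_const e0.
pose P i := p (v i) - v i.
have hP i : sp (fun n => 2 <= sw n)%N (P i).
  have z : subst e (P i) = 0 by rewrite substB Ep subrr.
  by apply/(sp_geP freeF) => -[_|[_|//]]; rewrite ?ker0 ?ker1.
have hw z : sp (fun n => (word_wt tot z).+1 <= sw n)%N (p (word_eval v z) - word_eval v z).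
  elim: z => [i|z1 h1 z2 h2] /=; first exact: hP.
  have -> : p (nmul (word_eval v z1) (word_eval v z2)) -
      nmul (word_eval v z1) (word_eval v z2) =
      nmul (p (word_eval v z1) - word_eval v z1) (p (word_eval v z2) - word_eval v z2)
      + (nmul (p (word_eval v z1) - word_eval v z1) (word_eval v z2) +
         nmul (word_eval v z1) (p (word_eval v z2) - word_eval v z2)).
    rewrite homM // addrA -nmulDr subrK -[X in _ = _ + X](addrK (nmul (word_eval v z1) (word_eval v z2))).
    by rewrite -nmulDr subrK addrA -nmulDl subrK.
  have hz z : sp (fun n => word_wt tot z <= sw n)%N (word_eval v z).
    by apply: (@mspan_mono _ _ _ _ v _ (Some z)) => /=.
  apply: mspanD; last apply: mspanD.
  - apply: mspanM h1 h2 => n1 n2 a1 a2; rewrite wt_mul -addnS leq_add //; exact: ltnW.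
  - by apply: mspanM h1 (hz z2) => n1 n2 a1 a2; rewrite wt_mul -addSn leq_add.
  - by apply: mspanM (hz z1) h2 => n1 n2 a1 a2; rewrite wt_mul -addnS leq_add.
move=> r /p0 pr; apply: contrapT => /eqP r0.
have [d [hd dmin]] : exists d, wcomp tot d r != 0 /\ sp (fun n => d <= sw n)%N r.
  have ex : exists d, wcomp tot d r != 0.
    by have [d [hd _]] := wcomp_top tot r0; exists d.
  have [d hd dmin] := ex_minnP ex; exists d; split=> //.
  apply/(sp_geP freeF) => d' dd; apply/eqP/negPn/negP => /dmin.
  by rewrite leqNgt dd.
case/eqP: hd; have : sp (fun n => d.+1 <= sw n)%N (p r - r).
  apply: (sp_ind (T := fun r => sp (fun n => d.+1 <= sw n)%N (p r - r)) dmin).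
    by rewrite hom0 // subrr; apply: mspan0.
  move=> k n g dn IH; rewrite homD // homZ // opprD addrACA -scalerBr.
  apply: mspanD => //; apply: mspanZ.
  case: n dn => [z|] /= dz; last by rewrite hom1 // subrr; apply: mspan0.
  by apply: mspanS (hw z) => n; apply: leq_trans.
move/(sp_geP freeF)/(_ d (ltnSn d)); rewrite pr sub0r linearN /=.
by move/eqP; rewrite oppr_eq0 => /eqP.
Qed.

Section Criterion.
Hypothesis crit : free_criterion.
Hypothesis x_neq0 : x != 0.

Lemma v_neq0 i : v i != 0.
Proof.
by apply: contraNneq x_neq0 => z; rewrite -(subst_v freeF (fun=> x) i) z subst0.
Qed.

Lemma wcomp_v w d i : wcomp w d (v i) = if w i == d then v i else 0.
Proof. exact: (wcomp_mono freeF w d (Some (Letter i))). Qed.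

Lemma wcomp_lin2 w d a b : wcomp w d (a *: v false + b *: v true) =
  (w false == d)%:R *: (a *: v false) + (w true == d)%:R *: (b *: v true).
Proof.
rewrite wcompD !wcompZ !wcomp_v.
by do 2!case: eqP => _; rewrite ?scale1r ?scale0r ?scaler0.
Qed.

Definition delta (i j : bool) : nat := j == i.

Lemma wt_delta_letter m i n : (forall i, 0 < m i)%N -> wt m n = m i ->
  (0 < wt (delta i) n)%N -> n = Some (Letter i).
Proof.
move=> m0; case: n => [z|] //=.
have pos z' : (0 < word_wt m z')%N by elim: z' => //= z1 h1 z2 h2; rewrite addn_gt0 h1.
have ge z' : (0 < word_wt (delta i) z')%N -> (m i <= word_wt m z')%N.
  elim: z' => [j|z1 h1 z2 h2] /=; first by rewrite /delta; case: eqP => [->|].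
  rewrite addn_gt0 => /orP[/h1|/h2] h; apply: leq_trans h _.
    exact: leq_addr.
  exact: leq_addl.
case: z => [j|z1 z2] /=; first by rewrite /delta; case: eqP => [->|].
move=> e; rewrite addn_gt0 => /orP[/ge|/ge]; rewrite -e leqNgt.
  by rewrite -[X in (X < _)%N]addn0 ltn_add2l pos.
by rewrite -[X in (X < _)%N]add0n ltn_add2r pos.
Qed.

Lemma subst_ap e i r : sp (fun n => wt (delta i) n == 0%N) r ->
  subst e r = ap (e (~~ i)) r.
Proof.
move=> h; apply: (sp_ind (T := fun r => subst e r = ap (e (~~ i)) r) h).
  by rewrite /unary !subst0.
move=> k n g hn IH; rewrite /unary !substD !substZ; congr (_ *: _ + _) => //.
rewrite !subst_mono; case: n hn => [z|] //=.
elim: z => [j|z1 h1 z2 h2] /=; first by rewrite /delta; case: (i); case: j.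
by rewrite addn_eq0 => /andP[/h1 -> /h2 ->].
Qed.

Lemma free_pair e m : (forall i, sp (fun n => sw n == m i) (e i)) ->
  (forall i, 0 < m i)%N -> (forall i r, e i <> ap (e (~~ i)) r) ->
  forall r, subst e r = 0 -> r = 0.
Proof.
move=> he m0 ne; apply: crit => [i|r r0].
  by apply: wcomp_eq0 (he i) => n /eqP->; rewrite -lt0n.
have r'0 i : wcomp (delta i) 1 (wcomp m (m i) r) = 0.
  set r' := wcomp m (m i) r.
  have : subst e r' = 0 by rewrite -(wcomp_subst freeF _ _ he) r0 linear0.
  have ht : sp (fun n => n == Some (Letter i)) (r' - wcomp (delta i) 0 r').
    have [N [rE rN]] := wcomp_sum freeF (delta i) r'.
    have -> : r' - wcomp (delta i) 0 r' = \sum_(d < N | d != 0 :> nat) wcomp (delta i) d r'.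
      case: N rE rN => [|N] rE rN.
        by rewrite big_ord0 rN // rE big_ord0 subrr.
      apply/eqP; rewrite subr_eq [X in _ == X]addrC; apply/eqP.
      by rewrite {1}rE (bigD1 ord0).
    apply: (big_ind (sp (fun n => n == Some (Letter i)))) => [|f g|d d0].
    - exact: mspan0.
    - exact: mspanD.
    apply: mspanS (wcomp_span freeF (delta i) d (wcomp_sp freeF m (m i) r)) => n.
    case/andP=> /eqP e1 /eqP e2; apply/eqP/(wt_delta_letter m0 e1).
    by rewrite e2 lt0n.
  have [a aE] : exists a, r' - wcomp (delta i) 0 r' = a *: v i.
    apply: (sp_ind (T := fun f => exists a, f = a *: v i) ht).
      by exists 0; rewrite scale0r.
    by move=> k n g /eqP -> [a ->]; exists (k + a); rewrite scalerDl.
  rewrite -[r' in subst e r'](subrK (wcomp (delta i) 0 r')) aE substD substZ subst_v.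
  rewrite (subst_ap e (wcomp_sp freeF _ _ _)) => h.
  have a0 : a = 0.
    apply: contrapT => /eqP a0.
    apply: (ne i (- a^-1 *: wcomp (delta i) 0 r')).
    rewrite /unary substZ scaleNr; apply/eqP; rewrite -addr_eq0.
    by rewrite -(inj_eq (scalerI a0)) scalerDr scalerA divff // scale1r scaler0 h.
  rewrite -[r'](subrK (wcomp (delta i) 0 r')) aE a0 scale0r add0r.
  by rewrite wcomp_wcomp.
have [a [b]] := sp_linear (wcomp_sp freeF tot 1 r).
rewrite -[x]/(v false) -[y]/(v true) => rE.
have ai i : wcomp (delta i) 1 (wcomp tot 1 r) = 0.
  have : wcomp m (m i) (wcomp (delta i) 1 (wcomp tot 1 r)) = wcomp (delta i) 1 (wcomp tot 1 r).
    rewrite rE wcomp_lin2 /delta.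
    by case: i; rewrite eqxx ?scale0r !scale1r ?addr0 ?add0r wcompZ wcomp_v eqxx.
  by move=> <-; rewrite (wcompC (delta i) tot) (wcompC m tot) (wcompC m (delta i)) r'0 wcomp0.
have := ai true; have := ai false.
rewrite !rE !wcomp_lin2 /delta /=.
by rewrite !scale0r !scale1r addr0 add0r => -> ->; rewrite addr0.
Qed.

End Criterion.
End Structure.

(** * Automorphisms and degree reduction *)

Section Automorphisms.
Variables (K : closedFieldType) (u : bool) (I : napoly K nat -> Prop).
Variables (F : nalgType u K) (x y : F).
Hypothesis freeF : free_on I (pair_gen x y).
Notation v := (pair_gen x y).
Notation sp := (mspan v).
Notation tot := (fun _ : bool => 1%N).
Notation sw := (wt tot).
Notation subst := (fsubst freeF).
Notation wcomp := (component freeF).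
Notation ap := (unary freeF).
Hypothesis crit : free_criterion freeF.
Hypothesis x_neq0 : x != 0.
Implicit Types (f g r : F) (e : bool -> F) (m : bool -> nat).

Definition autpair f g : Prop := bijective (subst (pair_gen f g)).
Notation aut := autpair.

Lemma autP f g : is_automorphism x y f g <-> aut f g.
Proof.
split=> [[phi [hphi bphi <- <-]]|h].
  apply: eq_bij bphi _ _ => r; rewrite (hom_subst freeF hphi).
  by congr (fsubst _ _ _); apply/funext => -[].
exists (subst (pair_gen f g)); split=> //; first exact: subst_hom.
  exact: (subst_v freeF _ false).
exact: (subst_v freeF _ true).
Qed.

Lemma subst_pair f g f' g' r : subst (pair_gen f g) (subst (pair_gen f' g') r) =
  subst (pair_gen (subst (pair_gen f g) f') (subst (pair_gen f g) g')) r.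
Proof.
by rewrite subst_subst; congr (fsubst _ _ _); apply/funext => -[].
Qed.

Lemma subst_x f g : subst (pair_gen f g) x = f.
Proof. exact: (subst_v freeF _ false). Qed.
Lemma subst_y f g : subst (pair_gen f g) y = g.
Proof. exact: (subst_v freeF _ true). Qed.

Lemma subst_apE e g w : subst e (ap g w) = ap (subst e g) w.
Proof. exact: subst_subst. Qed.

Lemma aut_comp f g f' g' : aut f g -> aut f' g' ->
  aut (subst (pair_gen f g) f') (subst (pair_gen f g) g').
Proof.
move=> h h'; apply: eq_bij (bij_comp h h') _ _ => r /=.
exact: subst_pair.
Qed.

Lemma aut_swap f g : aut f g -> aut g f.
Proof.
move=> h.
have hs : aut y x.
  have hK : involutive (subst (pair_gen y x)).
    by move=> r; rewrite subst_pair subst_x subst_y subst_id.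
  exact: inv_bij hK.
have := aut_comp h hs; by rewrite subst_x subst_y.
Qed.

Lemma aut_elem f g w : aut f g -> aut (f + ap g w) g.
Proof.
move=> h.
have hs w' : subst (pair_gen (x + ap y w') y) y = y by rewrite subst_y.
have he w' r : subst (pair_gen (x + ap y w') y) (subst (pair_gen (x - ap y w') y) r) = r.
  rewrite subst_pair subst_y substB subst_x subst_apE subst_y addrK.
  exact: subst_id.
have hs' : aut (x + ap y w) y.
  exists (subst (pair_gen (x - ap y w) y)) => r; last exact: he.
  have := he (- w) r; rewrite /unary -[- w]scaleN1r substZ scaleN1r opprK.
  by [].
by have := aut_comp h hs'; rewrite subst_y substD subst_x subst_apE subst_y.
Qed.

Lemma aut_not_const f g : aut f g -> ~ sp (fun n => sw n <= 0)%N f.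
Proof.
move=> /bij_inj inj hf.
have [a fE] : exists a, f = a *: nunit.
  by apply: (@sp_const _ _ _ x y); apply: mspanS hf => n; rewrite leqn0.
have := inj x (a *: nunit); rewrite subst_x substZ subst1 => /(_ fE) xE.
have : wcomp tot 1 x = 0.
  transitivity (wcomp tot 1 (a *: nunit)); first exact: (congr1 (wcomp tot 1) xE).
  by rewrite wcompZ (wcomp_mono freeF tot 1 None) scaler0.
by rewrite (wcomp_v freeF tot 1 false) => /eqP; apply/negP.
Qed.

Lemma top_dependent e m : bijective (subst e) ->
  (forall i, sp (fun n => sw n <= m i)%N (e i)) -> (forall i, 0 < m i)%N ->
  (exists i, 1 < m i)%N ->
  exists i r, wcomp tot (m i) (e i) = ap (wcomp tot (m (~~ i)) (e (~~ i))) r.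
Proof.
move=> [psi psiK Kpsi] he m0 [i mi]; apply: contrapT => nd.
pose t j := wcomp tot (m j) (e j).
have tinj : forall r, subst t r = 0 -> r = 0.
  apply: (free_pair crit (m := m)) => [j|//|j r ej].
    exact: wcomp_sp.
  by apply: nd; exists j, r.
have hp j : exists c b, v j = c *: nunit + b *: e (~~ i).
  pose p := psi (v j).
  have pE : subst e p = v j by rewrite Kpsi.
  have p0 : p != 0.
    by apply: contraNneq (v_neq0 freeF x_neq0 j) => p0; rewrite -pE p0 subst0.
  have [D [hD pD]] := wcomp_top freeF m p0.
  have [top _] := wcomp_subst_top freeF he pD.
  have D1 : D = 1%N.
    have : wcomp tot D (v j) != 0.
      by rewrite -pE top; apply: contraNneq hD => /tinj ->.
    by rewrite wcomp_v; case: (1%N =P D) => [<- //|_]; rewrite eqxx.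
  have [c [b pcb]] : exists c b, p = c *: nunit + b *: v (~~ i).
    apply: (sp_ind (T := fun p => exists c b, p = c *: nunit + b *: v (~~ i)) pD).
      by exists 0, 0; rewrite !scale0r addr0.
    move=> k n g nD [c [b ->]].
    case: n nD => [[l|z1 z2]|] /=.
    - have [->|li] := eqVneq l i; first by rewrite D1 leqNgt mi.
      have -> : l = ~~ i by move: li; case: l; case: (i).
      by exists c, (k + b); rewrite scalerDl addrCA.
    - have pos z : (0 < word_wt m z)%N by elim: z => //= z1' h1 z2' h2; rewrite addn_gt0 h1.
      by rewrite D1 leqNgt -[2%N]/(1 + 1)%N leq_add.
    - by exists (k + c), b; rewrite scalerDl addrA.
  by exists c, b; rewrite -pE pcb substD !substZ subst1 subst_v.
have [c0 [b0 e0]] := hp false; have [c1 [b1 e1]] := hp true.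
have rel : b1 *: v false + (- b0) *: v true = (b1 * c0 - b0 * c1) *: nunit.
  rewrite e0 e1 !scalerDr !scalerA addrACA -!scalerDl !mulNr [b1 * b0]mulrC.
  by rewrite subrr scale0r addr0.
have cst w d : (0 < d)%N -> wcomp w d ((b1 * c0 - b0 * c1) *: nunit) = 0.
  by case: d => // d _; rewrite wcompZ (wcomp_mono freeF w d.+1 None) /= scaler0.
have b10 : b1 = 0.
  have := cst (delta false) 1%N isT; rewrite -rel wcomp_lin2 /delta /= scale0r addr0 scale1r.
  by move/eqP; rewrite scaler_eq0 (negPf x_neq0) orbF => /eqP.
have h1 : wcomp tot 1 (v true) = 0.
  by rewrite e1 b10 scale0r addr0 wcompZ (wcomp_mono freeF tot 1 None) scaler0.
by have := v_neq0 freeF x_neq0 true; rewrite -h1 wcomp_v eqxx.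
Qed.

Lemma wt_cst (b : nat) n : wt (fun _ : bool => b) n = (sw n * b)%N.
Proof.
case: n => [z|] //=; elim: z => [_|z1 h1 z2 h2] /=; first by rewrite mul1n.
by rewrite h1 h2 mulnDl.
Qed.

Lemma ap_ap g r : ap g (ap x r) = ap g r.
Proof.
rewrite /unary subst_subst; congr (fsubst _ _ _); apply/funext => i.
exact: (subst_v freeF _ false).
Qed.

Lemma sp_ap (P : pred (mono bool)) g r : (forall n, P n -> sp P (mono_eval (fun=> g) n)) ->
  sp P r -> sp P (ap g r).
Proof.
move=> h hr; apply: (sp_ind (T := fun r => sp P (ap g r)) hr).
  by rewrite /unary subst0; apply: mspan0.
move=> k n g' Pn IH; rewrite /unary substD substZ subst_mono.
by apply: mspanD => //; apply: mspanZ; apply: h.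
Qed.

Lemma sp_ap_x (Q : nat -> bool) r :
  sp (fun n => Q (sw n)) r -> sp (fun n => Q (sw n)) (ap x r).
Proof.
apply: sp_ap => n Qn.
have -> : mono_eval (fun=> x) n = mono_eval v (omap (word_map (fun=> false)) n).
  by rewrite mono_eval_map.
by apply: mspan_mono; rewrite wt_map.
Qed.

Lemma reduce1 f g a b : aut f g ->
  sp (fun n => sw n <= a)%N f -> sp (fun n => sw n <= b)%N g ->
  (0 < b <= a)%N -> (1 < a)%N -> wcomp tot a f != 0 -> wcomp tot b g != 0 ->
  exists k w, [/\ (k * b)%N = a, sp (fun n => sw n == k) w, ap x w = w &
    sp (fun n => sw n < a)%N (f - ap g w)].
Proof.
move=> hfg fa gb /andP[b0 ba] a1 fa0 gb0.
set ft := wcomp tot a f in fa0 *; set gt := wcomp tot b g in gb0 *.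
suff [k [w0 [kb w0k fw]]] : exists k w, [/\ (k * b)%N = a, sp (fun n => sw n == k) w &
    ft = ap gt w].
  exists k, (ap x w0); split=> //.
  - exact: (sp_ap_x (Q := fun d => d == k)).
  - by rewrite ap_ap.
  have he : forall i, sp (fun n => sw n <= (fun _ : bool => b) i)%N ((fun _ : bool => g) i).
    by [].
  have ha : sp (fun n => wt (fun _ : bool => b) n <= a)%N w0.
    by apply: mspanS w0k => n /eqP e; rewrite wt_cst e kb.
  have [t1 t2] := wcomp_subst_top freeF he ha.
  rewrite ap_ap; apply/(sp_ltP freeF) => d; rewrite leq_eqVlt wcompB.
  case/orP=> [/eqP<-|ad]; last first.
    by rewrite !((sp_leP freeF _ _ _).1 _ _ ad) ?subrr.
  rewrite /unary t1 -/gt -/ft fw (wcomp_fix freeF _ w0k) ?subrr // => n /eqP e.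
  by rewrite wt_cst e kb.
pose m i := if i then b else a.
have [i|i||i [r hr]] := @top_dependent (pair_gen f g) m hfg.
- by case: i.
- by rewrite /m; case: i => //; apply: leq_trans ba.
- by exists false.
have homt h d (hd : sp (fun n => sw n == d) h) d' r' :
    wcomp tot d' (ap h r') = ap h (wcomp (fun=> d) d' r').
  exact: wcomp_subst.
case: i hr; rewrite /= -/ft -/gt => hr.
  have : gt = ap ft (wcomp (fun=> a) b r).
    by rewrite -(homt ft a (wcomp_sp freeF _ _ _)) -hr /gt wcomp_wcomp eqxx.
  set r' := wcomp _ _ r => gr.
  have hr' : sp (fun n => (sw n == 1%N) && (a == b)) r'.
    apply: mspanS (wcomp_sp freeF _ _ _) => n; rewrite wt_cst.
    case: (sw n) => [|[|l]]; rewrite ?mul0n ?mul1n => /eqP e.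
    - by rewrite -e in b0.
    - by rewrite e !eqxx.
    - have : (b < l.+2 * a)%N.
        by rewrite (leq_ltn_trans ba) // ltn_Pmull // ltnW.
      by rewrite e ltnn.
  have ab : a = b.
    apply/eqP/negPn/negP => ne; case/eqP: gb0; rewrite gr.
    suff -> : r' = 0 by rewrite /unary subst0.
    by apply: (sp_ind (T := fun r => r = 0) hr') => // k n g' /andP[_]; rewrite (negPf ne).
  have [al [be rE]] : exists al be, r' = al *: x + be *: y.
    by apply: (@sp_linear _ _ _ x y); apply: mspanS hr' => n /andP[].
  have gE : gt = (al + be) *: ft.
    rewrite gr rE /unary substD !substZ (subst_v freeF _ false) (subst_v freeF _ true).
    by rewrite scalerDl.
  have ga0 : al + be != 0 by apply: contraNneq gb0 => z; rewrite gE z scale0r.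
  exists 1%N, ((al + be)^-1 *: x); split; first by rewrite mul1n.
    by apply: mspanZ; apply: (@mspan_mono _ _ _ _ v _ (Some (Letter false))).
  by rewrite /unary substZ (subst_v freeF _ false) gE scalerA mulVf // scale1r.
have : ft = ap gt (wcomp (fun=> b) a r).
  by rewrite -(homt gt b (wcomp_sp freeF _ _ _)) -hr /ft wcomp_wcomp eqxx.
set r' := wcomp _ _ r => fr.
have hr' : sp (fun n => (sw n * b == a)%N) r'.
  by apply: mspanS (wcomp_sp freeF _ _ _) => n; rewrite wt_cst.
exists (a %/ b)%N, r'; split=> //.
  rewrite divnK //; apply/negPn/negP => nd; case/eqP: fa0; rewrite fr.
  suff -> : r' = 0 by rewrite /unary subst0.
  apply: (sp_ind (T := fun r => r = 0) hr') => // k n g' /eqP e.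
  by case/negP: nd; rewrite -e dvdn_mull.
by apply: mspanS hr' => n /eqP <-; rewrite mulnK.
Qed.

Lemma reduce f g a b : aut f g ->
  sp (fun n => sw n <= a)%N f -> sp (fun n => sw n <= b)%N g ->
  (0 < b)%N -> wcomp tot b g != 0 ->
  exists w f', [/\ f = f' + ap g w, ap x w = w,
    sp (fun n => 2 <= sw n <= a %/ b)%N w & sp (fun n => sw n <= b)%N f'].
Proof.
move=> + + gb b0 gb0; elim: a f => [|a IH] f hfg fa.
  exists 0, f; split; rewrite /unary ?subst0 ?addr0 //; first exact: mspan0.
  by apply: mspanS fa => n; rewrite leqn0 => /eqP ->.
have sw_mono w : sp (fun n => 2 <= sw n <= a %/ b)%N w -> sp (fun n => 2 <= sw n <= a.+1 %/ b)%N w.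
  apply: mspanS => n /andP[-> h] /=; apply: leq_trans h _.
  exact: leq_div2r.
have [ab|ba] := leqP a.+1 b.
  exists 0, f; split; rewrite /unary ?subst0 ?addr0 //; first exact: mspan0.
  by apply: mspanS fa => n h; apply: leq_trans h ab.
have step f1 : aut f1 g -> sp (fun n => sw n <= a)%N f1 -> exists w f', [/\ f1 = f' + ap g w, ap x w = w,
    sp (fun n => 2 <= sw n <= a.+1 %/ b)%N w & sp (fun n => sw n <= b)%N f'].
  move=> h1 h2; have [w [f' [-> h3 h4 h5]]] := IH f1 h1 h2.
  by exists w, f'; split=> //; apply: sw_mono.
have [fa0|fa0] := eqVneq (wcomp tot a.+1 f) 0.
  apply: step => //; apply/(sp_leP freeF) => d; rewrite leq_eqVlt => /orP[/eqP<- //|ad].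
  by rewrite ((sp_leP freeF _ _ _).1 fa).
have [||k [w [kb wk wx fw]]] := reduce1 hfg fa gb _ _ fa0 gb0.
- by rewrite b0 ltnW.
- exact: leq_ltn_trans b0 ba.
have [||w' [f' [fE w'x w'k f'b]]] := step (f - ap g w).
- have -> : f - ap g w = f + ap g (- w).
    by rewrite /unary -[- w]scaleN1r substZ scaleN1r.
  exact: aut_elem.
- by apply: mspanS fw => n; rewrite ltnS.
exists (w' + w), f'; split=> //.
- by rewrite /unary substD addrA -/(unary _ _ _) -[X in _ = X + _]fE subrK.
- by rewrite /unary substD -!/(unary _ _ _) w'x wx.
apply: mspanD => //; apply: mspanS wk => n /eqP ->.
rewrite -kb mulnK // leqnn andbT; move: ba; rewrite -kb.
by case: (k) => [|[|]] //; rewrite mul1n ltnn.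
Qed.

Lemma reduce_dvdn f g a b : aut f g ->
  sp (fun n => sw n <= a)%N f -> sp (fun n => sw n <= b)%N g ->
  (0 < b < a)%N -> wcomp tot a f != 0 -> wcomp tot b g != 0 -> (b %| a)%N.
Proof.
move=> h fa gb /andP[b0 ba] fa0 gb0.
have [|k [w [<- _ _ _]]] := reduce1 h fa gb _ (leq_ltn_trans b0 ba) fa0 gb0.
  by rewrite b0 ltnW.
exact: dvdn_mull.
Qed.

End Automorphisms.

(** * Polynomial families of pairs *)

Section Bases.
Variables (K : fieldType) (V : lmodType K).
Implicit Types P Q R : V -> Prop.

Lemma basis_coord P N (b : 'I_N -> V) (pi : V -> V) : is_basis P b ->
  linear pi -> (forall f, P (pi f)) ->
  exists L : V -> 'I_N -> K,
    (forall k f g i, L (k *: f + g) i = k * L f i + L g i) /\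
    (forall f, pi f = \sum_i L f i *: b i).
Proof.
move=> [ind gen] lin_pi Ppi.
have [L LE] : exists L : V -> 'I_N -> K, forall f, pi f = \sum_i L f i *: b i.
  have h f : exists a : 'I_N -> K, pi f = \sum_i a i *: b i by apply/gen.
  by have [L hL] := choice h; exists L.
exists L; split=> // k f g i; apply/eqP; rewrite -subr_eq0; apply/eqP.
move: i; apply: ind.
under eq_bigr do rewrite scalerBl scalerDl -scalerA.
by rewrite sumrB big_split /= -scaler_sumr -!LE lin_pi subrr.
Qed.

Lemma is_basis_mem P N (b : 'I_N -> V) i : is_basis P b -> P (b i).
Proof.
case=> _ gen; apply/gen; exists (fun j => (j == i)%:R).
rewrite (bigD1 i) //= eqxx scale1r big1 ?addr0 // => j /negPf ->.
by rewrite scale0r.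
Qed.

Lemma has_dimD P Q R a b : has_dim P a -> has_dim Q b ->
  (forall f, R f <-> exists p q, [/\ P p, Q q & f = p + q]) ->
  (forall p q, P p -> Q q -> p + q = 0 -> p = 0) ->
  has_dim R (a + b).
Proof.
move=> [bP [indP genP]] [bQ [indQ genQ]] RE disj.
exists (fun i => match fintype.split i with inl j => bP j | inr j => bQ j end).
have sumE (c : 'I_(a + b) -> K) :
    \sum_i c i *: match fintype.split i with inl j => bP j | inr j => bQ j end =
    \sum_i c (lshift b i) *: bP i + \sum_i c (rshift a i) *: bQ i.
  rewrite big_split_ord /=; congr (_ + _); apply: eq_bigr => i _.
    by rewrite -[lshift _ _]/(unsplit (inl i)) unsplitK.
  by rewrite -[rshift _ _]/(unsplit (inr i)) unsplitK.
split=> [c|f].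
  rewrite sumE => c0.
  have p0 : \sum_i c (lshift b i) *: bP i = 0.
    apply: disj c0; first by apply/genP; eexists.
    by apply/genQ; eexists.
  move: c0; rewrite p0 add0r => /indQ hQ i; have := indP _ p0 => hP.
  by case: (splitP i) => j e; [rewrite (_ : i = lshift b j)|rewrite (_ : i = rshift a j)] => //; apply: val_inj.
rewrite RE; split=> [[p [q [/genP[cp ->] /genQ[cq ->] ->]]]|[c ->]].
  exists (fun i => match fintype.split i with inl j => cp j | inr j => cq j end).
  rewrite sumE; congr (_ + _); apply: eq_bigr => i _.
    by rewrite -[lshift _ _]/(unsplit (inl i)) unsplitK.
  by rewrite -[rshift _ _]/(unsplit (inr i)) unsplitK.
rewrite sumE; do 2!eexists; split; last reflexivity.
  by apply/genP; eexists.
by apply/genQ; eexists.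
Qed.

Lemma has_dim0 P : (forall f, P f <-> f = 0) -> has_dim P 0.
Proof.
move=> h; exists (fun=> 0); split=> [a _ []|f] //.
rewrite h; split=> [->|[a ->]]; last by rewrite big_ord0.
by exists (fun=> 0); rewrite big_ord0.
Qed.

End Bases.

Section Families.
Variables (K : closedFieldType) (u : bool) (F : nalgType u K).

Definition pfun (T : finType) (h : (T -> K) -> F) : Prop :=
  exists (J : finType) (q : J -> (T -> K) -> K) (w : J -> F),
    (forall j, pol (q j)) /\ forall t, h t = \sum_j q j t *: w j.

Lemma pfun_ext (T : finType) (h1 h2 : (T -> K) -> F) :
  h1 =1 h2 -> pfun h1 -> pfun h2.
Proof. by move=> e [J [q [w [pq hE]]]]; exists J, q, w; split=> // t; rewrite -e. Qed.

Lemma pfun_scale (T : finType) (q : (T -> K) -> K) (w : F) :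
  pol q -> pfun (fun t => q t *: w).
Proof.
move=> pq; exists unit, (fun _ => q), (fun _ => w); split=> // t.
by rewrite big_const card_unit /= addr0.
Qed.

Lemma pfun_cst (T : finType) (w : F) : pfun (fun _ : T -> K => w).
Proof. by apply: pfun_ext (pfun_scale w (pol_cst T 1)) => t; rewrite scale1r. Qed.

Lemma pfun_add (T : finType) (h1 h2 : (T -> K) -> F) :
  pfun h1 -> pfun h2 -> pfun (fun t => h1 t + h2 t).
Proof.
case=> J1 [q1 [w1 [p1 e1]]] [J2 [q2 [w2 [p2 e2]]]].
exists (J1 + J2)%type, (fun j => match j with inl i => q1 i | inr i => q2 i end),
  (fun j => match j with inl i => w1 i | inr i => w2 i end).
by split=> [[j|j]|t] //; rewrite big_sumType /= e1 e2.
Qed.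

Lemma pfun_sum (T : finType) (J : Type) (r : seq J) (h : J -> (T -> K) -> F) :
  (forall j, pfun (h j)) -> pfun (fun t => \sum_(j <- r) h j t).
Proof.
move=> ph; elim: r => [|j r IH].
  by apply: pfun_ext (pfun_cst T 0) => t; rewrite big_nil.
by apply: pfun_ext (pfun_add (ph j) IH) => t; rewrite big_cons.
Qed.

Lemma pfun_scalep (T : finType) (q : (T -> K) -> K) (h : (T -> K) -> F) :
  pol q -> pfun h -> pfun (fun t => q t *: h t).
Proof.
move=> pq [J [q' [w [pq' hE]]]]; exists J, (fun j t => q t * q' j t), w.
split=> [j|t]; first exact: pol_mul.
by rewrite hE scaler_sumr; apply: eq_bigr => j _; rewrite scalerA.
Qed.

Lemma pfun_mul (T : finType) (h1 h2 : (T -> K) -> F) :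
  pfun h1 -> pfun h2 -> pfun (fun t => nmul (h1 t) (h2 t)).
Proof.
case=> J1 [q1 [w1 [p1 e1]]] [J2 [q2 [w2 [p2 e2]]]].
exists (J1 * J2)%type, (fun j t => q1 j.1 t * q2 j.2 t), (fun j => nmul (w1 j.1) (w2 j.2)).
split=> [j|t]; first exact: pol_mul.
rewrite e1 e2 nmul_suml -(pair_bigA _ (fun i j => (q1 i t * q2 j t) *: nmul (w1 i) (w2 j))) /=.
apply: eq_bigr => i _; rewrite nmul_sumr; apply: eq_bigr => j _.
by rewrite nmulZl nmulZr scalerA.
Qed.

Lemma pfun_comp (T U : finType) (h : (T -> K) -> F) (g : (U -> K) -> T -> K) :
  (forall i, pol (fun t => g t i)) -> pfun h -> pfun (fun t => h (g t)).
Proof.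
move=> pg [J [q [w [pq hE]]]]; exists J, (fun j t => q j (g t)), w.
by split=> [j|t]; [exact: pol_comp2|rewrite hE].
Qed.

Lemma pfun_functional (T : finType) (h : (T -> K) -> F) (L : F -> K) :
  (forall k f g, L (k *: f + g) = k * L f + L g) -> pfun h -> pol (fun t => L (h t)).
Proof.
move=> lL [J [q [w [pq hE]]]].
have L0 : L 0 = 0.
  have := lL 1 0 0; rewrite scale1r mul1r addr0 => e.
  by apply: (addrI (L 0)); rewrite -e addr0.
apply: (@pol_ext _ _ (fun t => \sum_j q j t * L (w j))) => [t|].
  rewrite hE; elim: (index_enum J) => [|j r IH]; rewrite ?big_nil ?L0 //.
  by rewrite !big_cons lL IH.
by apply: pol_sum => j; apply: pol_mul => //; apply: pol_cst.
Qed.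

Lemma pfun_mono_eval (T : finType) (e : (T -> K) -> bool -> F) n :
  (forall i, pfun (fun t => e t i)) -> pfun (fun t => mono_eval (e t) n).
Proof.
move=> pe; case: n => [z|] /=; last exact: pfun_cst.
by elim: z => //= z1 h1 z2 h2; apply: pfun_mul.
Qed.

(** [S] is contained in a finite union of polynomial families with at most [d]
    parameters each. *)
Inductive covered (d : nat) : (F -> F -> Prop) -> Prop :=
  | cover_family (T : finType) (hf hg : (T -> K) -> F) (S : F -> F -> Prop) of
      (#|T| <= d)%N & pfun hf & pfun hg &
      (forall f g, S f g -> exists t, f = hf t /\ g = hg t) : covered d S
  | cover_union (S1 S2 S : F -> F -> Prop) of covered d S1 & covered d S2 &
      (forall f g, S f g -> S1 f g \/ S2 f g) : covered d S.

Lemma coverS d d' (S S' : F -> F -> Prop) : (d <= d')%N ->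
  (forall f g, S' f g -> S f g) -> covered d S -> covered d' S'.
Proof.
move=> dd sub cS; elim: cS S' sub => [T hf hg {}S Td pf pg hS|S1 S2 {}S _ h1 _ h2 hS] S' sub.
  by apply: (cover_family _ pf pg) => [|f g /sub/hS //]; apply: leq_trans dd.
by apply: (cover_union (h1 S1 _) (h2 S2 _)) => // f g /sub/hS.
Qed.

Lemma cover_swap d (S : F -> F -> Prop) : covered d S -> covered d (fun f g => S g f).
Proof.
elim=> [T hf hg {}S Td pf pg hS|S1 S2 {}S _ h1 _ h2 hS].
  by apply: (cover_family Td pg pf) => f g /hS[t [-> ->]]; exists t.
by apply: (cover_union h1 h2) => f g /hS.
Qed.

Lemma cover_empty d : covered d (fun _ _ => False).
Proof.
apply: (@cover_family d void (fun=> 0) (fun=> 0)) => //; try exact: pfun_cst.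
by rewrite card_void.
Qed.

Lemma cover_bigU d n (S : nat -> F -> F -> Prop) :
  (forall b, (b < n)%N -> covered d (S b)) ->
  covered d (fun f g => exists2 b, (b < n)%N & S b f g).
Proof.
elim: n => [|n IH] hS; first by apply: coverS (cover_empty d) => // f g [].
apply: (cover_union (IH _) (hS n (ltnSn n))); first by move=> b /ltnW; apply: hS.
move=> f g [b]; rewrite ltnS leq_eqVlt => /orP[/eqP->|bn] h; first by right.
by left; exists b.
Qed.

End Families.

Section Upper.
Variables (K : closedFieldType) (u : bool) (I : napoly K nat -> Prop).
Variables (F : nalgType u K) (x y : F).
Hypothesis freeF : free_on I (pair_gen x y).
Notation v := (pair_gen x y).
Notation sp := (mspan v).
Notation tot := (fun _ : bool => 1%N).
Notation sw := (wt tot).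
Notation subst := (fsubst freeF).
Notation wcomp := (component freeF).
Notation ap := (unary freeF).
Notation aut := (autpair freeF).
Implicit Types (f g r : F).

Lemma pfun_subst (T : finType) (e : (T -> K) -> bool -> F) w :
  (forall i, pfun (fun t => e t i)) -> pfun (fun t => subst (e t) w).
Proof.
move=> pe.
apply: (@pfun_ext _ _ _ _ (fun t => \sum_(i <- rep freeF w) i.1 *: mono_eval (e t) i.2)).
  move=> t; rewrite -{2}(repE freeF w) (hom_lin _ _ (subst_hom freeF _)) /lin.
  apply: eq_bigr => i _; congr (_ *: mono_eval _ _); apply/funext => j /=.
  by rewrite subst_v.
apply: pfun_sum => i; apply: pfun_scalep; [exact: pol_cst|exact: pfun_mono_eval].
Qed.

Lemma pfun_ap (T : finType) (h : (T -> K) -> F) w :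
  pfun h -> pfun (fun t => ap (h t) w).
Proof. by move=> ph; apply: pfun_subst. Qed.

Lemma cover_ext d M (W : 'I_M -> F) (S : F -> F -> Prop) : covered d S ->
  covered (d + M) (fun f g => exists f' (a : 'I_M -> K),
    S f' g /\ f = f' + \sum_j a j *: ap g (W j)).
Proof.
elim=> [T hf hg {}S Td pf pg hS|S1 S2 {}S _ h1 _ h2 hS]; last first.
  apply: (cover_union h1 h2) => f g [f' [a [/hS[] h ->]]]; [left|right]; by exists f', a.
pose T' := (T + 'I_M)%type; pose g1 (t : T' -> K) i := t (inl i).
have pg1 i : pol (fun t => g1 t i) by apply: pol_var.
apply: (@cover_family _ _ _ _ T'
  (fun t => hf (g1 t) + \sum_j t (inr j) *: ap (hg (g1 t)) (W j))
  (fun t => hg (g1 t))).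
- by rewrite card_sum card_ord leq_add2r.
- apply: pfun_add; first exact: pfun_comp.
  apply: pfun_sum => j; apply: pfun_scalep; first exact: pol_var.
  by apply: pfun_ap; apply: pfun_comp.
- exact: pfun_comp.
move=> f g [f' [a [/hS[t [-> ->]] ->]]].
by exists (fun i => match i with inl i => t i | inr j => a j end).
Qed.

Lemma nunit_mulrn : (nunit : F) *+ u = nunit.
Proof.
apply: if_elim (@nunitP u K F) => [e _|_ ->]; last by rewrite mul0rn.
by rewrite [X in _ *+ X](_ : _ = 1%N) ?mulr1n // e.
Qed.

Lemma sp_affine f : sp (fun n => sw n <= 1)%N f ->
  exists a b c, f = a *: x + b *: y + c *: nunit.
Proof.
move=> hf; have [n [fE _]] := wcomp_sum freeF tot f.
have [a [b e1]] := sp_linear (wcomp_sp freeF tot 1 f).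
have [c e0] := sp_const (wcomp_sp freeF tot 0 f).
exists a, b, c; rewrite -e1 -e0; apply/eqP; rewrite -subr_eq0; apply/eqP.
apply: (wcomp_inj0 (freeF := freeF) (w := tot)) => d.
rewrite wcompB wcompD !wcomp_wcomp.
case: d => [|[|d]] /=; rewrite ?add0r ?addr0 ?subrr //.
by rewrite ((sp_leP freeF _ _ _).1 hf) // subrr.
Qed.

Lemma cover_affine : covered (4 + 2 * u)
  (fun f g => sp (fun n => sw n <= 1)%N f /\ sp (fun n => sw n <= 1)%N g).
Proof.
pose T := (bool * bool + bool * 'I_u)%type.
pose h (i : bool) (t : T -> K) : F := t (inl (i, false)) *: x + t (inl (i, true)) *: y
  + \sum_(k < u) t (inr (i, k)) *: nunit.
have ph i : pfun (h i).
  apply: pfun_add; first by apply: pfun_add; apply: pfun_scale; apply: pol_var.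
  by apply: pfun_sum => k; apply: pfun_scale; apply: pol_var.
apply: (@cover_family _ _ _ _ T (h false) (h true)) => //.
  by rewrite card_sum !card_prod card_bool card_ord.
move=> f g [/sp_affine[a [b [c ->]]] /sp_affine[a' [b' [c' ->]]]].
exists (fun i => match i with
  | inl (false, false) => a | inl (false, true) => b
  | inl (true, false) => a' | inl (true, true) => b'
  | inr (false, _) => c | inr (true, _) => c' end).
rewrite /h /= !sumr_const card_ord !scalerMnr nunit_mulrn.
by [].
Qed.

Lemma deg_coord n N (b : 'I_N -> F) : is_basis (deg_le v n) b ->
  exists L : F -> 'I_N -> K,
    [/\ forall k f g i, L (k *: f + g) i = k * L f i + L g i,
        forall f, deg_le v n f -> f = \sum_i L f i *: b i
      & forall a i, L (\sum_j a j *: b j) i = a i].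
Proof.
move=> hb.
pose pi f := \sum_(i < n.+1) wcomp tot i f.
have pi_lin : linear pi.
  move=> a f g; rewrite /pi scaler_sumr -big_split /=; apply: eq_bigr => i _.
  by rewrite wcompD wcompZ.
have pi_mem f : deg_le v n (pi f).
  apply/deg_leP; apply: mspan_sum => i; apply: mspanS (wcomp_sp freeF tot i f).
  by move=> z /eqP ->; rewrite -ltnS.
have [L [Llin LE]] := basis_coord hb pi_lin pi_mem.
have pi_id f : deg_le v n f -> pi f = f.
  move/deg_leP => hf; have [m [fE fm]] := wcomp_sum freeF tot f.
  rewrite [RHS]fE /pi.
  have ext M N' : (M <= N')%N -> (forall d, (M <= d)%N -> wcomp tot d f = 0) ->
      \sum_(i < M) wcomp tot i f = \sum_(i < N') wcomp tot i f.
    move=> MN z; rewrite (big_ord_widen _ (fun i => wcomp tot i f) MN) big_mkcond /=.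
    by apply: eq_bigr => i _; case: ltnP => // /z ->.
  have [nm|mn] := leqP n.+1 m; last by rewrite (ext _ _ (ltnW mn)).
  by apply: ext => // d' nd; rewrite ((sp_leP freeF _ _ _).1 hf).
exists L; split=> // [f hf|a i]; first by rewrite -LE pi_id.
have hm : deg_le v n (\sum_j a j *: b j) by apply/hb.2; exists a.
apply/eqP; rewrite -subr_eq0; apply/eqP; move: i; apply: hb.1.
under eq_bigr do rewrite scalerBl.
by rewrite sumrB -LE pi_id // subrr.
Qed.

Lemma card_points n N (b : 'I_N -> F) d (S : F -> F -> Prop) k :
  is_basis (deg_le v n) b -> covered d S ->
  zchain (fun p : 'rV[K]_(N + N) =>
    S (\sum_(i < N) lsubmx p 0 i *: b i) (\sum_(i < N) rsubmx p 0 i *: b i)) k ->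
  (k <= d)%N.
Proof.
move=> hb cS /zchain_dependent; apply=> h dk.
have [L [Llin LE co]] := deg_coord hb.
elim: cS k h dk => {S} [T hf hg S Td pf pg hS|S1 S2 S _ h1 _ h2 hS] k h dk.
  pose phi (t : T -> K) : 'rV[K]_(N + N) :=
    row_mx (\row_i L (hf t) i) (\row_i L (hg t) i).
  have pphi : polymap phi.
    move=> i; case: (splitP i) => j e.
      rewrite (_ : i = lshift N j); last exact: val_inj.
      apply: (@pol_ext _ _ (fun t => L (hf t) j)).
        by move=> t; rewrite /phi row_mxEl mxE.
      by apply: (@pfun_functional _ _ _ _ hf (fun f => L f j)).
    rewrite (_ : i = rshift N j); last exact: val_inj.
    apply: (@pol_ext _ _ (fun t => L (hg t) j)).
      by move=> t; rewrite /phi row_mxEr mxE.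
    by apply: (@pfun_functional _ _ _ _ hg (fun f => L f j)).
  have [P P0 hP] := polymap_dependent h pphi (leq_ltn_trans Td dk).
  exists P => // p /hS[t [ef eg]].
  have -> : p = phi t; last exact: hP.
  rewrite -[p]hsubmxK /phi; congr row_mx; apply/rowP => i; rewrite [RHS]mxE.
    by rewrite -ef co.
  by rewrite -eg co.
have [P1 P10 hP1] := h1 k h dk; have [P2 P20 hP2] := h2 k h dk.
exists (P1 * P2); first by rewrite mulf_neq0.
move=> p /hS[/hP1|/hP2] e; by rewrite mevalM e ?mul0r ?mulr0.
Qed.

End Upper.

(** * The upper bound *)

Section Growth.
Variable c : nat -> nat.
Hypotheses (c1 : c 1%N = 1%N) (c2 : c 2%N = 1%N).
Hypothesis c_mono : forall n, (1 < n)%N -> (c n <= c n.+1)%N.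

Definition csum n := (\sum_(1 <= i < n.+1) c i)%N.

Lemma c_le i j : (0 < i <= j)%N -> (c i <= c j)%N.
Proof.
case/andP=> i0; elim: j => [|j IH]; first by rewrite leqn0 => /eqP e; rewrite e in i0.
rewrite leq_eqVlt ltnS => /orP[/eqP->//|ij]; apply: leq_trans (IH ij) _.
case: j {IH} ij => [|[|j]] ij; last exact: c_mono.
  by move: i0 ij; case: i.
by move: i0 ij; case: i => [|[|i]]; rewrite // c1 c2.
Qed.

Lemma c_gt0 n : (0 < n)%N -> (0 < c n)%N.
Proof. by move=> n0; rewrite -c1 c_le. Qed.

Lemma csumS n : (0 < n)%N -> csum n = (1 + \sum_(2 <= i < n.+1) c i)%N.
Proof. by move=> n0; rewrite /csum big_ltn ?ltnS // c1. Qed.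

Lemma csum_add a b : (csum a + csum b <= csum (a + b))%N.
Proof.
rewrite /csum (@big_cat_nat _ _ _ a.+1 1 (a + b).+1) //= ?ltnS ?leq_addr //.
rewrite leq_add2l.
have -> : (\sum_(a.+1 <= i < (a + b).+1) c i = \sum_(1 <= i < b.+1) c (i + a))%N.
  by rewrite -add1n big_addn; congr bigop; congr index_iota; lia.
rewrite !big_nat; apply: leq_sum => i /andP[i1 _].
by rewrite c_le // i1 leq_addr.
Qed.

Lemma csum_mono a b : (a <= b)%N -> (csum a <= csum b)%N.
Proof. by move=> ab; rewrite -(subnKC ab); apply: leq_trans (csum_add _ _); rewrite leq_addr. Qed.

Lemma csum_mul a b : (1 < a)%N -> (1 < b)%N -> (csum a + csum b <= csum (a * b))%N.
Proof.
move=> a1 b1; apply: leq_trans (csum_add a b) _; apply: csum_mono.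
nia.
Qed.

End Growth.

Section Cover.
Variables (K : closedFieldType) (u : bool) (I : napoly K nat -> Prop).
Variables (F : nalgType u K) (x y : F).
Hypothesis freeF : free_on I (pair_gen x y).
Notation v := (pair_gen x y).
Notation sp := (mspan v).
Notation tot := (fun _ : bool => 1%N).
Notation sw := (wt tot).
Notation subst := (fsubst freeF).
Notation wcomp := (component freeF).
Notation ap := (unary freeF).
Notation aut := (autpair freeF).
Implicit Types (f g r : F).
Hypothesis crit : free_criterion freeF.
Hypothesis x_neq0 : x != 0.
Variable c : nat -> nat.
Hypothesis c_dim : forall n, (0 < n)%N ->
  has_dim (homogeneous (fun _ : unit => x) n) (c n).
Hypotheses (c1 : c 1%N = 1%N) (c2 : c 2%N = 1%N).
Hypothesis c_mono : forall n, (1 < n)%N -> (c n <= c n.+1)%N.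

Definition upoly k f := ap x f = f /\ sp (fun n => 2 <= sw n <= k)%N f.

Lemma wcomp_ap_x d r : wcomp tot d (ap x r) = ap x (wcomp tot d r).
Proof.
apply: wcomp_subst => _.
exact: (@mspan_mono _ _ _ _ v _ (Some (Letter false))).
Qed.

Lemma upoly_small k f : (k < 2)%N -> (upoly k f <-> f = 0).
Proof.
move=> k2; split=> [[_ hf]|->]; last first.
  by split; rewrite /unary ?subst0 //; apply: mspan0.
apply: (sp_ind (T := fun f => f = 0) hf) => // k' n g' /andP[h1 h2] _.
by have := leq_ltn_trans (leq_trans h1 h2) k2; rewrite ltnn.
Qed.

Lemma upoly_dim k : has_dim (upoly k) (\sum_(2 <= i < k.+1) c i).
Proof.
elim: k => [|k IH].
  by rewrite big_geq //; apply: has_dim0 => f; apply: upoly_small.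
case: k IH => [|k] IH.
  by rewrite big_geq //; apply: has_dim0 => f; apply: upoly_small.
rewrite big_nat_recr //=; apply: (has_dimD IH (c_dim (ltn0Sn k.+1))) => [f|p q].
  split=> [[fx hf]|[p [q [[px hp] /(unary_homogeneousP freeF)[qx hq] ->]]]].
    exists (f - wcomp tot k.+2 f), (wcomp tot k.+2 f); split; last by rewrite subrK.
    - split.
        by rewrite /unary substB -!/(unary _ _ _) fx -wcomp_ap_x fx.
      have hs : sp (fun n => 2 <= sw n)%N (f - wcomp tot k.+2 f).
        apply: mspanB; first by apply: mspanS hf => n /andP[].
        by apply: mspanS (wcomp_sp freeF tot k.+2 f) => n /eqP ->.
      have hs' : sp (fun n => sw n < k.+2)%N (f - wcomp tot k.+2 f).
        apply/(sp_ltP freeF) => d; rewrite wcompB wcomp_wcomp leq_eqVlt.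
        case/orP=> [/eqP<-|kd]; first by rewrite eqxx subrr.
        rewrite (gtn_eqF kd) subr0; apply: wcomp_eq0 hf => n /andP[_ nk].
        by rewrite neq_ltn (leq_ltn_trans nk kd).
      have [n [-> nz]] := wcomp_sum freeF tot (f - wcomp tot k.+2 f).
      apply: mspan_sum => d; have [dk|kd] := leqP d k.+1; last first.
        by rewrite ((sp_ltP freeF _ _ _).1 hs' d kd); apply: mspan0.
      apply: mspanS (wcomp_span freeF tot d hs) => z.
      by case/andP=> -> /eqP ->.
    - by apply/(unary_homogeneousP freeF); rewrite -wcomp_ap_x fx wcomp_wcomp eqxx.
  split; first by rewrite /unary substD -!/(unary _ _ _) px qx.
  apply: mspanD; first by apply: mspanS hp => n /andP[-> /leqW].
  by rewrite -hq; apply: mspanS (wcomp_sp freeF tot k.+2 q) => n /eqP ->; rewrite ltnS /=.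
case=> _ hp /(unary_homogeneousP freeF)[_ hq] pq.
have p0 : wcomp tot k.+2 p = 0.
  apply: wcomp_eq0 hp => n /andP[_ h]; by rewrite neq_ltn ltnS h.
have := congr1 (wcomp tot k.+2) pq; rewrite wcompD p0 add0r hq wcomp0 => q0.
by rewrite -pq q0 addr0.
Qed.

Definition autdeg n f g := [/\ aut f g, sp (fun z => sw z <= n)%N f,
  sp (fun z => sw z <= n)%N g & wcomp tot n f != 0 \/ wcomp tot n g != 0].

Definition dimH n := (csum c n + 4 + 2 * u - (n == 1))%N.

Lemma cover_autdeg n : (0 < n)%N -> covered (dimH n) (autdeg n).
Proof.
elim/ltn_ind: n => n IH n0.
have [n1|n1] := eqVneq n 1%N.
  apply: coverS (cover_affine freeF) => [|f g [_ hf hg _]]; last by rewrite n1 in hf hg.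
  by rewrite /dimH n1 /csum big_nat1 c1 /=; lia.
have n2 : (1 < n)%N by lia.
pose G f g := [/\ aut f g, sp (fun z => sw z <= n)%N f,
  wcomp tot n f != 0 & sp (fun z => sw z < n)%N g].
pose d := (csum c n + 3 + 2 * u)%N.
have cG : covered d G.
  have hU k : exists W : 'I_(\sum_(2 <= i < k.+1) c i) -> F, is_basis (upoly k) W.
    by have [W hW] := upoly_dim k; exists W.
  pose S b f g := [/\ (0 < b)%N, (b %| n)%N & exists w f',
    [/\ autdeg b f' g, f = f' + ap g w & upoly (n %/ b) w]].
  apply: (coverS (leqnn d) (S := fun f g => exists2 b, (b < n)%N & S b f g)).
    move=> f g [h fn fn0 gn].
    have hg0 : g != 0.
      apply/negP => /eqP g0; apply: (aut_not_const x_neq0 (aut_swap h)).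
      by rewrite g0; apply: mspan0.
    have [b [gb0 gb]] := wcomp_top freeF tot hg0.
    have b0 : (0 < b)%N.
      case: (posnP b) => // b0; case: (aut_not_const x_neq0 (aut_swap h)).
      by rewrite b0 in gb.
    have bn : (b < n)%N.
      rewrite ltnNge; apply/negP => nb; case/eqP: gb0.
      exact: (sp_ltP freeF _ _ _).1 gn _ nb.
    have bd : (b %| n)%N by apply: (reduce_dvdn crit x_neq0 h fn gb) => //; rewrite b0.
    have [w [f' [fE wx hw f'b]]] := reduce crit x_neq0 h fn gb b0 gb0.
    exists b => //; split=> //; exists w, f'; split=> //.
    split=> //; last by right.
    have -> : f' = f + ap g (- w).
      by rewrite fE /unary -[- w]scaleN1r substZ scaleN1r addrK.
    exact: aut_elem.
  apply: cover_bigU => b bn.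
  have [/andP[b0 bd]|nb] := boolP ((0 < b)%N && (b %| n)%N); last first.
    apply: coverS (cover_empty F d) => // f g [b0 bd _].
    by rewrite b0 bd in nb.
  have [W hW] := hU (n %/ b)%N.
  apply: coverS (cover_ext freeF W (IH b bn b0)) => [|f g [_ _ [w [f' [h1 -> h2]]]]]; last first.
    have [a aE] := (hW.2 w).1 h2; exists f', a; split=> //; congr (_ + _).
    rewrite aE /unary (hom_sum (subst_hom freeF _)); apply: eq_bigr => j _.
    exact: substZ.
  have nE : (n %/ b * b = n)%N by rewrite divnK.
  have k1 : (1 < n %/ b)%N by rewrite ltn_divRL // mul1n.
  have := csumS c1 (ltnW k1); rewrite /dimH /d.
  have [->|b1] := eqVneq b 1%N.
    by rewrite divn1 /csum big_nat1 c1 /=; lia.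
  have := @csum_mul c c1 c2 c_mono (n %/ b) b k1; rewrite nE.
  have : (1 < b)%N by lia.
  by move=> b2 /(_ b2); lia.
pose M f g := exists f' (a : 'I_1 -> K), G g f' /\ f = f' + \sum_j a j *: ap g x.
have cM : covered (dimH n) M.
  apply: coverS (cover_ext freeF (fun _ : 'I_1 => x) (cover_swap cG)) => //.
  by rewrite /dimH /d (negPf n1); lia.
have dd : (d <= dimH n)%N by rewrite /dimH /d (negPf n1); lia.
apply: (cover_union (cover_union (coverS dd (fun f g h => h) cG)
    (coverS dd (fun f g h => h) (cover_swap cG)) (fun f g h => h)) cM).
move=> f g [h fn gn fg0].
have low f1 : sp (fun z => sw z <= n)%N f1 -> wcomp tot n f1 = 0 -> sp (fun z => sw z < n)%N f1.
  move=> h1 z; apply/(sp_ltP freeF) => d'; rewrite leq_eqVlt => /orP[/eqP<-//|nd].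
  exact: (sp_leP freeF _ _ _).1 h1 _ nd.
have [f0|f0] := eqVneq (wcomp tot n f) 0.
  left; right; split=> //; [exact: aut_swap|by case: fg0 => //; rewrite f0 eqxx|exact: low].
have [g0|g0] := eqVneq (wcomp tot n g) 0.
  by left; left; split=> //; apply: low.
right.
have [|k [w [kn wk wx fw]]] := reduce1 crit x_neq0 h fn gn _ n2 f0 g0.
  by rewrite n0 leqnn.
have k1 : k = 1%N by apply/eqP; rewrite -(eqn_pmul2r n0) mul1n kn.
rewrite k1 in wk; have [a [b wE]] := sp_linear wk.
have apx g' : ap g' x = g' by exact: (subst_v freeF _ false).
exists (f - ap g w), (fun=> a + b); split; last first.
  rewrite big_ord1 apx -wx wE /unary substD !substZ (subst_v freeF _ false).
  rewrite (subst_v freeF _ true) -scalerDl substZ -/(unary _ _ _) apx.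
  by rewrite subrK.
split=> //; apply: aut_swap.
have -> : f - ap g w = f + ap g (- w).
  by rewrite /unary -[- w]scaleN1r substZ scaleN1r.
exact: aut_elem.
Qed.

Lemma has_degP f n : has_deg v f n ->
  sp (fun z => sw z <= n)%N f /\ ((0 < n)%N -> wcomp tot n f != 0).
Proof.
case=> /deg_leP hf hmin; split=> // n0; apply/negP => /eqP z.
have : deg_le v n.-1 f.
  apply/deg_leP/(sp_leP freeF) => d; rewrite prednK // leq_eqVlt.
  case/orP=> [/eqP<-//|nd]; exact: (sp_leP freeF _ _ _).1 hf _ nd.
by move/hmin; rewrite leqNgt prednK // leqnn.
Qed.

Lemma has_deg_intro f n : sp (fun z => sw z <= n)%N f -> wcomp tot n f != 0 ->
  has_deg v f n.
Proof.
move=> hf f0; split; first exact/deg_leP.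
move=> k /deg_leP hk; rewrite leqNgt; apply/negP => kn; case/eqP: f0.
exact: (sp_leP freeF _ _ _).1 hk _ kn.
Qed.

Lemma upper_bound n N (b : 'I_N -> F) k : (0 < n)%N -> homog_basis x y n b ->
  zchain (aut_points x y n b) k -> (k <= dimH n)%N.
Proof.
move=> n0 [hb _].
apply: (@card_points _ _ _ _ _ _ freeF _ _ _ _
  (fun f g => is_automorphism x y f g /\ has_aut_deg x y f g n) _ hb).
apply: coverS (cover_autdeg n0) => // f g [/(autP freeF) h [k1 [k2 [h1 h2 nE]]]].
have [f1 f2] := has_degP h1; have [g1 g2] := has_degP h2.
split=> //.
- by apply: mspanS f1 => z zk; rewrite nE leq_max zk.
- by apply: mspanS g1 => z zk; rewrite nE leq_max zk orbT.
move: nE; rewrite /maxn; case: ifP => _ nE.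
  by right; rewrite nE; apply: g2; rewrite -nE.
by left; rewrite nE; apply: f2; rewrite -nE.
Qed.

End Cover.

(** * Linear functionals on the free algebra *)

Section Functionals.
Variables (K : closedFieldType) (u : bool) (F : nalgType u K).

Definition flin (L : F -> K) : Prop := forall k f g, L (k *: f + g) = k * L f + L g.

Variable L : F -> K.
Hypothesis hL : flin L.

Lemma flinD f g : L (f + g) = L f + L g.
Proof. by have := hL 1 f g; rewrite scale1r mul1r. Qed.
Lemma flin0 : L 0 = 0.
Proof. by apply: (addrI (L 0)); rewrite -flinD !addr0. Qed.
Lemma flinZ k f : L (k *: f) = k * L f.
Proof. by have := hL k f 0; rewrite !addr0 flin0 addr0. Qed.
Lemma flin_sum (J : finType) (f : J -> F) : L (\sum_j f j) = \sum_j L (f j).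
Proof. exact: (big_morph L flinD flin0). Qed.

Lemma flin_points N (b : 'I_N -> F) (s : bool) :
  exists q : {mpoly K[N + N]}, forall p : 'rV[K]_(N + N),
    peval q p = L (\sum_i (if s then rsubmx p else lsubmx p) 0 i *: b i).
Proof.
exists (\sum_i L (b i) *: 'X_(if s then rshift N i else lshift N i)) => p.
rewrite flin_sum /peval raddf_sum /=; apply: eq_bigr => i _.
by rewrite mevalZ mevalXU flinZ mulrC; case: s; rewrite mxE.
Qed.

End Functionals.

Lemma sum_ord_bool (V : nmodType) (u : bool) (k : 'I_u) (f : 'I_u -> V) :
  \sum_(j < u) f j = f k.
Proof.
case: u k f => k f; last by case: k.
by rewrite big_ord1 (ord1 k).
Qed.

Section Lower.
Variables (K : closedFieldType) (u : bool) (I : napoly K nat -> Prop).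
Variables (F : nalgType u K) (x y : F).
Hypothesis freeF : free_on I (pair_gen x y).
Notation v := (pair_gen x y).
Notation sp := (mspan v).
Notation tot := (fun _ : bool => 1%N).
Notation sw := (wt tot).
Notation subst := (fsubst freeF).
Notation wcomp := (component freeF).
Notation ap := (unary freeF).
Notation aut := (autpair freeF).
Implicit Types (f g r : F).
Hypothesis x_neq0 : x != 0.
Variable c : nat -> nat.
Hypothesis c_dim : forall n, (0 < n)%N ->
  has_dim (homogeneous (fun _ : unit => x) n) (c n).
Hypotheses (c1 : c 1%N = 1%N) (c2 : c 2%N = 1%N).
Hypothesis c_mono : forall n, (1 < n)%N -> (c n <= c n.+1)%N.

Lemma wcomp_x w d : wcomp w d x = if w false == d then x else 0.
Proof. exact: (wcomp_v freeF w d false). Qed.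
Lemma wcomp_y w d : wcomp w d y = if w true == d then y else 0.
Proof. exact: (wcomp_v freeF w d true). Qed.
Lemma wcomp_nunit w d : wcomp w d nunit = if 0%N == d then nunit else 0.
Proof. exact: (wcomp_mono freeF w d None). Qed.

Lemma xy_free a b : a *: x + b *: y = 0 -> a = 0 /\ b = 0.
Proof.
move=> h; have hc i : wcomp (delta i) 1 (a *: x + b *: y) = 0 by rewrite h wcomp0.
have := hc false; have := hc true.
rewrite !wcompD !wcompZ !wcomp_x !wcomp_y /delta /= !scaler0 add0r addr0.
have y0 := v_neq0 freeF x_neq0 true.
by move=> /eqP; rewrite scaler_eq0 (negPf y0) orbF => /eqP -> /eqP;
  rewrite scaler_eq0 (negPf x_neq0) orbF => /eqP ->.
Qed.

Lemma linear_coord : exists Lx Ly : F -> K, [/\ flin Lx, flin Ly &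
  forall f, wcomp tot 1 f = Lx f *: x + Ly f *: y].
Proof.
have h f : exists ab : K * K, wcomp tot 1 f = ab.1 *: x + ab.2 *: y.
  by have [a [b e]] := sp_linear (wcomp_sp freeF tot 1 f); exists (a, b).
have [L LE] := choice h.
have key k f g : (L (k *: f + g)).1 - (k * (L f).1 + (L g).1) = 0 /\
   (L (k *: f + g)).2 - (k * (L f).2 + (L g).2) = 0.
  apply: xy_free; rewrite !scalerBl !scalerDl -!scalerA addrACA -LE.
  rewrite wcompD wcompZ !LE !scalerDr -opprD; apply/eqP; rewrite subr_eq0; apply/eqP.
  by rewrite addrACA.
exists (fun f => (L f).1), (fun f => (L f).2); split=> // k f g.
  by apply/eqP; rewrite -subr_eq0; have [-> _] := key k f g.
by apply/eqP; rewrite -subr_eq0; have [_ ->] := key k f g.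
Qed.

Lemma nunit_neq0 : u -> (nunit : F) != 0.
Proof.
move=> hu; apply: contraNneq x_neq0 => z.
have [h _] := nunit_mul x; rewrite z nmul0l in h.
by apply/eqP; rewrite -[x]scale1r h; congr (_ *: _); rewrite hu.
Qed.

Lemma const_coord : exists L0 : F -> K, flin L0 /\
  (u -> forall f, wcomp tot 0 f = L0 f *: nunit).
Proof.
have [hu|/negP hu] := orP (orbN u); last first.
  by exists (fun=> 0); split=> // k f g; rewrite mulr0 addr0.
have h f : exists a : K, wcomp tot 0 f = a *: nunit.
  exact: sp_const (wcomp_sp freeF tot 0 f).
have [L LE] := choice h; exists L; split=> // k f g.
apply/eqP; rewrite -subr_eq0.
have e : (L (k *: f + g) - (k * L f + L g)) *: (nunit : F) = 0.
  by rewrite scalerBl scalerDl -scalerA -!LE wcompD wcompZ subrr.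
by move/eqP: e; rewrite scaler_eq0 (negPf (nunit_neq0 hu)) orbF.
Qed.

Notation rho := (subst (pair_gen x 0)).

Lemma wcomp_rho d r : wcomp tot d (rho r) = rho (wcomp tot d r).
Proof.
apply: wcomp_subst => -[]; first exact: mspan0.
exact: (@mspan_mono _ _ _ _ v _ (Some (Letter false))).
Qed.

Lemma rho_x : rho x = x. Proof. exact: (subst_v freeF _ false). Qed.
Lemma rho_y : rho y = 0. Proof. exact: (subst_v freeF _ true). Qed.
Lemma ap_id g : ap g x = g. Proof. exact: (subst_v freeF _ false). Qed.

Lemma ap_x_rho r : ap x (rho r) = rho r.
Proof.
rewrite /unary subst_subst; congr (fsubst _ _ _); apply/funext => -[] /=.
  exact: subst0.
exact: ap_id.
Qed.

Lemma rho_ap_x r : rho (ap x r) = ap x r.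
Proof. by rewrite (subst_apE) rho_x. Qed.

Lemma rho_rho r : rho (rho r) = rho r.
Proof. by rewrite -(ap_x_rho r) rho_ap_x. Qed.

Lemma lead_coord n : (1 < n)%N -> exists (C : F -> K) (w : F), [/\ flin C, upoly freeF n w,
  C w = 1, forall f, C (rho f) = C f & forall f, wcomp tot n f = 0 -> C f = 0].
Proof.
move=> n1; have n0 : (0 < n)%N by apply: ltnW.
have [b hb] := c_dim n0.
have pi_lin : linear (fun f => wcomp tot n (rho f)).
  by move=> k f g; rewrite substD substZ wcompD wcompZ.
have pi_mem f : homogeneous (fun _ : unit => x) n (wcomp tot n (rho f)).
  apply/(unary_homogeneousP freeF); rewrite wcomp_wcomp eqxx; split=> //.
  by rewrite -wcomp_ap_x ap_x_rho.
have [L [Llin LE]] := basis_coord hb pi_lin pi_mem.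
pose i0 := Ordinal (c_gt0 c1 c2 c_mono n0).
have Lb : L (b i0) i0 = 1.
  have /(unary_homogeneousP freeF)[bx bn] := is_basis_mem i0 hb.
  have /hb.1 e : \sum_i (L (b i0) i - (i == i0)%:R) *: b i = 0.
    under eq_bigr do rewrite scalerBl.
    rewrite sumrB -LE -{1}bx rho_ap_x bx bn (bigD1 i0 isT) eqxx scale1r /=.
    rewrite big1 ?addr0 ?subrr // => i /negPf ->; by rewrite scale0r.
  by apply/eqP; rewrite -subr_eq0; have := e i0; rewrite eqxx => ->.
have Lext f g : wcomp tot n (rho f) = wcomp tot n (rho g) -> L f i0 = L g i0.
  move=> e; apply/eqP; rewrite -subr_eq0; apply/eqP; move: (i0); apply: hb.1.
  under eq_bigr do rewrite scalerBl.
  by rewrite sumrB -!LE e subrr.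
have Llin0 : flin (fun f => L f i0) by [].
exists (fun f => L f i0), (b i0); split=> //.
- have /(unary_homogeneousP freeF)[bx bn] := is_basis_mem i0 hb.
  split=> //; rewrite -bn; apply: mspanS (wcomp_sp freeF tot n (b i0)) => z /eqP ->.
  by rewrite n1 leqnn.
- by move=> f; apply: Lext; rewrite rho_rho.
- move=> f f0; rewrite -(flin0 Llin0); apply: Lext.
  by rewrite wcomp_rho f0 !subst0 wcomp0.
Qed.

Lemma upoly_coord n M (W : 'I_M -> F) : is_basis (upoly freeF n) W ->
  exists L : F -> 'I_M -> K, [/\ forall i, flin (fun f => L f i),
    forall f, sp (fun z => sw z <= 1)%N f -> forall i, L f i = 0,
    forall f i, L (rho f) i = L f i &
    forall i j, L (W j) i = (i == j)%:R].
Proof.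
move=> hW; pose pi f := \sum_(d < n.+1 | (1 < d)%N) wcomp tot d (rho f).
have pi_lin : linear pi.
  move=> k f g; rewrite /pi scaler_sumr -big_split /=; apply: eq_bigr => d _.
  by rewrite substD substZ wcompD wcompZ.
have pi_mem f : upoly freeF n (pi f).
  split.
    rewrite /pi /unary (hom_sum_cond (subst_hom freeF _)); apply: eq_bigr => d _.
    by rewrite -/(unary _ _ _) -wcomp_ap_x ap_x_rho.
  apply: (big_ind (sp (fun z => 1 < sw z <= n)%N)) => [|f1 f2|d d1].
  - exact: mspan0.
  - exact: mspanD.
  - by apply: mspanS (wcomp_sp freeF tot d _) => z /eqP ->; rewrite d1 -ltnS /=.
have [L [Llin LE]] := basis_coord hW pi_lin pi_mem.
have pi_inj f g : pi f = pi g -> forall i, L f i = L g i.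
  move=> e i; apply/eqP; rewrite -subr_eq0; apply/eqP; move: i; apply: hW.1.
  under eq_bigr do rewrite scalerBl.
  by rewrite sumrB -!LE e subrr.
have Ll i : flin (fun f => L f i) by move=> k f g; exact: Llin.
exists L; split=> //.
- move=> f f1 i; rewrite -(flin0 (Ll i)); apply: pi_inj.
  rewrite /pi !big1 // => d d1; first by rewrite subst0 wcomp0.
  by rewrite wcomp_rho ((sp_leP freeF _ _ _).1 f1) ?subst0.
- by move=> f; apply: pi_inj; rewrite /pi rho_rho.
move=> i j; have [Wx Wn] := is_basis_mem j hW.
have piW : pi (W j) = W j.
  rewrite /pi -[in LHS]Wx rho_ap_x Wx.
  have [m [WE mz]] := wcomp_sum freeF tot (W j).
  have z d : ~~ (1 < d <= n)%N -> wcomp tot d (W j) = 0.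
    move=> hd; apply: wcomp_eq0 Wn => w hw; by apply: contraNneq hd => <-.
  rewrite [RHS]WE.
  transitivity (\sum_(d < (m + n).+1) wcomp tot d (W j)).
    rewrite (big_ord_widen_cond (m + n).+1 (fun d => 1 < d)%N (fun d => wcomp tot d (W j))) ?ltnS ?leq_addl //.
    rewrite big_mkcond; apply: eq_bigr => d _; case: ifP => // /negbT hd.
    by rewrite z // -ltnS.
  rewrite [RHS](big_ord_widen_cond (m + n).+1 predT (fun d => wcomp tot d (W j))) ?leqW ?leq_addr //.
  rewrite [RHS]big_mkcond; apply: eq_bigr => d _ /=; case: ltnP => // md.
  exact: mz.
apply/eqP; rewrite -subr_eq0; apply/eqP; move: i; apply: hW.1.
under eq_bigr do rewrite scalerBl.
rewrite sumrB -LE piW (bigD1 j) //= eqxx scale1r big1 ?addr0 ?subrr // => i /negPf ->.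
by rewrite scale0r.
Qed.

End Lower.

(** * The lower bound *)

Section LowerBound.
Variables (K : closedFieldType) (u : bool) (I : napoly K nat -> Prop).
Variables (F : nalgType u K) (x y : F).
Hypothesis freeF : free_on I (pair_gen x y).
Notation v := (pair_gen x y).
Notation sp := (mspan v).
Notation tot := (fun _ : bool => 1%N).
Notation sw := (wt tot).
Notation subst := (fsubst freeF).
Notation wcomp := (component freeF).
Notation ap := (unary freeF).
Notation aut := (autpair freeF).
Notation rho := (subst (pair_gen x 0)).
Implicit Types (f g r : F).
Hypothesis x_neq0 : x != 0.

Lemma aut_scale f g k : aut f g -> k != 0 -> aut (k *: f) g.
Proof.
move=> h k0.
have hs k1 k2 : k2 * k1 = 1 -> cancel (subst (pair_gen (k1 *: x) y)) (subst (pair_gen (k2 *: x) y)).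
  move=> kk r; rewrite subst_pair substZ subst_x subst_y scalerA mulrC kk scale1r.
  exact: subst_id.
have hk : aut (k *: x) y.
  by exists (subst (pair_gen (k^-1 *: x) y)); apply: hs; rewrite ?mulVf ?mulfV.
by have := aut_comp h hk; rewrite substZ subst_x subst_y.
Qed.

Lemma apD g r s : ap g (r + s) = ap g r + ap g s.
Proof. exact: substD. Qed.
Lemma apZ g k r : ap g (k *: r) = k *: ap g r.
Proof. exact: substZ. Qed.
Lemma ap1 g : ap g nunit = nunit.
Proof. exact: subst1. Qed.

Lemma aut_param a b c d e1 e2 al w : a != 0 -> d - c * b != 0 ->
  let l := x + b *: y in
  let g := c *: x + d *: y + e2 *: nunit + ap l w in
  aut (a *: l + e1 *: nunit + al *: g) g.
Proof.
move=> a0 d0 l g.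
have h0 : aut x y by exists id => r; rewrite subst_id.
have h1 : aut l y.
  have := aut_elem (b *: x) h0; by rewrite apZ ap_id.
have h2 : aut g l.
  have := aut_elem (c *: x + e2 *: nunit + w) (aut_scale (aut_swap h1) d0).
  congr (autpair _ _ _).
  rewrite !apD !apZ ap_id ap1 /g !addrA; congr (_ + _ + _).
  rewrite /l scalerDr scalerA addrCA -scalerDl; congr (_ + _ *: _).
  by rewrite subrK.
have := aut_elem (e1 *: nunit + al *: x) (aut_scale (aut_swap h2) a0).
congr (autpair _ _ _).
by rewrite apD !apZ ap_id ap1 addrA.
Qed.

Variable c : nat -> nat.
Hypothesis c_dim : forall n, (0 < n)%N ->
  has_dim (homogeneous (fun _ : unit => x) n) (c n).
Hypotheses (c1 : c 1%N = 1%N) (c2 : c 2%N = 1%N).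
Hypothesis c_mono : forall n, (1 < n)%N -> (c n <= c n.+1)%N.

Section Degree.
Variables (n N : nat) (b : 'I_N -> F).
Hypotheses (n0 : (0 < n)%N) (hb : is_basis (deg_le v n) b).
(* For [n = 1] there is no [alpha] and no [w], so the leading coefficient [C]
   of [g], which serves as a denominator below, is replaced with [1]. *)
Let z : bool := n != 1%N.
Variables (C : F -> K) (w0 : F).
Hypotheses (C_lin : flin C) (w0_mem : upoly freeF n w0).
Hypotheses (C_rho : forall f, C (rho f) = C f).
Hypotheses (C_top : forall f, wcomp tot n f = 0 -> C f = 0).
Hypotheses (C_w0 : z -> C w0 = 1).
Variables (M : nat) (W : 'I_M -> F).
Hypothesis hW : is_basis (upoly freeF n) W.
Variables (Lx Ly L0 : F -> K) (LW : F -> 'I_M -> K).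
Hypotheses (Lx_lin : flin Lx) (Ly_lin : flin Ly) (L0_lin : flin L0).
Hypothesis LxyE : forall f, wcomp tot 1 f = Lx f *: x + Ly f *: y.
Hypothesis L0E : u -> forall f, wcomp tot 0 f = L0 f *: nunit.
Hypotheses (LW_lin : forall i, flin (fun f => LW f i)).
Hypothesis LW_small : forall f, sp (fun m => sw m <= 1)%N f -> forall i, LW f i = 0.
Hypothesis LW_rho : forall f i, LW (rho f) i = LW f i.
Hypothesis LW_W : forall i j, LW (W j) i = (i == j)%:R.
Variable co : F -> 'I_N -> K.
Hypothesis co_lin : forall i, flin (fun f => co f i).
Hypothesis coE : forall f, deg_le v n f -> f = \sum_i co f i *: b i.

Let T : finType := ((bool * bool + bool * 'I_u) + ('I_z + 'I_M))%type.
Implicit Types t : T -> K.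

Let ta t := t (inl (inl (false, false))).
Let tb t := t (inl (inl (false, true))).
Let tc t := t (inl (inl (true, false))).
Let td t := t (inl (inl (true, true))).
Let te i t := \sum_(k < u) t (inl (inr (i, k))).
Let tal t := \sum_(k < z) t (inr (inl k)).
Let tw j t := t (inr (inr j)).

Let l t := x + tb t *: y.
Let U t := w0 + \sum_j tw j t *: W j.
Let g t := tc t *: x + (1 + td t) *: y + te true t *: nunit + ap (l t) (U t).
Let f t := (1 + ta t) *: l t + te false t *: nunit + tal t *: g t.

Lemma param_pol : [/\ pol ta, pol tb, pol tc, pol td & pol tal] /\
  (forall i, pol (te i)) /\ forall j, pol (tw j).
Proof.
by do ![split] => *; rewrite /ta /tb /tc /td /tal /te /tw;
  do ?[exact: pol_var|apply: pol_sum => k].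
Qed.

Lemma pfun_l : pfun l.
Proof.
apply: pfun_add; first exact: pfun_cst.
by apply: pfun_scale; exact: pol_var.
Qed.

Lemma pfun_g : pfun g.
Proof.
have [[pa pb pc pd pal] [pe pw]] := param_pol.
apply: pfun_add; [apply: pfun_add; [apply: pfun_add|]|].
- exact: pfun_scale.
- by apply: pfun_scale; apply: pol_add => //; apply: pol_cst.
- exact: pfun_scale.
apply: (@pfun_ext _ _ _ _ (fun t => ap (l t) w0 + \sum_j tw j t *: ap (l t) (W j))).
  move=> t; rewrite /U /unary substD (hom_sum (subst_hom freeF _)).
  by congr (_ + _); apply: eq_bigr => j _; rewrite substZ.
apply: pfun_add; first exact: pfun_ap pfun_l.
by apply: pfun_sum => j; apply: pfun_scalep => //; apply: pfun_ap pfun_l.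
Qed.

Lemma pfun_f : pfun f.
Proof.
have [[pa pb pc pd pal] [pe pw]] := param_pol.
apply: pfun_add; first apply: pfun_add.
- apply: pfun_scalep pfun_l; apply: pol_add => //; exact: pol_cst.
- exact: pfun_scale.
- exact: pfun_scalep pfun_g.
Qed.

Lemma U_mem t : upoly freeF n (U t).
Proof.
have [w1 w2] := w0_mem; split.
  rewrite /U /unary substD (hom_sum (subst_hom freeF _)) -!/(unary _ _ _) w1; congr (_ + _).
  apply: eq_bigr => j _; rewrite substZ -!/(unary _ _ _).
  by have [-> _] := is_basis_mem j hW.
apply: mspanD => //; apply: mspan_sum => j; apply: mspanZ.
by have [] := is_basis_mem j hW.
Qed.

Lemma wcomp_ap_l t d r : wcomp tot d (ap (l t) r) = ap (l t) (wcomp tot d r).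
Proof.
apply: wcomp_subst => _; apply: mspanD.
  exact: (@mspan_mono _ _ _ _ v _ (Some (Letter false))).
by apply: mspanZ; exact: (@mspan_mono _ _ _ _ v _ (Some (Letter true))).
Qed.

Lemma wcomp_apU t d : ~~ (1 < d <= n)%N -> wcomp tot d (ap (l t) (U t)) = 0.
Proof.
move=> hd; rewrite wcomp_ap_l (wcomp_eq0 freeF _ (U_mem t).2) /unary ?subst0 //.
by move=> m hm; apply: contraNneq hd => <-.
Qed.

Lemma rho_l t : rho (l t) = x.
Proof. by rewrite /l substD substZ rho_x rho_y scaler0 addr0. Qed.

Lemma rho_g t : rho (g t) = tc t *: x + te true t *: nunit + U t.
Proof.
rewrite /g !substD !substZ rho_x rho_y scaler0 addr0 subst1 subst_apE rho_l.
by rewrite (U_mem t).1.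
Qed.

Lemma Lxy_val h a a' : wcomp tot 1 h = a *: x + a' *: y -> Lx h = a /\ Ly h = a'.
Proof.
rewrite LxyE => e; have [|e1 e2] := @xy_free _ _ _ _ _ _ freeF x_neq0 (Lx h - a) (Ly h - a').
  by rewrite !scalerBl addrACA -opprD e subrr.
by split; apply/eqP; rewrite -subr_eq0 ?e1 ?e2.
Qed.

Lemma Lxy_g t : Lx (g t) = tc t /\ Ly (g t) = 1 + td t.
Proof.
apply: Lxy_val; rewrite /g !wcompD wcomp_apU // addr0 !wcompZ wcomp_x wcomp_y wcomp_nunit.
by rewrite /= scaler0 addr0.
Qed.

Lemma Lxy_l t : Lx (l t) = 1 /\ Ly (l t) = tb t.
Proof.
by apply: Lxy_val; rewrite wcompD wcompZ wcomp_x wcomp_y /= scale1r.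
Qed.

Lemma Lxy_nunit : Lx nunit = 0 /\ Ly nunit = 0.
Proof. by apply: Lxy_val; rewrite wcomp_nunit !scale0r addr0. Qed.

Lemma L0_val h a : u -> wcomp tot 0 h = a *: nunit -> L0 h = a.
Proof.
move=> hu; rewrite L0E // => e; apply/eqP; rewrite -subr_eq0.
have : (L0 h - a) *: (nunit : F) == 0 by rewrite scalerBl e subrr.
by rewrite scaler_eq0 (negPf (nunit_neq0 x_neq0 hu)) orbF.
Qed.

Lemma L0_g t : u -> L0 (g t) = te true t.
Proof.
move=> hu; apply: L0_val => //; rewrite /g !wcompD wcomp_apU // addr0 !wcompZ.
by rewrite wcomp_x wcomp_y wcomp_nunit /= !scaler0 !add0r.
Qed.

Lemma L0_l t : u -> L0 (l t) = 0.
Proof.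
move=> hu; apply: L0_val => //; rewrite wcompD wcompZ wcomp_x wcomp_y /=.
by rewrite scaler0 scale0r addr0.
Qed.

Lemma L0_nunit : u -> L0 nunit = 1.
Proof. by move=> hu; apply: L0_val => //; rewrite wcomp_nunit scale1r. Qed.

Lemma LW_g t i : LW (g t) i = LW w0 i + tw i t.
Proof.
have [L LE] : exists L, forall h, LW h i = L h by exists (LW^~ i).
have hL : flin L by move=> k h h'; rewrite -!LE; exact: LW_lin.
rewrite -LW_rho rho_g !LE !(flinD hL) !(flinZ hL) (flin_sum hL).
rewrite -[L x]LE LW_small; last exact: (@mspan_mono _ _ _ _ v _ (Some (Letter false))).
rewrite -[L nunit]LE LW_small; last exact: (@mspan_mono _ _ _ _ v _ None).
rewrite !mulr0 !add0r (bigD1 i) //= big1 => [|j ji]; rewrite (flinZ hL) -[L (W _)]LE LW_W.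
  by rewrite eqxx mulr1 addr0.
by rewrite eq_sym (negPf ji) mulr0.
Qed.

Lemma n_gt1 : z -> (1 < n)%N.
Proof. by rewrite /z; case: n n0 => [|[|]]. Qed.

Let CG h := if z then C h else 1.
Let CF h := if z then C h else 0.

Lemma CF_f t : CF (f t) = tal t * CG (g t).
Proof.
rewrite /CF /CG; case hz : z; last first.
  rewrite /tal big1 ?mul0r // => k; have := ltn_ord k.
  by rewrite [X in (_ < X)%N](_ : _ = 0%N) // hz.
have n1 := n_gt1 hz.
have C1 : C nunit = 0.
  by apply: C_top; rewrite wcomp_nunit; case: (n) n1.
have Cl : C (l t) = 0.
  apply: C_top; rewrite wcompD wcompZ wcomp_x wcomp_y /=.
  by case: (n) n1 => [|[|m]] //; rewrite scaler0 addr0.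
by rewrite /f (flinD C_lin) (flinD C_lin) !(flinZ C_lin) C1 Cl !mulr0 !add0r.
Qed.

Lemma CG_g t : CG (g t) = 1 + \sum_j tw j t * CF (W j).
Proof.
rewrite /CF /CG; case hz : z; last first.
  by rewrite big1 ?addr0 // => j _; rewrite mulr0.
have n1 := n_gt1 hz.
have C1 : C nunit = 0.
  by apply: C_top; rewrite wcomp_nunit; case: (n) n1.
have Cx : C x = 0.
  by apply: C_top; rewrite wcomp_x; case: (n) n1 => [|[|m]].
rewrite -C_rho rho_g !(flinD C_lin) !(flinZ C_lin) C1 Cx !mulr0 !add0r.
rewrite (flin_sum C_lin) C_w0 //; congr (_ + _); apply: eq_bigr => j _.
exact: flinZ.
Qed.

Lemma pol_CG : pol (fun t => CG (g t)).
Proof.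
rewrite /CG; case: z; last exact: pol_cst.
exact: pfun_functional C_lin pfun_g.
Qed.

Lemma deg_g t : sp (fun m => sw m <= n)%N (g t).
Proof.
apply/(sp_leP freeF) => d nd; rewrite !wcompD wcomp_apU; last by rewrite (leqNgt d) nd andbF.
rewrite !wcompZ wcomp_x wcomp_y wcomp_nunit /=.
have -> : (0%N == d) = false by apply/ltn_eqF/(leq_ltn_trans (leq0n n)).
have -> : (1%N == d) = false by apply/ltn_eqF/(leq_ltn_trans n0).
by rewrite !scaler0 !addr0.
Qed.

Lemma deg_f t : sp (fun m => sw m <= n)%N (f t).
Proof.
apply: mspanD; last exact/mspanZ/deg_g.
apply/(sp_leP freeF) => d nd.
rewrite !wcompD !wcompZ wcompD wcompZ wcomp_x wcomp_y wcomp_nunit /=.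
have -> : (0%N == d) = false by apply/ltn_eqF/(leq_ltn_trans (leq0n n)).
have -> : (1%N == d) = false by apply/ltn_eqF/(leq_ltn_trans n0).
by rewrite !scaler0 !addr0 scaler0.
Qed.

Let phi t : 'rV[K]_(N + N) := row_mx (\row_i co (f t) i) (\row_i co (g t) i).

Lemma phi_f t : \sum_i lsubmx (phi t) 0 i *: b i = f t.
Proof.
rewrite [RHS]coE; last by apply/deg_leP; apply: deg_f.
by apply: eq_bigr => i _; rewrite row_mxKl mxE.
Qed.

Lemma phi_g t : \sum_i rsubmx (phi t) 0 i *: b i = g t.
Proof.
rewrite [RHS]coE; last by apply/deg_leP; apply: deg_g.
by apply: eq_bigr => i _; rewrite row_mxKr mxE.
Qed.

Let pq (h : (T -> K) -> K) := exists q : {mpoly K[N + N]}, forall t, peval q (phi t) = h t.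

Lemma pq_f L : flin L -> pq (fun t => L (f t)).
Proof.
by move=> hL; have [q qE] := flin_points hL b false; exists q => t; rewrite qE phi_f.
Qed.

Lemma pq_g L : flin L -> pq (fun t => L (g t)).
Proof.
by move=> hL; have [q qE] := flin_points hL b true; exists q => t; rewrite qE phi_g.
Qed.

Lemma pq_cst k : pq (fun=> k).
Proof. by exists k%:MP => t; rewrite /peval mevalC. Qed.

Lemma pq_sub h1 h2 : pq h1 -> pq h2 -> pq (fun t => h1 t - h2 t).
Proof.
by case=> q1 e1 [q2 e2]; exists (q1 - q2) => t; rewrite /peval mevalB -e1 -e2.
Qed.

Lemma pq_mul h1 h2 : pq h1 -> pq h2 -> pq (fun t => h1 t * h2 t).
Proof.
by case=> q1 e1 [q2 e2]; exists (q1 * q2) => t; rewrite /peval mevalM -e1 -e2.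
Qed.

Lemma pq_ext h1 h2 : h1 =1 h2 -> pq h1 -> pq h2.
Proof. by move=> e [q hq]; exists q => t; rewrite -e. Qed.

Lemma pq_CG : pq (fun t => CG (g t)).
Proof. by rewrite /CG; case: z; [exact: pq_g|exact: pq_cst]. Qed.

Lemma pq_CF : pq (fun t => CF (f t)).
Proof. by rewrite /CF; case: z; [exact: pq_f|exact: pq_cst]. Qed.

Let Q (i : T) t : K :=
  match i with
  | inl (inl (false, true)) => (1 + ta t) * CG (g t)
  | inl (inl (true, _)) | inl (inr (true, _)) | inr (inr _) => 1
  | _ => CG (g t)
  end.

Lemma elim_l L t (hL : flin L) :
  L (f t) * CG (g t) - CF (f t) * L (g t) =
  ((1 + ta t) * L (l t) + te false t * L nunit) * CG (g t).
Proof.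
rewrite CF_f {1}/f (flinD hL) (flinD hL) !(flinZ hL) [RHS]mulrDl mulrDl.
by rewrite [X in _ + X - _]mulrAC addrK mulrDl.
Qed.

Lemma separating i : pq (fun t => t i * Q i t).
Proof.
have pl L : flin L -> pq (fun t => ((1 + ta t) * L (l t) + te false t * L nunit) * CG (g t)).
  move=> hL; apply: pq_ext (pq_sub (pq_mul (pq_f hL) pq_CG) (pq_mul pq_CF (pq_g hL))) => t.
  exact: elim_l.
case: i => [[[[] []]|[[] k]]|[k|j]] /=.
- apply: pq_ext (pq_sub (pq_g Ly_lin) (pq_cst 1)) => t.
  by rewrite (Lxy_g t).2 addrC addKr mulr1.
- by apply: pq_ext (pq_g Lx_lin) => t; rewrite (Lxy_g t).1 mulr1.
- apply: pq_ext (pl _ Ly_lin) => t; rewrite (Lxy_l t).2 Lxy_nunit.2.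
  by rewrite mulr0 addr0 mulrAC [RHS]mulrC.
- apply: pq_ext (pq_sub (pl _ Lx_lin) pq_CG) => t.
  by rewrite (Lxy_l t).1 Lxy_nunit.1 mulr0 addr0 mulr1 mulrDl mul1r addrC addKr.
- have hu : u by case: (u) k => // -[].
  apply: pq_ext (pq_g L0_lin) => t; by rewrite L0_g // mulr1 /te (sum_ord_bool k).
- have hu : u by case: (u) k => // -[].
  apply: pq_ext (pl _ L0_lin) => t; by rewrite L0_l // L0_nunit // mulr0 add0r mulr1 /te (sum_ord_bool k).
- by apply: pq_ext pq_CF => t; rewrite CF_f /tal (sum_ord_bool k).
- apply: pq_ext (pq_sub (pq_g (LW_lin j)) (pq_cst (LW w0 j))) => t.
  by rewrite LW_g addrC addKr mulr1.
Qed.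

Let D t := (1 + ta t) * (1 + td t - tc t * tb t) * CG (g t).

Lemma param_autdeg t : D t != 0 -> aut_points x y n b (phi t).
Proof.
rewrite !mulf_eq0 !negb_or => /andP[/andP[a0 d0] cg0].
have haut : aut (f t) (g t) by exact: aut_param.
rewrite /aut_points phi_f phi_g; split; first by apply/(autP freeF).
have gn0 : wcomp tot n (g t) != 0.
  move: cg0; rewrite /CG; case hz: z.
    by apply: contra_neq => /C_top.
  move=> _; apply/negP => /eqP h; apply: (aut_not_const x_neq0 (aut_swap haut)).
  apply/(sp_leP freeF) => d; have n1 : n = 1%N by apply/eqP; exact: (negbFE hz).
  rewrite leq_eqVlt -{1}n1 => /orP[/eqP<-//|d1].
  by apply: ((sp_leP freeF _ _ _).1 (deg_g t)); rewrite n1.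
have f0 : f t != 0.
  apply/negP => /eqP h; apply: (aut_not_const x_neq0 haut); rewrite h; exact: mspan0.
have [k [fk fk']] := wcomp_top freeF tot f0.
exists k, n; split; [exact: (has_deg_intro fk' fk)|exact: (has_deg_intro (deg_g t) gn0)|].
apply/esym/maxn_idPr; rewrite leqNgt; apply/negP => nk; case/eqP: fk.
exact: (sp_leP freeF _ _ _).1 (deg_f t) _ nk.
Qed.

Lemma card_T : #|T| = (4 + 2 * u + z + M)%N.
Proof. by rewrite !card_sum !card_prod card_bool !card_ord addnA. Qed.

Lemma lower_core : zchain (aut_points x y n b) (4 + 2 * u + z + M).
Proof.
have [P hP] := choice separating.
rewrite -card_T; apply: (@flag_zchain _ _ _ _ phi D P Q).
- move=> i; case: (splitP i) => j e.
    rewrite (_ : i = lshift N j); last exact: val_inj.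
    apply: pol_ext (pfun_functional (co_lin j) pfun_f) => t.
    by rewrite /phi row_mxEl mxE.
  rewrite (_ : i = rshift N j); last exact: val_inj.
  apply: pol_ext (pfun_functional (co_lin j) pfun_g) => t.
  by rewrite /phi row_mxEr mxE.
- have [[pa pb pc pd pal] [pe pw]] := param_pol.
  apply: pol_mul pol_CG; apply: pol_mul; first exact: pol_add (pol_cst _ _) pa.
  by apply: pol_sub; [exact: pol_add (pol_cst _ _) pd|exact: pol_mul].
- rewrite /D /ta /td /tc CG_g big1 ?addr0 ?mul0r ?subr0 ?mulr1 ?oner_neq0 // => j _.
  by rewrite /tw mul0r.
- exact: param_autdeg.
- by move=> i t; rewrite hP.
- have [[pa pb pc pd pal] [pe pw]] := param_pol.
  case=> [[[[] []]|[[] k]]|[k|j]] /=; do ?[exact: pol_cst|exact: pol_CG].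
  by apply: pol_mul pol_CG; exact: pol_add (pol_cst _ _) pa.
have CG0 : CG (g (fun=> 0)) = 1.
  by rewrite CG_g big1 ?addr0 // => j _; rewrite /tw mul0r.
by case=> [[[[] []]|[[] k]]|[k|j]] /=; rewrite ?CG0 /ta ?addr0 ?mulr1 oner_neq0.
Qed.

End Degree.

Lemma lower_bound n N (b : 'I_N -> F) : (0 < n)%N -> homog_basis x y n b ->
  zchain (aut_points x y n b) (dimH u c n).
Proof.
move=> n0 [hb _].
have [C [w0 [C_lin w0_mem C_rho C_top C_w0]]] : exists (C : F -> K) (w0 : F),
  [/\ flin C, upoly freeF n w0, forall f, C (rho f) = C f,
      forall f, wcomp tot n f = 0 -> C f = 0 & n != 1%N -> C w0 = 1].
  have [n1|n1] := eqVneq n 1%N.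
    exists (fun=> 0), 0; split=> // [k f g|]; first by rewrite mulr0 addr0.
    by split; [exact: subst0|exact: mspan0].
  have [|C [w [h1 h2 h3 h4 h5]]] := lead_coord freeF c_dim c1 c2 c_mono (n := n).
    by case: (n) n0 n1 => [|[|]].
  by exists C, w.
have [W hW] := upoly_dim freeF c_dim n.
have [Lx [Ly [Lx_lin Ly_lin LxyE]]] := linear_coord freeF x_neq0.
have [L0 [L0_lin L0E]] := const_coord freeF x_neq0.
have [LW [LW_lin LW_small LW_rho LW_W]] := upoly_coord hW.
have [co [co_lin coE _]] := deg_coord freeF hb.
have := lower_core n0 C_lin w0_mem C_rho C_top C_w0 hW Lx_lin Ly_lin L0_lin LxyE L0E
  LW_lin LW_small LW_rho LW_W (co := co) (fun i k f g => co_lin k f g i) coE.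
congr (zchain _ _); rewrite /dimH csumS //.
by case: eqVneq => [->|_] /=; lia.
Qed.

End LowerBound.

(** * A model of the absolutely free algebra *)

(** Formal infinite combinations of words: finite support plays no role here,
    since this model only serves to separate the words of the free algebra. *)
Definition wseries (u : bool) (K : nzRingType) : Type := mono bool -> K^o.
HB.instance Definition _ u K := GRing.Lmodule.copy (wseries u K) (mono bool -> K^o).

Section Series.
Variables (u : bool) (K : comNzRingType).
Local Notation A := (wseries u K).
Implicit Types a b c : A.

Definition wseries_mul a b : A := fun m =>
  match m with
  | None => u%:R * (a None * b None)
  | Some z => u%:R * (a None * b (Some z) + a (Some z) * b None) +
      match z with Join z1 z2 => a (Some z1) * b (Some z2) | Letter _ => 0 end
  end.

Definition wseries_unit : A := fun m => if m is None then u%:R else 0.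

Fact wseries_mulDl a b c : wseries_mul (a + b) c = wseries_mul a c + wseries_mul b c.
Proof.
apply/funext => -[[i|z1 z2]|] /=; rewrite -![(_ + _ : A) _]/(_ _ + _ _) /=; ring.
Qed.
Fact wseries_mulDr a b c : wseries_mul a (b + c) = wseries_mul a b + wseries_mul a c.
Proof.
apply/funext => -[[i|z1 z2]|] /=; rewrite -![(_ + _ : A) _]/(_ _ + _ _) /=; ring.
Qed.
Fact wseries_mulZl (k : K) a b : wseries_mul (k *: a) b = k *: wseries_mul a b.
Proof.
apply/funext => -[[i|z1 z2]|] /=; rewrite -![(_ *: _ : A) _]/(k * _ _) /=; ring.
Qed.
Fact wseries_mulZr (k : K) a b : wseries_mul a (k *: b) = k *: wseries_mul a b.
Proof.
apply/funext => -[[i|z1 z2]|] /=; rewrite -![(_ *: _ : A) _]/(k * _ _) /=; ring.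
Qed.
Fact wseries_unitP :
  if u then (forall a, wseries_mul wseries_unit a = a) /\
            (forall a, wseries_mul a wseries_unit = a)
  else wseries_unit = 0.
Proof.
rewrite /wseries_mul /wseries_unit; case: u; last by apply/funext => -[].
by split=> a; apply/funext => -[[i|z1 z2]|] /=;
  rewrite ?mul1r ?mulr1 ?mul0r ?mulr0 ?addr0 ?add0r.
Qed.

HB.instance Definition _ := Lmodule_isNAlgebra.Build u K A
  wseries_mulDl wseries_mulDr wseries_mulZl wseries_mulZr wseries_unitP.

End Series.

Section AbsolutelyFree.
Variables (K : closedFieldType) (u : bool) (F : nalgType u K) (x y : F).
Hypothesis freeF : free_on (fun _ : napoly K nat => False) (pair_gen x y).
Notation v := (pair_gen x y).
Notation sp := (mspan v).
Notation tot := (fun _ : bool => 1%N).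
Notation sw := (wt tot).
Notation subst := (fsubst freeF).
Notation wcomp := (component freeF).
Implicit Types (f g r : F) (m : mono bool).

Definition letter_series (i : bool) : wseries u K := fun m => (m == Some (Letter i))%:R.

Lemma wcoef_ex : exists h : F -> wseries u K, nalg_hom h /\ forall i, h (v i) = letter_series i.
Proof.
have [_ univ] := freeF.
have [] // := univ (wseries u K : nalgType u K) _ letter_series.
by case=> h hh hE _; exists h.
Qed.

Definition wcoef f m : K := projT1 (cid wcoef_ex) f m.

Lemma wcoefD f g m : wcoef (f + g) m = wcoef f m + wcoef g m.
Proof. by rewrite /wcoef; case: cid => h [hh _] /=; rewrite (homD hh). Qed.
Lemma wcoefZ k f m : wcoef (k *: f) m = k * wcoef f m.
Proof. by rewrite /wcoef; case: cid => h [hh _] /=; rewrite (homZ hh). Qed.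
Lemma wcoef0 m : wcoef 0 m = 0.
Proof. by rewrite -[0](scale0r 0) wcoefZ mul0r. Qed.
Lemma wcoef_sum (J : Type) (s : seq J) (f : J -> F) m :
  wcoef (\sum_(i <- s) f i) m = \sum_(i <- s) wcoef (f i) m.
Proof.
by elim: s => [|i s IH]; rewrite ?big_nil ?wcoef0 // !big_cons wcoefD IH.
Qed.

Lemma wcoefM_join f g z1 z2 : wcoef f None = 0 -> wcoef g None = 0 ->
  wcoef (nmul f g) (Some (Join z1 z2)) = wcoef f (Some z1) * wcoef g (Some z2).
Proof.
rewrite /wcoef; case: cid => h [hh _] /= f0 g0; rewrite (homM hh).
by rewrite /nmul /= f0 g0 mul0r mulr0 addr0 mulr0 add0r.
Qed.

Lemma wcoef_word z m : wcoef (word_eval v z) m = (m == Some z)%:R.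
Proof.
rewrite /wcoef; case: cid => h [hh hE] /=.
rewrite -[word_eval v z]/(mono_eval v (Some z)) (hom_mono _ _ hh) /=.
elim: z m => [i|z1 h1 z2 h2] m /=; first by rewrite hE.
rewrite /nmul /=; case: m => [[i|a b]|] /=; rewrite !h1 !h2 /=.
- by rewrite ?(mul0r, mulr0, addr0).
- rewrite ?(mul0r, mulr0, addr0, add0r) -natrM mulnb; congr ((nat_of_bool _)%:R).
  by apply/andP/eqP => [[/eqP[->] /eqP[->]]|[-> ->]].
- by rewrite ?(mul0r, mulr0).
Qed.

Lemma wcoef_nunit m : wcoef nunit m = if m is None then u%:R else 0.
Proof. by rewrite /wcoef; case: cid => h [hh hE] /=; rewrite (hom1 hh). Qed.

Lemma wcoef_eq0 f : (forall m, wcoef f m = 0) -> f = 0.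
Proof.
move=> h; have [s fE] := free_gen freeF f.
have [p _ pE] := lin_napoly u s; move: fE; rewrite pE => fE.
have wcoefE m : wcoef f m = \sum_(m' <- finsupp p) p m' * wcoef (mono_eval v m') m.
  by rewrite fE wcoef_sum; apply: eq_bigr => m' _; rewrite wcoefZ.
rewrite fE /napoly_eval big_seq big1 // => m mp.
have := wcoefE m; rewrite h (bigD1_seq m) ?fset_uniq //= big1 ?addr0.
  case: m mp => [z|] mp /=.
    by rewrite wcoef_word eqxx mulr1 => <-; rewrite scale0r.
  by rewrite wcoef_nunit => e; rewrite -(nunit_mulrn F) -scaler_nat scalerA -e scale0r.
move=> m' ne; case: m' ne => [z|] ne /=.
  by rewrite wcoef_word eq_sym (negPf ne) mulr0.
by rewrite wcoef_nunit; case: m mp ne => [z|] // _ _; rewrite mulr0.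
Qed.

Lemma wcoef_None f : sp (fun m => 1 <= sw m)%N f -> wcoef f None = 0.
Proof.
move=> h; apply: (sp_ind (T := fun f => wcoef f None = 0) h); first exact: wcoef0.
by move=> k [z|] g //= _ IH; rewrite wcoefD wcoefZ IH wcoef_word mulr0 addr0.
Qed.

Lemma join_span n r : sp (fun m => 2 <= sw m <= n)%N r ->
  exists s : seq (K * (word bool * word bool)),
    all (fun i => (word_wt tot i.2.1 < n) && (word_wt tot i.2.2 < n))%N s /\
    r = \sum_(i <- s) i.1 *: nmul (word_eval v i.2.1) (word_eval v i.2.2).
Proof.
move=> h; apply: (sp_ind (T := fun r => exists s : seq (K * (word bool * word bool)),
    all (fun i => (word_wt tot i.2.1 < n) && (word_wt tot i.2.2 < n))%N s /\
    r = \sum_(i <- s) i.1 *: nmul (word_eval v i.2.1) (word_eval v i.2.2)) h).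
  by exists [::]; rewrite big_nil.
move=> k [[j|z1 z2]|] g //= /andP[_ zn] [s [sn ->]].
exists ((k, (z1, z2)) :: s); rewrite big_cons /=; split=> //.
have := word_wt_gt0 z1; have := word_wt_gt0 z2; rewrite sn andbT; lia.
Qed.

(** A relation [\sum_i k_i (E a_i) (E b_i) = 0] between products is, by unique
    factorization of words, a relation in a tensor product, so it comes from
    relations between the shorter [E a_i] and between the [E b_i]. *)
Lemma free_criterion_absolute : free_criterion freeF.
Proof.
move=> e e0 ker1.
have ge1 r : sp (fun m => 1 <= sw m)%N r -> wcoef (subst e r) None = 0.
  by move=> hr; apply: wcoef_None; apply: subst_ge1.
have hword z : sp (fun m => 1 <= sw m)%N (word_eval v z).
  by apply: (@mspan_mono _ _ _ _ v _ (Some z)); rewrite /= word_wt_gt0.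
suff key n : forall r, sp (fun m => sw m <= n)%N r -> subst e r = 0 -> r = 0.
  move=> r r0; have [n [rE rn]] := wcomp_sum freeF tot r; apply: (key n) r0.
  by apply/(sp_leP freeF) => d nd; apply: rn; apply: ltnW.
elim: n => [|n IH] r rn r0.
  have := kernel_const e0 r0; rewrite (wcomp_fix freeF _ rn) // => m.
  by rewrite leqn0 => /eqP.
have IH' r' : sp (fun m => (1 <= sw m) && (sw m <= n))%N r' ->
    (forall z, wcoef (subst e r') (Some z) = 0) -> r' = 0.
  move=> h1 h2; apply: IH; first by apply: mspanS h1 => m /andP[].
  apply: wcoef_eq0 => -[z|] //; apply: ge1; by apply: mspanS h1 => m /andP[].
have r2 : sp (fun m => 2 <= sw m <= n.+1)%N r.
  have [N [-> _]] := wcomp_sum freeF tot r; apply: mspan_sum => d.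
  have [d1|d1] := ltnP d 2.
    have -> : wcomp tot d r = 0; last exact: mspan0.
    by case: (d : nat) d1 => [|[|]] // _; [apply: kernel_const r0|apply: ker1 r0].
  apply: mspanS (wcomp_span freeF tot d rn) => m /andP[h /eqP e1].
  by rewrite h andbT e1.
have [s [/allP sn rE]] := join_span r2.
have lin_sp (c : K * (word bool * word bool) -> K) (b : K * (word bool * word bool) -> word bool) :
    (forall i, i \in s -> word_wt tot (b i) <= n)%N ->
    sp (fun m => (1 <= sw m) && (sw m <= n))%N (\sum_(i <- s) c i *: word_eval v (b i)).
  move=> hb; rewrite big_seq; apply: (big_ind (sp _)) => [|f g|i si].
  - exact: mspan0.
  - exact: mspanD.
  - apply: mspanZ; apply: (@mspan_mono _ _ _ _ v _ (Some (b i))).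
    by rewrite /= word_wt_gt0 hb.
have subst_sum (c : K * (word bool * word bool) -> K) (b : K * (word bool * word bool) -> word bool) m :
    wcoef (subst e (\sum_(i <- s) c i *: word_eval v (b i))) m =
    \sum_(i <- s) c i * wcoef (subst e (word_eval v (b i))) m.
  rewrite (hom_sum (subst_hom freeF e)) wcoef_sum; apply: eq_bigr => i _.
  by rewrite substZ wcoefZ.
have s1 i : i \in s -> (word_wt tot i.2.1 <= n)%N by case/sn/andP.
have s2 i : i \in s -> (word_wt tot i.2.2 <= n)%N by case/sn/andP.
have q0 z1 : \sum_(i <- s) (i.1 * wcoef (subst e (word_eval v i.2.1)) (Some z1)) *:
    word_eval v i.2.2 = 0.
  apply: IH' => [|z2]; first exact: lin_sp.
  rewrite subst_sum -[RHS](wcoef0 (Some (Join z1 z2))) -r0 rE.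
  rewrite (hom_sum (subst_hom freeF e)) wcoef_sum; apply: eq_bigr => i _.
  by rewrite substZ (homM (subst_hom freeF e)) wcoefZ wcoefM_join ?ge1 // mulrA.
have p0 z2 : \sum_(i <- s) (i.1 * (Some z2 == Some i.2.2)%:R) *: word_eval v i.2.1 = 0.
  apply: IH' => [|z1]; first exact: lin_sp.
  rewrite subst_sum -[RHS](wcoef0 (Some z2)) -(q0 z1) wcoef_sum; apply: eq_bigr => i _.
  by rewrite wcoefZ wcoef_word mulrAC.
apply: wcoef_eq0 => m.
have [[z1 [z2 ->]]|nj] := pselect (exists z1 z2, m = Some (Join z1 z2)).
  rewrite -[RHS](wcoef0 (Some z1)) -(p0 z2) rE !wcoef_sum; apply: eq_bigr => i _.
  by rewrite !wcoefZ wcoefM_join ?wcoef_word // -mulrA [_%:R * _]mulrC.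
rewrite rE wcoef_sum big1 // => i _; rewrite wcoefZ.
rewrite -[nmul _ _]/(word_eval v (Join i.2.1 i.2.2)) wcoef_word.
case: eqP => [e1|_]; last by rewrite mulr0.
by case: nj; exists i.2.1, i.2.2.
Qed.

End AbsolutelyFree.

(* The fuel [k] is irrelevant when [n <= k]. *)
Fixpoint word_list (k n : nat) : seq (word unit) :=
  if k is k'.+1 then
    if n == 1%N then [:: Letter tt]
    else [seq Join ab.1 ab.2 | i <- iota 1 n.-1,
           ab <- [seq (a, b) | a <- word_list k' i, b <- word_list k' (n - i)]]
  else [::].

Lemma mem_word_list k n (z : word unit) : (n <= k)%N ->
  (z \in word_list k n) = (word_wt (fun=> 1%N) z == n).
Proof.
have pos (z' : word unit) : (0 < word_wt (fun=> 1%N) z')%N.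
  by elim: z' => //= z1 h1 z2 h2; rewrite addn_gt0 h1.
elim: k n z => [|k IH] n z nk.
  by rewrite in_nil (_ : n = 0%N) ?eqn0Ngt ?pos //; apply/eqP; rewrite -leqn0.
rewrite /=; have [->|n1] := eqVneq n 1%N.
  case: z => [[]|z1 z2]; rewrite inE ?eqxx //=.
  have -> : (word_wt (fun=> 1%N) z1 + word_wt (fun=> 1%N) z2 == 1%N) = false.
    by rewrite gtn_eqF //; exact: leq_add (pos z1) (pos z2).
  by apply/eqP.
apply/allpairsPdep/eqP => [[i [[a b] [hi /allpairsP[[a' b'] /= [ha hb [-> ->]]] ->]]]|].
  rewrite mem_iota in hi; move: ha hb => /=.
  by rewrite !IH; [move=> /eqP -> /eqP ->|..]; lia.
case: z => [t|z1 z2] /= zn; first by rewrite -zn in n1.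
have p1 := pos z1; have p2 := pos z2.
exists (word_wt (fun=> 1%N) z1), (z1, z2); split=> //.
  by rewrite mem_iota; lia.
apply/allpairsP; exists (z1, z2); split=> //=; rewrite IH ?eqxx //; try lia.
Qed.

Lemma uniq_word_list k n : (n <= k)%N -> uniq (word_list k n).
Proof.
elim: k n => [|k IH] n nk //=; case: eqVneq => // n1.
apply: allpairs_uniq_dep => [|i hi|]; first exact: iota_uniq.
  rewrite mem_iota in hi; apply: allpairs_uniq; try (apply: IH; lia).
  by move=> [a b] [a' b'] _ _ /= [-> ->].
move=> [i [a b]] [i' [a' b']] /allpairsPdep[j [p [hj hp [-> ->]]]].
move=> /allpairsPdep[j' [p' [hj' hp' [-> ->]]]] /= [e1 e2].
move: hj hj'; rewrite !mem_iota => hj hj'.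
case/allpairsP: hp e1 e2 => -[c d] [/= hc hd ->].
case/allpairsP: hp' => -[c' d'] [/= hc' hd' ->] /= e1 e2.
subst c' d'; move: hc hc'; rewrite !mem_word_list; [|lia|lia].
by move=> /eqP -> /eqP ->.
Qed.

Definition word_count n := size (word_list n n).

Lemma size_word_list k n : (n <= k)%N -> size (word_list k n) = word_count n.
Proof.
move=> nk; apply: perm_size; apply: uniq_perm; try exact: uniq_word_list.
by move=> z; rewrite !mem_word_list.
Qed.

Lemma word_count0 : word_count 0 = 0%N. Proof. by []. Qed.
Lemma word_count1 : word_count 1 = 1%N. Proof. by []. Qed.

Lemma word_count_rec n : (1 < n)%N ->
  word_count n = (\sum_(1 <= i < n) word_count i * word_count (n - i))%N.
Proof.
case: n => [|n] // n1; rewrite {1}/word_count /= (gtn_eqF n1) size_allpairs_dep.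
rewrite sumnE big_map /index_iota subn1 /= [LHS]big_seq [RHS]big_seq.
apply: eq_bigr => i; rewrite mem_iota => hi.
by rewrite size_allpairs !size_word_list //; lia.
Qed.

Lemma word_count_mono n : (1 < n)%N -> (word_count n <= word_count n.+1)%N.
Proof.
move=> n1; rewrite [X in (_ <= X)%N]word_count_rec; last exact: ltnW.
rewrite big_nat_recr; last exact: ltnW.
by rewrite subSnn word_count1 muln1; apply: leq_addl.
Qed.

Lemma word_count_conv n :
  word_count n = ((n == 1) + \sum_(i < n.+1) word_count i * word_count (n - i))%N.
Proof.
case: n => [|[|n]]; [by rewrite !big_ord_recl big_ord0..|].
rewrite word_count_rec // -(big_mkord predT (fun i => word_count i * word_count (n.+2 - i))%N).
by rewrite [in RHS]big_nat_recr // [in RHS]big_ltn // subnn word_count0 mul0n muln0 [in RHS]/= addn0 !add0n.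
Qed.

Section UnaryDimension.
Variables (K : closedFieldType) (u : bool) (F : nalgType u K) (x y : F).
Hypothesis freeF : free_on (fun _ : napoly K nat => False) (pair_gen x y).
Notation v := (pair_gen x y).

Lemma unary_dim n : (0 < n)%N ->
  has_dim (homogeneous (fun _ : unit => x) n) (word_count n).
Proof.
move=> n0; pose W := word_list n n.
have mem_W z : (z \in W) = (word_wt (fun=> 1%N) z == n) by apply: mem_word_list.
pose wd (i : 'I_(word_count n)) : word unit := nth (Letter tt) W i.
have wcoef_wd (i j : 'I_(word_count n)) :
    wcoef freeF (word_eval (fun _ : unit => x) (wd i))
      (Some (word_map (fun=> false) (wd j))) = (i == j)%:R.
  have := mono_eval_map (fun=> false) v (Some (wd i)) => /= <-.
  rewrite wcoef_word; congr ((nat_of_bool _)%:R).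
  have inj : injective (word_map (fun _ : unit => false)).
    by elim=> [[]|z1 h1 z2 h2] [[]|z1' z2'] //= [/h1 -> /h2 ->].
  rewrite (inj_eq (@Some_inj _)) (inj_eq inj) nth_uniq ?ltn_ord ?uniq_word_list //.
  by rewrite eq_sym.
exists (fun i => word_eval (fun _ : unit => x) (wd i)); split=> [a a0 i|f].
  have := wcoef0 freeF (Some (word_map (fun=> false) (wd i))).
  rewrite -a0 wcoef_sum (bigD1 i) //= wcoefZ wcoef_wd eqxx mulr1 big1 ?addr0 // => j ji.
  by rewrite wcoefZ wcoef_wd (negPf ji) mulr0.
split=> [[p hp ->]|[a ->]].
  have [s sn ->] : exists2 s, all (fun i => (tot_deg i.2 == n)%N) s &
      napoly_eval (fun _ : unit => x) p = lin (fun _ : unit => x) s.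
    apply/(mspan_napoly (A := F) _ (fun z => tot_deg z == n)%N).
    by exists p => // z /hp ->.
  elim: s sn => [|[k m] s IH] /=.
    by exists (fun=> 0); rewrite /lin big_nil big1 // => i _; rewrite scale0r.
  case/andP=> mn /IH[a aE]; rewrite /lin big_cons -/(lin _ _) aE.
  case: m mn => [z|] /=; last by rewrite eq_sym (gtn_eqF n0).
  rewrite -[word_deg _ _]/(mono_deg predT (Some z)) -wt1 /= -mem_W => zW.
  have iz : (index z W < word_count n)%N by rewrite index_mem.
  exists (fun i => (i == Ordinal iz)%:R * k + a i).
  under [RHS]eq_bigr do rewrite scalerDl.
  rewrite big_split /=; congr (_ + _).
  rewrite (bigD1 (Ordinal iz)) //= eqxx mul1r {1}/wd /= (nth_index (Letter tt) zW).
  by rewrite big1 ?addr0 // => i /negPf ->; rewrite mul0r scale0r.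
have [|p hp pE] := (mspan_napoly (A := F) (fun _ : unit => x) (fun z => tot_deg z == n)%N
    (\sum_i a i *: word_eval (fun _ : unit => x) (wd i))).2; last first.
  by exists p => // z /hp/eqP.
exists [seq (a i, Some (wd i)) | i <- enum 'I_(word_count n)].
  apply/allP => _ /mapP[i _ ->] /=.
  have : wd i \in W by rewrite mem_nth.
  by rewrite mem_W -[word_wt _ _]/(wt (fun=> 1%N) (Some (wd i))) wt1.
by rewrite /lin big_map big_enum.
Qed.

End UnaryDimension.

(** * The theorem *)

Section Main.
Variables (K : closedFieldType) (u : bool) (I : napoly K nat -> Prop).
Variables (F : nalgType u K) (x y : F).
Hypothesis freeF : free_on I (pair_gen x y).
Variable c : nat -> nat.
Hypothesis c_dim : forall n, (0 < n)%N ->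
  has_dim (homogeneous (fun _ : unit => x) n) (c n).
Hypotheses (c1 : c 1%N = 1%N) (c2 : c 2%N = 1%N).
Hypothesis c_mono : forall n, (1 < n)%N -> (c n <= c n.+1)%N.

Lemma generator_neq0 : x != 0.
Proof.
have := c_dim (ltn0Sn 0); rewrite c1 => -[b hb]; apply/eqP => x0.
have /(unary_homogeneousP freeF)[bx b1] := is_basis_mem 0 hb.
have [al [be bE]] := sp_linear (wcomp_sp freeF (fun=> 1%N) 1 (b 0)).
have b0 : b 0 = 0.
  rewrite -bx -b1 bE apD !apZ ap_id /unary (subst_v freeF _ true) -scalerDl.
  by rewrite [X in _ *: X]x0 scaler0.
have := hb.1 (fun=> 1) _ 0; rewrite big_ord1 b0 scaler0 => /(_ erefl)/eqP.
by rewrite oner_eq0.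
Qed.

Lemma zdim_aut_points n N (b : 'I_N -> F) : free_criterion freeF -> (0 < n)%N ->
  homog_basis x y n b -> zdim (aut_points x y n b) (dimH u c n).
Proof.
move=> crit n0 hb; split=> [|k].
  exact: (lower_bound freeF generator_neq0 c_dim).
exact: (upper_bound crit generator_neq0 c_dim).
Qed.

End Main.

(** The Catalan numbers [word_count] satisfy [C = t + C ^ 2], so that
    [(1 - 2 C) ^ 2 = 1 - 4 t]. *)
Definition sqrt_series (n : nat) : rat := (n == 0%N)%:R - 2%:R * (word_count n)%:R.

Lemma sqrt_seriesP : is_sqrt_1_4t sqrt_series.
Proof.
split=> [|n]; first by rewrite /sqrt_series word_count0 mulr0 subr0.
have conv : \sum_(i < n.+1) (word_count i)%:R * (word_count (n - i))%:R =
    (word_count n)%:R - (n == 1)%:R :> rat.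
  rewrite [in RHS]word_count_conv natrD addrC addKr natr_sum.
  by apply: eq_bigr => i _; rewrite natrM.
have e1 : \sum_(i < n.+1) (i == 0 :> nat)%:R * sqrt_series (n - i) = sqrt_series n.
  rewrite big_ord_recl /= mul1r subn0 big1 ?addr0 // => i _.
  by rewrite mul0r.
have e2 : \sum_(i < n.+1) (word_count i)%:R * (n - i == 0)%N%:R = (word_count n)%:R :> rat.
  rewrite big_ord_recr /= subnn eqxx mulr1 big1 ?add0r // => i _.
  by rewrite subn_eq0 leqNgt ltn_ord mulr0.
rewrite /fps_mul; under eq_bigr do rewrite {1}/sqrt_series mulrBl.
rewrite sumrB e1.
have -> : \sum_(i < n.+1) 2%:R * (word_count i)%:R * sqrt_series (n - i) =
    2%:R * (word_count n)%:R - 4%:R * ((word_count n)%:R - (n == 1%N)%:R).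
  rewrite -{1}e2 -conv !mulr_sumr -sumrB; apply: eq_bigr => i _.
  by rewrite /sqrt_series; ring.
rewrite /sqrt_series /fps_poly coefB coef1 coefZ coefX.
by ring.
Qed.

Lemma generating_function u n :
  fps_mul (fps_poly (2%:R * (1 - 'X)))
    (fun k => if (0 < k)%N then (dimH u word_count k + (k == 1))%N%:R else 0) n
  = fps_poly (1 + (4 * (2 + u))%:R *: 'X) n - sqrt_series n.
Proof.
pose D k : rat := if (0 < k)%N then (csum word_count k + 4 + 2 * u)%N%:R else 0.
have DE k : (if (0 < k)%N then (dimH u word_count k + (k == 1))%N%:R else 0) = D k.
  rewrite /D /dimH; case: k => // k /=; congr (_%:R).
  by rewrite subnK //; case: k => //=; lia.
have coefE i : fps_poly (2%:R * (1 - 'X)) i = 2%:R * ((i == 0%N)%:R - (i == 1%N)%:R).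
  by rewrite /fps_poly !mulr_natl coefMn coefB coef1 coefX.
rewrite /fps_mul; under eq_bigr do rewrite DE coefE.
rewrite /fps_poly coefD coef1 coefZ coefX /sqrt_series.
case: n => [|[|n]].
- by rewrite big_ord1 /D /= ?(mulr0, addr0, subr0, subrr).
- rewrite !big_ord_recl big_ord0 /D /= /csum big_nat1 word_count1.
  by rewrite ?(natrM, natrD) /=; ring.
rewrite big_ord_recl big_ord_recl big1 => [|i _]; last by rewrite /= subrr mulr0 mul0r.
rewrite /D /= subn0 subn1 /= /csum (big_nat_recr n.+2) //= !natrD.
ring.
Qed.

(* The terms [(n == 1)] and [(k == 1)] correct the degree one case: the linear
   (affine if [u]) automorphisms form an open subset of the whole affine space
   of dimension [4 + 2 * u], one less than [c 1 + 4 + 2 * u]. *)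
Theorem theorem2p1 (K : closedFieldType) (u : bool) :
  (forall (I : napoly K nat -> Prop) (F : nalgType u K) (x y : F)
          (c : nat -> nat),
     homogeneous_system u I ->
     nielsen_schreier u I ->
     free_on I (pair_gen x y) ->
     (forall n, (0 < n)%N -> has_dim (homogeneous (fun _ : unit => x) n) (c n)) ->
     c 1%N = 1%N -> c 2%N = 1%N ->
     (forall n, (1 < n)%N -> (c n <= c n.+1)%N) ->
     forall (n N : nat) (b : 'I_N -> F), (0 < n)%N -> homog_basis x y n b ->
       zdim (aut_points x y n b)
            (\sum_(1 <= i < n.+1) c i + 4 + 2 * u - (n == 1))%N)
  /\
  (forall (F : nalgType u K) (x y : F)
          (N : nat -> nat) (b : forall n, 'I_(N n) -> F),
     free_on (fun _ : napoly K nat => False) (pair_gen x y) ->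
     (forall n, homog_basis x y n (b n)) ->
     exists (d : nat -> nat) (s : nat -> rat),
       [/\ forall n, (0 < n)%N -> zdim (aut_points x y n (b n)) (d n),
           is_sqrt_1_4t s
         & forall n,
             fps_mul (fps_poly (2%:R * (1 - 'X)))
                     (fun k => if (0 < k)%N then (d k + (k == 1))%N%:R else 0) n
             = fps_poly (1 + (4 * (2 + u))%:R *: 'X) n - s n]).
Proof.
split=> [I F x y c _ NS freeF c_dim c1 c2 c_mono n N b n0 hb|F x y N b freeF hb].
  by apply: (zdim_aut_points (freeF := freeF) c_dim) => //; apply: nielsen_schreier_criterion NS.
exists (dimH u word_count), sqrt_series; split.
- move=> n n0; apply: (zdim_aut_points (freeF := freeF)) => //.
  + exact: unary_dim freeF.
  + exact: word_count_mono.
  + exact: free_criterion_absolute.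
- exact: sqrt_seriesP.
- exact: generating_function.
Qed.
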